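(* Let $f,g$ be holomorphic functions defined near the origin of $\mathbb C^n$ ($n\ge2$) with $f(\mathbf 0)=g(\mathbf 0)=0$, and let $H(\mathbf z,\bar{\mathbf z})=f(\mathbf z)\overline{g(\mathbf z)}$. Assume (n1), (n2) and the Newton multiplicity condition. For $r>0$ put $K=H^{-1}(0)\cap S_r^{2n-1}$ and $\varphi:S_r^{2n-1}\setminus K\to S^1$, $\varphi(\mathbf z)=H(\mathbf z)/|H(\mathbf z)|$. Then there exist positive numbers $r_3$ and $r_2$ such that - for every $0<r\le r_3$ the map $\varphi:S_r^{2n-1}\setminus K\to S^1$ has no critical points; - $r_2\le r_1$ for some $0<r_1\le r_0$ for which $0$ is the only critical value of $H$ restricted to $B_{r_1}^{2n}$ ($r_0$ as in the context); and for any such $r_2,r_3$ and any $r$ with $0<r\le\min\{r_3,r_2\}$, the map $\varphi:S_r^{2n-1}\setminus K\to S^1$ is a locally trivial fibration.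
   Context: $S_r^{2n-1}$ and $B_r^{2n}$ are the sphere and closed ball of radius $r$ centered at the origin of $\mathbb C^n$. $V(f)=f^{-1}(0)$, $V(g)=g^{-1}(0)$, $V(f,g)=V(f)\cap V(g)$. $r_0>0$ is a fixed number such that $V(f),V(g),V(f,g)$ are singular at most at the origin in $B_{r_0}^{2n}$ and every sphere $S_r^{2n-1}$, $0<r\le r_0$, is transverse to them. $H$ is regarded as a real analytic map to $\mathbb R^2=\mathbb C$; critical points are points where the real differential has rank $<2$. Newton data: for $f=\sum_\nu a_\nu\mathbf z^\nu$, $\Gamma_+(f)$ is the convex hull of $\bigcup_{a_\nu\neq0}(\nu+\mathbb R_{\ge0}^n)$, and the Newton boundary $\Gamma(f)$ is the union of the compact faces of $\Gamma_+(f)$. $f$ is convenient if $\Gamma(f)$ meets every coordinate axis. For a weight vector $P=(p_1,\dots,p_n)$ (integers $p_i\ge0$, not all zero), $d(P;f)$ is the minimum of $\sum p_i\nu_i$ over $\nu\in\Gamma_+(f)$, and $f_P=\sum a_\nu\mathbf z^\nu$, summed over $\nu$ with $\sum p_i\nu_i=d(P;f)$. $P$ is strictly positive if all $p_i>0$. $f$ is non-degenerate if for each strictly positive $P$, $f_P$ has no critical point on $\{f_P=0\}\cap(\mathbb C^* )^n$. (n1): $f$ and $g$ are convenient and non-degenerate. (n2): $V(f,g)$ is a non-degenerate complete intersection: for each strictly positive $P$, $df_P$ and $dg_P$ are linearly independent at every point of $\{f_P=g_P=0\}\cap(\mathbb C^* )^n$. Newton multiplicity condition: $d(P;f)\ne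 d(P;g)$ for every strictly positive weight vector $P$. *)

(* Defs.v *)
From HB Require Import structures.
From mathcomp Require Import all_boot all_order all_algebra.
From mathcomp Require Import all_classical all_reals all_analysis.
From mathcomp Require Import finmap complex summability.

Set Implicit Arguments.
Unset Strict Implicit.
Unset Printing Implicit Defensive.

Import Order.TTheory GRing.Theory Num.Theory.
Import numFieldNormedType.Exports.

Local Open Scope classical_set_scope.
Local Open Scope complex_scope.
Local Open Scope ring_scope.

(* The field of complex numbers over R. The library puts a topology, and the
   structure of a normed module over itself, on the carrier of any numFieldType
   but not on the bare type R[i], which this carrier is convertible to. *)
Definition complexField (R : realType) : numFieldType := R[i].

Section PowerSeries.
Variables (R : realType) (n : nat).
Local Notation C := (complexField R).

Definition multi_index := {ffun 'I_n -> nat}.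

Definition monomial (nu : multi_index) (z : 'rV[C]_n) : C :=
  \prod_(j < n) z 0 j ^+ nu j.

(* The convergence is unconditional, over the finite sets of multi-indices. *)
Definition has_power_series (f : 'rV[C]_n -> C) (p : 'rV[C]_n)
    (a : multi_index -> C) : Prop :=
  \forall z \near p,
    partial_sum (fun nu => a nu * monomial nu (z - p)) @ totally --> f z.

Definition holomorphic_on (U : set 'rV[C]_n) (f : 'rV[C]_n -> C) :=
  forall p, U p -> exists a, has_power_series f p a.

End PowerSeries.

(* In this section a is the family of Taylor coefficients at the origin of a
   germ f = \sum_nu a_nu z^nu. *)
Section Newton.
Variables (R : realType) (n : nat).
Local Notation C := (complexField R).
Implicit Types (a b : multi_index n -> C) (P : {ffun 'I_n -> nat}).

Definition convex_hull (A : set 'rV[R]_n) : set 'rV[R]_n :=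
  smallest (@convex_set R 'rV[R]_n) A.

Definition newton_polyhedron a : set 'rV[R]_n :=
  convex_hull
    [set x | exists2 nu, a nu != 0 & forall j, (nu j)%:R <= x 0 j].

Definition dot (l x : 'rV[R]_n) : R := \sum_(j < n) l 0 j * x 0 j.

(* The nonempty faces of A: the loci where a linear form is minimal on A. *)
Definition face (A F : set 'rV[R]_n) : Prop :=
  F !=set0 /\
  exists l, F = [set x | A x /\ forall y, A y -> dot l x <= dot l y].

Definition newton_boundary a : set 'rV[R]_n :=
  \bigcup_(F in [set F | face (newton_polyhedron a) F /\ compact F]) F.

Definition convenient a : Prop :=
  forall i : 'I_n, exists2 x, newton_boundary a x &
    forall j, j != i -> x 0 j = 0.

Definition strictly_positive P : Prop := forall j, (0 < P j)%N.

Definition nat_row (nu : {ffun 'I_n -> nat}) : 'rV[R]_n :=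
  \row_j (nu j)%:R.

(* The infimum is a minimum as soon as a is not identically zero. *)
Definition newton_deg P a : R :=
  inf [set dot (nat_row P) x | x in newton_polyhedron a].

(* The index set is finite when P is strictly positive; otherwise the sum may
   take the default value 0. *)
Definition face_function P a (z : 'rV[C]_n) : C :=
  \sum_(nu \in [set nu | dot (nat_row P) (nat_row nu) = newton_deg P a])
    a nu * monomial nu z.

Definition torus : set 'rV[C]_n := [set z | forall j, z 0 j != 0].

Definition non_degenerate a : Prop :=
  forall P, strictly_positive P ->
  forall z, torus z -> face_function P a z = 0 ->
  ~ (forall v, 'd (face_function P a) z v = 0).

Definition lin_indep (l m : 'rV[C]_n -> C) : Prop :=
  forall s t : C, (forall v, s * l v + t * m v = 0) -> s = 0 /\ t = 0.

Definition non_degenerate_complete_intersection a b : Prop :=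
  forall P, strictly_positive P ->
  forall z, torus z -> face_function P a z = 0 -> face_function P b z = 0 ->
  lin_indep ('d (face_function P a) z) ('d (face_function P b) z).

Definition newton_multiplicity_condition a b : Prop :=
  forall P, strictly_positive P -> newton_deg P a <> newton_deg P b.

End Newton.

Section Real.
Variable R : realType.
Local Notation C := (complexField R).

Definition reim (c : C) : 'rV[R]_2 :=
  \row_k (if k == 0 then complex.Re c else complex.Im c).

Variable n : nat.
Implicit Types (z v : 'rV[C]_n) (F : 'rV[C]_n -> C).

Definition to_real z : 'rV[R]_(n + n) :=
  row_mx (map_mx (@complex.Re R) z) (map_mx (@complex.Im R) z).

Definition of_real (w : 'rV[R]_(n + n)) : 'rV[C]_n :=
  \row_j (w 0 (lshift n j) +i* w 0 (rshift n j)).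

(* The 2n x 2 Jacobian matrix at z of F : R^2n -> R^2, acting on rows. *)
Definition real_jacobian F z : 'M[R]_(n + n, 2) :=
  'J (fun w => reim (F (of_real w))) (to_real z).

(* The library norm of 'rV[C]_n is the sup norm, hence the explicit sums. *)
Definition sphere_of (r : R) : set 'rV[C]_n :=
  [set z | \sum_(j < n) `|z 0 j| ^+ 2 = (r ^+ 2)%:C].

Definition closed_ball_of (r : R) : set 'rV[C]_n :=
  [set z | \sum_(j < n) `|z 0 j| ^+ 2 <= (r ^+ 2)%:C].

Definition tangent_sphere z : set 'rV[C]_n :=
  [set v | to_real z *m (to_real v)^T = 0].

Definition unit_circle : set C := [set c | `|c| = 1].

Definition tangent_circle (c : C) : set 'rV[R]_2 :=
  [set u | reim c *m u^T = 0].

End Real.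

Section LocallyTrivial.
Variables X Y : topologicalType.

(* p : E -> B is a topological fibre bundle with typical fibre T; over W, the
   maps x |-> (p x, h x) and k are mutually inverse homeomorphisms between
   E `&` p @^-1` W and (B `&` W) `*` T. *)
Definition locally_trivial_fibration (E : set X) (B : set Y) (p : X -> Y) :=
  {within E, continuous p} /\ p @` E = B /\
  exists T : topologicalType, forall c, B c ->
    exists W : set Y, [/\ open W, W c &
      exists (h : X -> T) (k : Y * T -> X),
        [/\ {within E `&` p @^-1` W, continuous h},
            {within (B `&` W) `*` [set: T], continuous k},
            forall x, E x -> W (p x) -> k (p x, h x) = x &
            forall y t, B y -> W y ->
              [/\ E (k (y, t)), p (k (y, t)) = y & h (k (y, t)) = t]]].

End LocallyTrivial.

Section MixedFunction.
Variables (R : realType) (n : nat).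
Local Notation C := (complexField R).
Variable U : set 'rV[C]_n.
Variables f g : 'rV[C]_n -> C.

(* A linear subspace V of tangent vectors is transverse to the sphere at z. *)
Definition transverse_at (V : set 'rV[C]_n) (z : 'rV[C]_n) : Prop :=
  forall w, exists u v, [/\ V u, tangent_sphere z v & w = u + v].

(* f, g are defined on U; V(f), V(g), V(f,g) are singular at most at the origin
   in the ball of radius r0 and meet transversally every sphere inside it.
   Off the origin the tangent spaces of these varieties are the kernels of df,
   dg and (df, dg). *)
Definition admissible_radius (r0 : R) : Prop :=
  [/\ 0 < r0,
      closed_ball_of r0 `<=` U,
      forall z, closed_ball_of r0 z -> z <> 0 ->
        [/\ f z = 0 -> ~ (forall v, 'd f z v = 0),
            g z = 0 -> ~ (forall v, 'd g z v = 0) &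
            f z = 0 -> g z = 0 -> lin_indep ('d f z) ('d g z)] &
      forall r z, 0 < r <= r0 -> sphere_of r z ->
        [/\ f z = 0 -> transverse_at [set v | 'd f z v = 0] z,
            g z = 0 -> transverse_at [set v | 'd g z v = 0] z &
            f z = 0 -> g z = 0 ->
              transverse_at [set v | 'd f z v = 0 /\ 'd g z v = 0] z]].

Definition mixed (z : 'rV[C]_n) : C := f z * conjc (g z).

Definition critical_mixed (z : 'rV[C]_n) : Prop :=
  (\rank (real_jacobian mixed z) < 2)%N.

Definition zero_only_critical_value (r1 : R) : Prop :=
  [set mixed z | z in [set z | closed_ball_of r1 z /\ critical_mixed z]]
  = [set 0].

Definition milnor_domain (r : R) : set 'rV[C]_n :=
  sphere_of r `\` (sphere_of r `&` mixed @^-1` [set 0]).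

Definition milnor_map (z : 'rV[C]_n) : C := mixed z / `|mixed z|.

(* milnor_map is smooth near every point of milnor_domain r; the differential
   of its restriction T_z S_r -> T S^1 is the restriction of its Jacobian. *)
Definition critical_milnor (z : 'rV[C]_n) : Prop :=
  ~ (forall u, tangent_circle (milnor_map z) u ->
     exists2 v, tangent_sphere z v &
       u = to_real v *m real_jacobian milnor_map z).

Definition no_critical_points_upto (r3 : R) : Prop :=
  closed_ball_of r3 `<=` U /\
  forall r, 0 < r <= r3 -> forall z, milnor_domain r z -> ~ critical_milnor z.

Definition below_regular_radius (r0 r2 : R) : Prop :=
  exists r1, [/\ 0 < r1, r1 <= r0, zero_only_critical_value r1 & r2 <= r1].

End MixedFunction.

(* Main.v *)
(* The critical points of phi and of H off H = 0 satisfy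
     z_j d_jf / f - mu z_j d_jg / g = i lam |z_j|^2   for all j,
   with |mu| = 1 and lam real, where mu = 1 for phi and lam = 0 for H. If such
   points accumulated at 0, then along an ultrafilter of them the sizes
   -ln |z_j| would select a strictly positive weight P and a point b of the torus
   such that f, g, z_j d_jf and z_j d_jg, divided by dominant monomials, converge
   to the corresponding quantities of f_P and g_P at b. If f_P and g_P both vanish
   at b, the limit equation contradicts (n2); if exactly one vanishes, it
   contradicts the non-degeneracy of f or g; otherwise Euler's identity gives
   d(P;f) = d(P;g).
   For the fibration, the transversality of S_r to V(f), V(g) and V(f,g), together
   with the absence of critical points of phi, makes the linear system
     Re <v, z> = 0,  df(v) = A f,  dg(v) = B g,  Im (A - B) = 1
   in (v, A, B) solvable by a Lipschitz field v on the whole compact sphere S_r,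
   including K. Its flow Phi preserves K and satisfies phi (Phi_t z) = e^{it} phi z,
   and its flow lines trivialize phi over half circles. *)

(* No curve through the bad points is selected, and no coordinate subspace is split off when
   coordinates vanish. An ultrafilter makes all bounded quotients converge at once, and convenience
   provides axis monomials that dominate every change caused by making zero coordinates nonzero. The
   sizes of the coordinates need not be powers of one parameter; the integral weight is therefore
   extracted by rational linear algebra from the finitely many monomial quotients that matter. The
   obstacle in the limit is that [f] and [g] may be much smaller than their dominant monomials, so
   that the relation cannot be divided by them. It is multiplied by [u * v / (|u| + |v|)], where [u]
   and [v] are the normalised values. The right-hand sides then share one phase; as the weights are
   positive, a vanishing weighted sum forces each of them to vanish, and this removes the unknown
   [lam]. For the fibration the obstacle is that the domain of phi is not compact, so that lifted
   vector fields might not be complete. Prescribing the logarithmic derivatives of [f] and [g]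
   separately, instead of that of the phase, is what lets the field cross [K]. *)
From HB Require Import structures.
Require Import Defs.
From mathcomp Require Import all_boot all_order all_algebra.
From mathcomp Require Import all_classical all_reals all_analysis.
From mathcomp Require Import finmap complex summability.
From mathcomp Require Import zify ring lra.

Set Implicit Arguments.
Unset Strict Implicit.
Unset Printing Implicit Defensive.

Import Order.TTheory GRing.Theory Num.Theory.
Import numFieldNormedType.Exports.

Local Open Scope classical_set_scope.
Local Open Scope ring_scope.

#[local] Existing Instance totally_filter.

(** * Norms and sums over the complex numbers *)

Section RealNorm.
Variable R : realType.
Local Notation C := (complexField R).

(* The library norm of a normed space over C takes its values in C. *)
Definition rnorm (V : normedZmodType C) (x : V) : R := complex.Re `|x|.

Lemma normE (V : normedZmodType C) (x : V) : `|x| = (rnorm x)%:C%C.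
Proof. by rewrite /rnorm RRe_real // ger0_real. Qed.

Lemma rnorm_ge0 (V : normedZmodType C) (x : V) : 0 <= rnorm x.
Proof. by have := normr_ge0 x; rewrite normE ler0c. Qed.

Lemma rnormD (V : normedZmodType C) (x y : V) :
  rnorm (x + y) <= rnorm x + rnorm y.
Proof. by have := ler_normD x y; rewrite !normE -rmorphD /= lecR. Qed.

Lemma rnormN (V : normedZmodType C) (x : V) : rnorm (- x) = rnorm x.
Proof. by rewrite /rnorm normrN. Qed.

Lemma rnormB (V : normedZmodType C) (x y : V) : rnorm (x - y) = rnorm (y - x).
Proof. by rewrite /rnorm distrC. Qed.

Lemma rnorm0 (V : normedZmodType C) : rnorm (0 : V) = 0.
Proof. by rewrite /rnorm normr0. Qed.

Lemma rnorm_eq0 (V : normedZmodType C) (x : V) : (rnorm x == 0) = (x == 0).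
Proof.
by rewrite -(normr_eq0 x) normE; apply/eqP/eqP => [->|[]].
Qed.

Lemma rnorm_gt0 (V : normedZmodType C) (x : V) : (0 < rnorm x) = (x != 0).
Proof. by rewrite lt_neqAle rnorm_ge0 andbT eq_sym rnorm_eq0. Qed.

Lemma rnorm_sum (V : normedZmodType C) (I : Type) (s : seq I) (P : pred I)
    (F : I -> V) :
  rnorm (\sum_(i <- s | P i) F i) <= \sum_(i <- s | P i) rnorm (F i).
Proof.
elim/big_rec2: _ => [|i y1 y2 _ le12]; first by rewrite rnorm0.
by rewrite (le_trans (rnormD _ _)) // lerD2l.
Qed.

Lemma rnormM (x y : C) : rnorm (x * y) = rnorm x * rnorm y.
Proof. by have := normrM x y; rewrite !normE -rmorphM => /complexI. Qed.

Lemma rnorm1 : rnorm (1 : C) = 1.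
Proof. by rewrite /rnorm normr1. Qed.

Lemma rnormX (x : C) k : rnorm (x ^+ k) = rnorm x ^+ k.
Proof. by elim: k => [|k IH]; rewrite ?exprS ?rnormM ?IH // !expr0 rnorm1. Qed.

Lemma rnormV (x : C) : rnorm x^-1 = (rnorm x)^-1.
Proof.
have [->|x0] := eqVneq x 0; first by rewrite invr0 rnorm0 invr0.
have : rnorm (x^-1 * x) = 1 by rewrite mulVf // rnorm1.
rewrite rnormM => h; apply: (@mulIf _ (rnorm x)); first by rewrite rnorm_eq0.
by rewrite h mulVf // rnorm_eq0.
Qed.

Lemma rnorm_prod (I : Type) (s : seq I) (P : pred I) (F : I -> C) :
  rnorm (\prod_(i <- s | P i) F i) = \prod_(i <- s | P i) rnorm (F i).
Proof.
by elim/big_rec2: _ => [|i y1 y2 _ le12]; rewrite ?rnorm1 // rnormM le12.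
Qed.

Lemma rnorm_real (x : R) : rnorm (x%:C%C : C) = `|x|.
Proof.
apply: complexI; rewrite -normE.
by rewrite normc_def /= expr0n addr0 sqrtr_sqr.
Qed.

Lemma rnorm_nat k : rnorm (k%:R : C) = k%:R.
Proof.
have -> : (k%:R : C) = (k%:R : R)%:C%C by rewrite rmorph_nat.
by rewrite rnorm_real normr_nat.
Qed.

Lemma rnormE (x : C) : rnorm x = Num.sqrt (complex.Re x ^+ 2 + complex.Im x ^+ 2).
Proof. by rewrite /rnorm normc_def. Qed.

Lemma rnorm_sqr (x : C) : rnorm x ^+ 2 = complex.Re x ^+ 2 + complex.Im x ^+ 2.
Proof. by rewrite rnormE sqr_sqrtr // addr_ge0 ?sqr_ge0. Qed.

Lemma Re_le_rnorm (x : C) : `|complex.Re x| <= rnorm x.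
Proof.
rewrite rnormE -(sqrtr_sqr (complex.Re x)) ler_wsqrtr // lerDl; exact: sqr_ge0.
Qed.

Lemma Im_le_rnorm (x : C) : `|complex.Im x| <= rnorm x.
Proof.
rewrite rnormE -(sqrtr_sqr (complex.Im x)) ler_wsqrtr // lerDr; exact: sqr_ge0.
Qed.

Lemma rnorm_le_ReIm (x : C) : rnorm x <= `|complex.Re x| + `|complex.Im x|.
Proof.
rewrite -(@ler_pXn2r _ 2) ?nnegrE ?rnorm_ge0 ?addr_ge0 //.
rewrite rnorm_sqr sqrrD !real_normK ?num_real // -addrA lerD2l lerDr.
by rewrite mulrn_wge0 // mulr_ge0.
Qed.

(** Balls have radii in C, but a positive complex number is real, so its real part serves as radius.
    Every epsilon below is therefore a real number. *)
Lemma rnorm_near (V : normedModType C) (p : V) (P : V -> Prop) :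
  (\forall z \near p, P z) <->
  exists2 e : R, 0 < e & forall z, rnorm (z - p) < e -> P z.
Proof.
split=> [/nbhs_ballP[e /= e0 h]|[e e0 h]].
  exists (complex.Re e).
    by move: e0; rewrite ltcE => /andP[].
  move=> z zp; apply: h; rewrite -ball_normE /= distrC normE.
  by move: e0 zp; rewrite !ltcE /= => /andP[/eqP-> _] ->; rewrite eqxx.
apply/nbhs_ballP; exists (e%:C%C); first by rewrite /= ltcR.
by move=> z; rewrite -ball_normE /= distrC normE ltcR; exact: h.
Qed.

Lemma cvg_rnorm (T : Type) (F : set_system T) {FF : Filter F}
    (V : normedModType C) (u : T -> V) (l : V) :
  u @ F --> l -> forall e : R, 0 < e -> \forall x \near F, rnorm (u x - l) < e.
Proof.
move=> ul e e0; apply: (ul [set z | rnorm (z - l) < e]).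
by apply/rnorm_near; exists e.
Qed.

Lemma rnorm_cvg (T : Type) (F : set_system T) {FF : Filter F}
    (V : normedModType C) (u : T -> V) (l : V) :
  (forall e : R, 0 < e -> \forall x \near F, rnorm (u x - l) < e) -> u @ F --> l.
Proof.
move=> h A; move/(proj1 (@rnorm_near V l A)) => [e e0 he].
by apply: filterS (h e e0) => x /he.
Qed.

Section Limits.
Variables (T : Type) (F : set_system T) (FF : Filter F).
Implicit Types (u v : T -> C) (k l : C).

Lemma ccvgD u v k l : u @ F --> k -> v @ F --> l ->
  (fun x => u x + v x) @ F --> k + l.
Proof. exact: (@cvgD C C T F FF u v k l). Qed.

Lemma ccvgB u v k l : u @ F --> k -> v @ F --> l ->
  (fun x => u x - v x) @ F --> k - l.
Proof. exact: (@cvgB C C T F FF u v k l). Qed.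

Lemma ccvgM u v k l : u @ F --> k -> v @ F --> l ->
  (fun x => u x * v x) @ F --> k * l.
Proof. exact: (@cvgM C T F FF u v k l). Qed.

Lemma ccvg_cst k : (fun=> k) @ F --> k.
Proof. exact: (@cvg_cst _ k T F FF). Qed.

Lemma ccvgMl u k l : u @ F --> l -> (fun x => k * u x) @ F --> k * l.
Proof. by move=> h; apply: ccvgM h; exact: ccvg_cst. Qed.

Lemma ccvg_sum (I : Type) (s : seq I) (G : I -> T -> C) (l : I -> C) :
  (forall i, G i @ F --> l i) ->
  (fun x => \sum_(i <- s) G i x) @ F --> \sum_(i <- s) l i.
Proof.
move=> h; elim: s => [|i s IH].
  by rewrite big_nil; under eq_fun do rewrite big_nil; exact: ccvg_cst.
by rewrite big_cons; under eq_fun do rewrite big_cons; exact: ccvgD (h i) IH.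
Qed.
End Limits.

Section Rows.
Variable n : nat.
Implicit Types z : 'rV[C]_n.

Lemma rnorm_coord z j : rnorm (z 0 j) <= rnorm z.
Proof.
rewrite -lecR -!normE [leRHS]/Num.norm /= mx_normE -[leLHS]nngE num_le.
by apply/bigmax_geP; right; exists (0, j).
Qed.

Lemma rnorm_row_le z (e : R) :
  0 <= e -> (forall j, rnorm (z 0 j) <= e) -> rnorm z <= e.
Proof.
move=> e0 h; rewrite -lecR -!normE [leLHS]/Num.norm /= mx_normE.
have e0' : 0 <= (e%:C%C : C) by rewrite ler0c.
rewrite -[leRHS]/((NngNum e0')%:num) num_le; apply/bigmax_leP; split => //=.
by move=> [i j] _; rewrite -[_ <= _]/(`|z i j| <= e%:C%C) normE lecR (ord1 i) h.
Qed.

Lemma rnorm_row_arg z : z != 0 -> exists j, rnorm z = rnorm (z 0 j).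
Proof.
move=> z0; have [|[i j] /= h] := @mx_norm_neq0 _ _ _ z.
  by rewrite -[mx_norm z]/`|z| normr_eq0.
by exists j; apply: complexI; rewrite -!normE -(ord1 i).
Qed.
End Rows.
End RealNorm.

(** * Unconditional sums over finite subsets *)

Section Summation.
Variables (R : realType) (I : choiceType).
Local Notation C := (complexField R).
Implicit Types (A B J : {fset I}) (c : I -> C).

Lemma partial_sumE (V : zmodType) (x : I -> V) A :
  partial_sum x A = \sum_(i <- A) x i.
Proof. by rewrite /partial_sum big_seq_fsetE. Qed.

(** For nonnegative [u] this is summability with sum at most [S]; it keeps all estimates on finite
    sums. *)
Definition sum_bounded (u : I -> R) (S : R) :=
  forall A, \sum_(i <- A) u i <= S.

Lemma near_totally (P : {fset I} -> Prop) J :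
  (forall A, (J `<=` A)%fset -> P A) -> \forall A \near totally, P A.
Proof. by move=> h; exists J. Qed.

Lemma sum_bounded_ge0 (u : I -> R) S : sum_bounded u S -> 0 <= S.
Proof. by move=> /(_ fset0); rewrite big_seq_fset0. Qed.

Lemma sum_boundedW (u v : I -> R) S :
  (forall i, u i <= v i) -> sum_bounded v S -> sum_bounded u S.
Proof. by move=> uv vS A; apply: le_trans (vS A); exact: ler_sum. Qed.

Lemma sum_boundedZ (u : I -> R) S k :
  0 <= k -> sum_bounded u S -> sum_bounded (fun i => k * u i) (k * S).
Proof. by move=> k0 uS A; rewrite -mulr_sumr ler_wpM2l. Qed.

(** Unconditional convergence of scalars is absolute. Finite sums avoiding a suitable [J] have
    modulus at most 2; selecting the indices where the real (or imaginary) part has a fixed sign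
    turns this into a bound on sums of absolute values. Two signs and two parts give the constant
    8. *)
Lemma cvg_sum_bounded c (l : C) : partial_sum c @ totally --> l ->
  exists S, sum_bounded (fun i => rnorm (c i)) S.
Proof.
move=> /cvg_rnorm /(_ 1 ltr01)[J /= _ hJ].
pose c0 i := if i \in J then 0 else c i.
have hB A : rnorm (\sum_(i <- A) c0 i) <= 2.
  have -> : \sum_(i <- A) c0 i = (partial_sum c (J `|` A)%fset - l) -
      (partial_sum c J - l).
    rewrite opprB addrA subrK !partial_sumE (big_fsetID _ (mem J) (J `|` A)%fset) /=.
    rewrite (_ : [fset x in J `|` A | x \in J]%fset = J); last first.
      by apply/fsetP => x; rewrite !inE; case: (x \in J); rewrite ?andbF ?andbT.
    rewrite addrAC subrr add0r (big_fsetID _ (mem J)) /= big1_fset ?add0r; last first.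
      by move=> i; rewrite !inE /c0 => /andP[_ ->].
    rewrite (_ : [fset x in J `|` A | x \notin J]%fset =
      [fset x in A | x \notin J]%fset); last first.
      by apply/fsetP => x; rewrite !inE; case: (x \in J); rewrite ?andbF ?andbT.
    rewrite big_seq [RHS]big_seq; apply: eq_bigr => i.
    by rewrite !inE /c0 => /andP[_ /negbTE ->].
  apply: le_trans (rnormD _ _) _; rewrite rnormN.
  have h1 := hJ (J `|` A)%fset (fsubsetUl _ _).
  by have := hJ J (fsubset_refl _) => /= h2; move: h1 => /= h1; lra.
have absb (r : C -> R) : {morph r : x y / x + y} -> r 0 = 0 ->
    (forall x, `|r x| <= rnorm x) -> forall A, \sum_(i <- A) `|r (c0 i)| <= 4.
  move=> rD r0 rle A; rewrite (big_fsetID _ (fun i => 0 <= r (c0 i))) /=.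
  have hs (s : seq I) : r (\sum_(i <- s) c0 i) = \sum_(i <- s) r (c0 i).
    exact: (big_morph r rD r0).
  rewrite (_ : 4 = 2 + 2 :> R); last by lra.
  apply: lerD.
    apply: le_trans (hB _); apply: le_trans (rle _); rewrite hs.
    apply: le_trans (ler_norm _); rewrite big_seq [leRHS]big_seq; apply: ler_sum => i.
    by rewrite !inE => /andP[_ h]; rewrite ger0_norm.
  apply: le_trans (hB _); apply: le_trans (rle _); rewrite hs -normrN.
  apply: le_trans (ler_norm _); rewrite -sumrN big_seq [leRHS]big_seq; apply: ler_sum => i.
  by rewrite !inE -ltNge => /andP[_ h]; rewrite ltr0_norm.
exists (\sum_(i <- J) rnorm (c i) + 8) => A.
rewrite (big_fsetID _ (mem J)) /= lerD //.
  rewrite [leRHS](big_fsetID _ (mem A)) /=.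
  rewrite (_ : [fset x in A | x \in J]%fset = [fset x in J | x \in A]%fset).
    by rewrite lerDl sumr_ge0 // => i _; exact: rnorm_ge0.
  by apply/fsetP => x; rewrite !inE andbC.
have ReD : {morph (@complex.Re R : C -> R) : x y / x + y} by case=> [? ?] [? ?].
have ImD : {morph (@complex.Im R : C -> R) : x y / x + y} by case=> [? ?] [? ?].
rewrite (_ : 8 = 4 + 4 :> R); last by lra.
apply: le_trans (lerD (absb _ ReD erefl (@Re_le_rnorm R) A)
                      (absb _ ImD erefl (@Im_le_rnorm R) A)).
rewrite -big_split /= [leRHS](big_fsetID _ (mem J)) /=.
apply: ler_wpDl.
  by rewrite sumr_ge0 // => i _; rewrite addr_ge0.
rewrite big_seq [leRHS]big_seq; apply: ler_sum => i; rewrite !inE /c0 => /andP[_ /negbTE ->].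
exact: rnorm_le_ReIm.
Qed.

Lemma real_cvg_sum (u : I -> R) S : (forall i, 0 <= u i) -> sum_bounded u S ->
  exists l : R, partial_sum u @ totally --> l.
Proof.
move=> u0 uS; pose E := [set \sum_(i <- A) u i | A in [set: {fset I}]].
have supE : has_sup E.
  by split; [exists (\sum_(i <- fset0) u i), fset0 | exists S => _ [A _ <-]].
exists (sup E); apply/cvgrPdist_lt => e e0.
have [_ [J _ <-] hJ] := sup_adherent e0 supE.
apply: (@near_totally _ J) => A JA; rewrite partial_sumE.
have h1 : \sum_(i <- A) u i <= sup E by apply: ub_le_sup; [case: supE|exists A].
have h2 : \sum_(i <- J) u i <= \sum_(i <- A) u i.
  rewrite [leRHS](big_fsetID _ (mem J)) /=.
  rewrite (_ : [fset x in A | x \in J]%fset = J); last first.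
    apply/fsetP => x; rewrite !inE andbC; case xJ: (x \in J) => //=.
    exact: (fsubsetP JA).
  by rewrite lerDl sumr_ge0.
by rewrite ger0_norm; lra.
Qed.

(** The family is the difference of the nonnegative families [|r i| + r i] and [|r i|]. *)
Lemma real_abs_cvg_sum (r : I -> R) S : sum_bounded (fun i => `|r i|) S ->
  exists l : R, partial_sum r @ totally --> l.
Proof.
move=> rS.
have [l1 h1] := real_cvg_sum (fun i => normr_ge0 (r i)) rS.
have [|A|l2 h2] := @real_cvg_sum (fun i => `|r i| + r i) (S + S).
- by move=> i; rewrite -lerBlDr sub0r -normrN; exact: ler_norm.
- by rewrite big_split lerD //; apply: le_trans (rS A); apply: ler_sum => i _; exact: ler_norm.
exists (l2 - l1); rewrite (_ : partial_sum r =
  fun A => partial_sum (fun i => `|r i| + r i) A - partial_sum (fun i => `|r i|) A).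
  exact: cvgB.
by apply/funext => A; rewrite !partial_sumE big_split /= addrAC subrr add0r.
Qed.

Lemma sum_bounded_cvg c S : sum_bounded (fun i => rnorm (c i)) S ->
  exists l : C, partial_sum c @ totally --> l.
Proof.
move=> cS.
have [l1 h1] := real_abs_cvg_sum (sum_boundedW (fun i => @Re_le_rnorm R (c i)) cS).
have [l2 h2] := real_abs_cvg_sum (sum_boundedW (fun i => @Im_le_rnorm R (c i)) cS).
exists (l1 +i* l2)%C; apply: rnorm_cvg => e e0.
have e20 : 0 < e / 2 by lra.
move/cvgrPdist_lt : h1 => /(_ _ e20) h1; move/cvgrPdist_lt : h2 => /(_ _ e20) h2.
have ReD : {morph (@complex.Re R : C -> R) : x y / x + y} by case=> [? ?] [? ?].
have ImD : {morph (@complex.Im R : C -> R) : x y / x + y} by case=> [? ?] [? ?].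
near=> A.
apply: le_lt_trans (rnorm_le_ReIm _) _.
have ReN (x y : C) : complex.Re (x - y) = complex.Re x - complex.Re y.
  by case: x y => [? ?] [? ?].
have ImN (x y : C) : complex.Im (x - y) = complex.Im x - complex.Im y.
  by case: x y => [? ?] [? ?].
rewrite ReN ImN /= partial_sumE (big_morph _ ReD erefl) (big_morph _ ImD erefl).
rewrite distrC (distrC _ l2) -!partial_sumE.
have : `|l1 - partial_sum (fun i => complex.Re (c i)) A| < e / 2 by near: A.
have : `|l2 - partial_sum (fun i => complex.Im (c i)) A| < e / 2 by near: A.
lra.
Unshelve. all: by end_near. Qed.

Lemma cvg_sum_le c (l : C) S : partial_sum c @ totally --> l ->
  sum_bounded (fun i => rnorm (c i)) S -> rnorm l <= S.
Proof.
move=> /cvg_rnorm cl cS; apply/ler_addgt0Pr => e e0.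
have [J _ /(_ J (fsubset_refl _)) /= hJ] := cl e e0.
have := cS J; have := rnorm_sum J xpredT c.
have := rnormD (l - partial_sum c J) (partial_sum c J).
rewrite subrK rnormB !partial_sumE in hJ *.
lra.
Qed.

Lemma cvg_sumB c (l : C) J : partial_sum c @ totally --> l ->
  partial_sum (fun i => if i \in J then 0 else c i) @ totally -->
    l - \sum_(i <- J) c i.
Proof.
move=> /cvg_rnorm cl; apply: rnorm_cvg => e /cl [A _ hA].
apply: (@near_totally _ (A `|` J)%fset) => B; rewrite fsubUset => /andP[AB JB].
have e1 : \sum_(i <- B) (if i \in J then 0 else c i) =
    \sum_(i <- [fset x in B | x \notin J]%fset) c i.
  rewrite (big_fsetID _ (mem J)) /= big1_fset ?add0r; last first.
    by move=> i; rewrite !inE => /andP[_ ->].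
  rewrite big_seq [RHS]big_seq; apply: eq_bigr => i.
  by rewrite !inE => /andP[_ /negbTE ->].
have e2 : \sum_(i <- B) c i = \sum_(i <- J) c i +
    \sum_(i <- [fset x in B | x \notin J]%fset) c i.
  rewrite (big_fsetID _ (mem J)) /= (_ : [fset x in B | x \in J]%fset = J) //.
  apply/fsetP => x; rewrite !inE andbC; case xJ: (x \in J) => //=.
  exact: (fsubsetP JB).
have := hA B AB; rewrite /= !partial_sumE e1 e2.
by rewrite opprB addrCA addrA.
Qed.

Lemma cvg_sumD c c' (l l' : C) : partial_sum c @ totally --> l ->
  partial_sum c' @ totally --> l' ->
  partial_sum (fun i => c i + c' i) @ totally --> l + l'.
Proof.
move=> h h'.
rewrite (_ : partial_sum _ = fun A => partial_sum c A + partial_sum c' A).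
  exact: ccvgD h h'.
by apply/funext => A; rewrite !partial_sumE big_split.
Qed.

Lemma cvg_sumZ c (l k : C) : partial_sum c @ totally --> l ->
  partial_sum (fun i => k * c i) @ totally --> k * l.
Proof.
move=> h.
rewrite (_ : partial_sum _ = fun A => k * partial_sum c A).
  exact: ccvgMl h.
by apply/funext => A; rewrite !partial_sumE mulr_sumr.
Qed.

Lemma cvg_sum0 : partial_sum (fun _ : I => 0 : C) @ totally --> (0 : C).
Proof.
rewrite (_ : partial_sum _ = fun=> 0); first exact: ccvg_cst.
by apply/funext => A; rewrite partial_sumE big1.
Qed.

Lemma cvg_sum_big (J : Type) (s : seq J) (F : J -> I -> C) (l : J -> C) :
  (forall j, partial_sum (F j) @ totally --> l j) ->
  partial_sum (fun i => \sum_(j <- s) F j i) @ totally --> \sum_(j <- s) l j.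
Proof.
move=> h; elim: s => [|j s IH].
  by rewrite big_nil; under eq_fun do rewrite big_nil; exact: cvg_sum0.
by rewrite big_cons; under eq_fun do rewrite big_cons; exact: cvg_sumD (h j) IH.
Qed.

End Summation.

(** This shifts the exponents of a differentiated series: the terms outside the image of [h] vanish,
    and finite sets are pulled back along [h]. *)
Lemma cvg_sum_reindex (R : realType) (I J : choiceType) (h : J -> I)
    (c : I -> complexField R) (l : complexField R) :
  injective h -> (forall i, (forall j, i <> h j) -> c i = 0) ->
  partial_sum c @ totally --> l ->
  partial_sum (fun j => c (h j)) @ totally --> l.
Proof.
move=> hinj c0 /cvg_rnorm cl; apply: rnorm_cvg => e /cl [A _ hA].
pose pinv i := if pselect (exists j, i = h j) is left e
  then Some (sval (cid e)) else None.
pose B := [fset j in pmap pinv A]%fset.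
have BP j : h j \in A -> j \in B.
  move=> hjA; rewrite !inE /= mem_pmap; apply/mapP; exists (h j) => //.
  rewrite /pinv; case: pselect => [e'|[]]; last by exists j.
  by case: cid => j' /= /hinj ->.
apply: (@near_totally _ _ B) => E BE.
have := hA (A `|` [fset h j | j in E])%fset (fsubsetUl _ _).
rewrite /= !partial_sumE; congr (rnorm (_ - _) < _).
rewrite -(@big_fset_incl _ _ _ _ [fset h j | j in E]%fset).
- by rewrite big_imfset //= => ? ? _ _; exact: hinj.
- exact: fsubsetUr.
- move=> x; rewrite inE => /orP[xA|->//] xE; apply: c0 => j xj.
  move/negP: xE; apply; apply/imfsetP; exists j => //.
  by apply: (fsubsetP BE); apply: BP; rewrite -xj.
Qed.

(** * Holomorphic functions *)

Section Remainder.
Variable R : realType.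
Local Notation C := (complexField R).

(* p' = p + l + second order remainder, for monomials p, p' of degree d at
   points of modulus at most X and distance at most e. *)
Definition taylor_bound (X e : R) (d : nat) (p' p l : C) :=
  [/\ rnorm p <= X ^+ d, rnorm p' <= X ^+ d,
      X * rnorm l <= d%:R * X ^+ d * e,
      X * rnorm (p' - p) <= d%:R * X ^+ d * e &
      X ^+ 2 * rnorm (p' - p - l) <= (d ^ 2)%:R * X ^+ d * e ^+ 2].

Lemma taylor_bound1 (X e : R) : 0 <= X -> 0 <= e -> taylor_bound X e 0 1 1 0.
Proof.
move=> X0 e0; split; rewrite ?expr0 ?rnorm1 ?subrr ?subr0 ?rnorm0 ?mulr0 //.
all: by rewrite !mul0r.
Qed.

Lemma taylor_bound_var (X e : R) (z h : C) : 0 <= X -> 0 <= e ->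
  rnorm z <= X -> rnorm (z + h) <= X -> rnorm h <= e ->
  taylor_bound X e 1 (z + h) z h.
Proof.
move=> X0 e0 zX zhX he; split; rewrite ?expr1 ?mul1r //.
- exact: ler_wpM2l.
- by rewrite addrAC subrr add0r; exact: ler_wpM2l.
- by rewrite [z + h]addrC addrK subrr rnorm0 mulr0 mulr_ge0 ?exprn_ge0.
Qed.

Let ring_id (K : comRingType) (p' p l q' q m : K) :
  (p' * q' - p * q) = (p' - p) * q' + p * (q' - q) /\
  (p' * q' - p * q - (l * q + p * m)) =
  (p' - p - l) * q' + l * (q' - q) + p * (q' - q - m).
Proof. by split; ring. Qed.

Let ring_id2 (K : comRingType) (z h : K) k :
  h * z ^+ k.+1 + z * (k.+1%:R * z ^+ k * h) = k.+2%:R * z ^+ k.+1 * h.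
Proof. by rewrite -[k.+2%:R]natr1 exprS; ring. Qed.

(** The second order remainder of a product is [(p' - p - l) * q' + l * (q' - q) + p * (q' - q -
    m)], and [d1 ^ 2 + d1 * d2 + d2 ^ 2 <= (d1 + d2) ^ 2]. Keeping the factors [X] and [X ^+ 2] on
    the left of the bounds avoids the truncated exponents d - 1 and d - 2. *)
Lemma taylor_boundM (X e : R) d1 d2 p' p l q' q m : 0 <= X -> 0 <= e ->
  taylor_bound X e d1 p' p l -> taylor_bound X e d2 q' q m ->
  taylor_bound X e (d1 + d2) (p' * q') (p * q) (l * q + p * m).
Proof.
move=> X0 e0 [p1 p2 p3 p4 p5] [q1 q2 q3 q4 q5].
have [id1 id2] := @ring_id C p' p l q' q m.
have Xd k : 0 <= X ^+ k by rewrite exprn_ge0.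
split.
- by rewrite rnormM exprD ler_pM ?rnorm_ge0.
- by rewrite rnormM exprD ler_pM ?rnorm_ge0.
- have h1 := ler_pM (mulr_ge0 X0 (rnorm_ge0 l)) (rnorm_ge0 q) p3 q1.
  have h2 := ler_pM (rnorm_ge0 p) (mulr_ge0 X0 (rnorm_ge0 m)) p1 q3.
  have := ler_wpM2l X0 (rnormD (l * q) (p * m)); rewrite !rnormM => h3.
  by rewrite natrD exprD; nra.
- rewrite id1.
  have h1 := ler_pM (mulr_ge0 X0 (rnorm_ge0 _)) (rnorm_ge0 q') p4 q2.
  have h2 := ler_pM (rnorm_ge0 p) (mulr_ge0 X0 (rnorm_ge0 _)) p1 q4.
  have := ler_wpM2l X0 (rnormD ((p' - p) * q') (p * (q' - q))).
  by rewrite !rnormM natrD exprD => h3; nra.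
- rewrite id2.
  have X20 : 0 <= X ^+ 2 by rewrite exprn_ge0.
  have h1 := ler_pM (mulr_ge0 X20 (rnorm_ge0 _)) (rnorm_ge0 q') p5 q2.
  have h2 := ler_pM (rnorm_ge0 p) (mulr_ge0 X20 (rnorm_ge0 _)) p1 q5.
  have h3 := ler_pM (mulr_ge0 X0 (rnorm_ge0 _)) (mulr_ge0 X0 (rnorm_ge0 _)) p3 q4.
  have := ler_wpM2l X20 (le_trans (rnormD ((p' - p - l) * q' + l * (q' - q)) (p * (q' - q - m)))
     (lerD (rnormD ((p' - p - l) * q') (l * (q' - q))) (lexx _))).
  rewrite !rnormM => h4; apply: le_trans h4 _.
  rewrite !mulrDr.
  have -> : X ^+ 2 * (rnorm l * rnorm (q' - q)) = X * rnorm l * (X * rnorm (q' - q)) by ring.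
  have -> : X ^+ 2 * (rnorm (p' - p - l) * rnorm q') = X ^+ 2 * rnorm (p' - p - l) * rnorm q' by ring.
  have -> : X ^+ 2 * (rnorm p * rnorm (q' - q - m)) = rnorm p * (X ^+ 2 * rnorm (q' - q - m)) by ring.
  apply: le_trans (lerD (lerD h1 h3) h2) _.
  rewrite exprD !natrX natrD -subr_ge0.
  set D1 := d1%:R; set D2 := d2%:R.
  have -> : (D1 + D2) ^+ 2 * (X ^+ d1 * X ^+ d2) * e ^+ 2 -
   (D1 ^+ 2 * X ^+ d1 * e ^+ 2 * X ^+ d2 +
    D1 * X ^+ d1 * e * (D2 * X ^+ d2 * e) +
    X ^+ d1 * (D2 ^+ 2 * X ^+ d2 * e ^+ 2)) =
    D1 * D2 * X ^+ d1 * X ^+ d2 * e ^+ 2 by ring.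
  by rewrite !mulr_ge0 // ?ler0n // exprn_ge0.
Qed.

Lemma taylor_bound_pow (X e : R) (z h : C) k : 0 <= X -> 0 <= e ->
  rnorm z <= X -> rnorm (z + h) <= X -> rnorm h <= e ->
  taylor_bound X e k ((z + h) ^+ k) (z ^+ k) (k%:R * z ^+ k.-1 * h).
Proof.
move=> X0 e0 zX zhX he; elim: k => [|k IH].
  by rewrite !expr0 !mul0r; exact: taylor_bound1.
have := taylor_boundM X0 e0 (taylor_bound_var X0 e0 zX zhX he) IH.
rewrite add1n -!exprS; congr taylor_bound.
case: k {IH} => [|k] /=; first by rewrite !expr0 !mul0r mulr0 addr0 mul1r mulr1 mul1r.
by rewrite ring_id2.
Qed.

Lemma taylor_bound_prod (J : eqType) (s : seq J) (X e : R) (d : J -> nat)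
    (p' p l : J -> C) : 0 <= X -> 0 <= e -> uniq s ->
  (forall j, taylor_bound X e (d j) (p' j) (p j) (l j)) ->
  taylor_bound X e (\sum_(j <- s) d j) (\prod_(j <- s) p' j)
    (\prod_(j <- s) p j) (\sum_(j <- s) l j * \prod_(i <- s | i != j) p i).
Proof.
move=> X0 e0 us h; elim: s us => [_|j s IH /= /andP[js us]].
  by rewrite !big_nil; exact: taylor_bound1.
have := taylor_boundM X0 e0 (h j) (IH us); rewrite !big_cons eqxx /=.
congr taylor_bound; congr (_ * _ + _).
  by rewrite [LHS]big_seq [RHS]big_seq_cond; apply: eq_bigl => i; rewrite /=; case: eqVneq => [->|_]; rewrite ?(negbTE js) ?andbT.
rewrite mulr_sumr [LHS]big_seq [RHS]big_seq; apply: eq_bigr => i si.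
rewrite big_cons; case: eqVneq => [ji|_]; first by rewrite ji si in js.
by rewrite mulrCA.
Qed.
End Remainder.

Section Monomial.
Variables (R : realType) (n : nat).
Local Notation C := (complexField R).
Implicit Types (nu : multi_index n) (z h : 'rV[C]_n).

Definition mdeg nu : nat := \sum_(j < n) nu j.

Definition lower (j : 'I_n) nu : multi_index n := [ffun i => (nu i - (i == j))%N].
Definition raise (j : 'I_n) nu : multi_index n := [ffun i => (nu i + (i == j))%N].

Lemma raiseK j : cancel (raise j) (lower j).
Proof. by move=> nu; apply/ffunP => i; rewrite !ffunE addnK. Qed.

Lemma lowerK j nu : (0 < nu j)%N -> raise j (lower j nu) = nu.
Proof.
move=> nuj; apply/ffunP => i; rewrite !ffunE subnK //.
by case: eqVneq => [->|].
Qed.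

Lemma nu_le_mdeg nu j : (nu j <= mdeg nu)%N.
Proof. by rewrite /mdeg (bigD1 j) //= leq_addr. Qed.

(** The partial derivative of a monomial. If [nu j = 0], the truncated subtraction in [lower] is
    harmless because the numerical factor vanishes. *)
Definition dmonomial (j : 'I_n) nu z : C := (nu j)%:R * monomial (lower j nu) z.

Lemma taylor_bound_monomial (X e : R) nu z h : 0 <= X -> 0 <= e ->
  rnorm z <= X -> rnorm (z + h) <= X -> rnorm h <= e ->
  taylor_bound X e (mdeg nu) (monomial nu (z + h)) (monomial nu z)
    (\sum_j h 0 j * dmonomial j nu z).
Proof.
move=> X0 e0 zX zhX he.
have tb j : taylor_bound X e (nu j) ((z 0 j + h 0 j) ^+ nu j) (z 0 j ^+ nu j)
    ((nu j)%:R * z 0 j ^+ (nu j).-1 * h 0 j).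
  apply: taylor_bound_pow => //.
  - exact: le_trans (rnorm_coord _ _) zX.
  - by have := rnorm_coord (z + h) j; rewrite mxE => /le_trans; apply.
  - exact: le_trans (rnorm_coord _ _) he.
have := taylor_bound_prod X0 e0 (index_enum_uniq _) tb.
rewrite (_ : \prod_(j <- _) (z 0 j + h 0 j) ^+ nu j = monomial nu (z + h)); last first.
  by apply: eq_bigr => j _; rewrite mxE.
rewrite (_ : \sum_(j <- _) _ * _ = \sum_j h 0 j * dmonomial j nu z) //.
apply: eq_bigr => j _; rewrite /dmonomial /monomial [in RHS](bigD1 j) //=.
rewrite ffunE eqxx subn1 mulrCA !mulrA; congr (_ * _).
  by rewrite mulrAC [_ * h 0 j]mulrC mulrA.
by apply: eq_bigr => i ij; rewrite ffunE (negbTE ij) subn0.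
Qed.

Lemma rnorm_monomial_le nu z (X : R) : rnorm z <= X ->
  rnorm (monomial nu z) <= X ^+ mdeg nu.
Proof.
move=> zX; rewrite /monomial rnorm_prod /mdeg -prodrXr; apply: ler_prod => j _.
rewrite rnorm_ge0 rnormX /=; apply: lerXn2r; rewrite ?nnegrE ?rnorm_ge0 //.
  exact: le_trans (rnorm_ge0 z) zX.
exact: le_trans (rnorm_coord _ _) zX.
Qed.

Lemma rnorm_dmonomial_le j nu z (X : R) : 0 <= X -> rnorm z <= X ->
  X * rnorm (dmonomial j nu z) <= (nu j)%:R * X ^+ mdeg nu.
Proof.
move=> X0 zX; rewrite /dmonomial rnormM rnorm_nat mulrCA.
case nuj: (nu j) => [|k]; first by rewrite !mul0r.
apply: ler_wpM2l => //.
have -> : mdeg nu = (mdeg (lower j nu)).+1.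
  rewrite /mdeg (bigD1 j) //= [in RHS](bigD1 j) //= ffunE eqxx nuj subn1 addSn.
  by congr (_ + _).+1; apply: eq_bigr => i ij; rewrite ffunE (negbTE ij) subn0.
by rewrite exprS; apply: ler_wpM2l => //; exact: rnorm_monomial_le.
Qed.

Lemma mul_dmonomial j nu z : z 0 j * dmonomial j nu z = (nu j)%:R * monomial nu z.
Proof.
rewrite /dmonomial mulrCA; case nuj: (nu j) => [|k]; first by rewrite !mul0r.
congr (_ * _); rewrite /monomial (bigD1 j) //= [in RHS](bigD1 j) //=.
rewrite ffunE eqxx nuj subn1 mulrA exprS; congr (_ * _).
by apply: eq_bigr => i ij; rewrite ffunE (negbTE ij) subn0.
Qed.

End Monomial.

Section QuadraticRemainder.
Variable K : numFieldType.

(** The differentials of power series, of face functions and of real and imaginary parts all come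
    from this criterion: [k * |h| ^ 2] is at most [e * |h|] once [|h| < e / (k + 1)]. *)
Lemma quadratic_remainder_diff (V W : normedModType K) (f : V -> W) (x : V)
    (L : {linear V -> W}) (k : K) :
  continuous L -> 0 <= k ->
  (\forall h \near 0, `|f (x + h) - f x - L h| <= k * `|h| ^+ 2) ->
  differentiable f x /\ 'd f x = L :> (V -> W).
Proof.
move=> Lc k0 hf.
have ho : f \o shift x = cst (f x) + L +o_ 0 id.
  apply/eqaddoP => e e0 /=.
  have e1 : 0 < e / (k + 1) by rewrite divr_gt0 // ltr_wpDl.
  near=> h.
  have h1 : `|f (x + h) - f x - L h| <= k * `|h| ^+ 2 by near: h.
  have h2 : `|h| < e / (k + 1).
    near: h; apply/nbhs_ballP; exists (e / (k + 1)) => // y.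
    by rewrite -ball_normE /= sub0r normrN.
  rewrite [X in `|X| <= _](_ : _ = f (x + h) - f x - L h); last first.
    by rewrite -[LHS]/(f (h + x) - (f x + L h)) [h + x]addrC opprD addrA.
  apply: le_trans h1 _; rewrite expr2 mulrA ler_wpM2r //.
  apply: le_trans (ler_wpM2l k0 (ltW h2)) _.
  rewrite mulrCA ler_piMr ?ltW //; rewrite ltr_pdivrMr ?mul1r; last by rewrite ltr_wpDl.
  by rewrite ltrDl.
have dL := diff_unique Lc ho.
by split=> //; apply/diff_locallyP; rewrite dL.
Unshelve. all: by end_near. Qed.

Variable n : nat.

Definition lin_form (c : 'I_n -> K) (h : 'rV[K]_n) : K := \sum_j h 0 j * c j.

Lemma lin_form_is_linear c : linear (lin_form c : 'rV[K]_n -> K^o).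
Proof.
move=> k u v; rewrite /lin_form scaler_sumr -big_split /=.
by apply: eq_bigr => j _; rewrite !mxE mulrDl scalerAl.
Qed.

HB.instance Definition _ c :=
  GRing.isLinear.Build K 'rV[K]_n K^o *:%R (lin_form c) (lin_form_is_linear c).

Lemma lin_form_continuous c : continuous (lin_form c : 'rV[K]_n -> K).
Proof.
suff h s (x : 'rV[K]_n) :
    (fun y : 'rV[K]_n => \sum_(j <- s) y 0 j * c j) @ x --> \sum_(j <- s) x 0 j * c j.
  by move=> x; exact: h.
elim: s => [|j s IH].
  rewrite big_nil; under eq_fun do rewrite big_nil.
  exact: (@cvg_cst K 0 _ (nbhs x) _).
have h1 : (fun y : 'rV[K]_n => y 0 j * c j) @ x --> x 0 j * c j.
  apply: (@cvgM K _ (nbhs x) _); first exact: coord_continuous.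
  exact: (@cvg_cst K (c j) _ (nbhs x) _).
rewrite big_cons; under eq_fun do rewrite big_cons.
exact: (@cvgD K K _ (nbhs x) _ _ _ _ _ h1 IH).
Qed.
End QuadraticRemainder.

(** Halving a radius of convergence absorbs the factors d and d ^ 2 produced by differentiation. The
    leading 2 covers [k = 3], where 9 exceeds 8. *)
Lemma sqrn_le_exp2 k : (k ^ 2 <= 2 * 2 ^ k)%N.
Proof.
elim: k => [|k IH] //; case: k IH => [|[|[|k]]] // IH.
by rewrite [(2 ^ k.+4)%N]expnS !expnS expn0 in IH *; nia.
Qed.

(** * Termwise differentiation of power series *)

Section PowerSeriesCalculus.
Variables (R : realType) (n : nat).
Local Notation C := (complexField R).
Implicit Types (f : 'rV[C]_n -> C) (p z h : 'rV[C]_n) (a : multi_index n -> C).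

Definition partial (f : 'rV[C]_n -> C) (j : 'I_n) (z : 'rV[C]_n) : C :=
  'd f z (delta_mx 0 j).

Definition abs_summable a (rho S : R) :=
  sum_bounded (fun nu => rnorm (a nu) * rho ^+ mdeg nu) S.

(** Convergence at the single point whose coordinates relative to [p] all equal [rho] is absolute,
    and there the monomials are the powers [rho ^+ mdeg nu]. *)
Lemma power_series_summable f p a : has_power_series f p a ->
  exists rho S, [/\ 0 < rho, abs_summable a rho S &
    forall z, rnorm (z - p) <= rho ->
    partial_sum (fun nu => a nu * monomial nu (z - p)) @ totally --> f z].
Proof.
move=> /rnorm_near[e e0 he]; pose rho := e / 2.
have rho0 : 0 < rho by rewrite divr_gt0.
have hz z : rnorm (z - p) <= rho ->
    partial_sum (fun nu => a nu * monomial nu (z - p)) @ totally --> f z.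
  by move=> zp; apply: he; apply: le_lt_trans zp _; rewrite /rho; lra.
pose v : 'rV[C]_n := const_mx (rho%:C%C).
have vrho : rnorm (v + p - p) <= rho.
  rewrite addrK; apply: rnorm_row_le => [|j]; first exact: ltW.
  by rewrite mxE rnorm_real ger0_norm // ltW.
have [S hS] := cvg_sum_bounded (hz _ vrho).
exists rho, S; split=> // A; apply: le_trans (hS A); rewrite addrK.
apply: ler_sum => nu _; rewrite rnormM; apply: ler_wpM2l; first exact: rnorm_ge0.
rewrite /monomial rnorm_prod /mdeg -prodrXr; apply: ler_prod => j _.
by have r0 := ltW rho0; rewrite exprn_ge0 //= mxE rnormX rnorm_real ger0_norm.
Qed.

Lemma half_geometric (rho : R) (d k : nat) : 0 <= rho -> (k <= 2 * 2 ^ d)%N ->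
  k%:R * (rho / 2) ^+ d <= 2 * rho ^+ d.
Proof.
move=> r0 kd; rewrite expr_div_n mulrCA mulrC ler_wpM2r ?exprn_ge0 //.
rewrite ler_pdivrMr ?exprn_gt0 // -natrX.
by rewrite -natrM ler_nat.
Qed.

Section AtPoint.
Variables (f : 'rV[C]_n -> C) (p : 'rV[C]_n) (a : multi_index n -> C).
Variables (rho S : R).
Hypotheses (rho0 : 0 < rho) (aS : abs_summable a rho S).
Hypothesis fa : forall z, rnorm (z - p) <= rho ->
  partial_sum (fun nu => a nu * monomial nu (z - p)) @ totally --> f z.

Let s := rho / 2.
Let s0 : 0 < s. Proof. by rewrite divr_gt0. Qed.

Lemma derived_summable j z : rnorm z <= s ->
  sum_bounded (fun nu => rnorm (a nu * dmonomial j nu z)) (2 / s * S).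
Proof.
move=> zs.
have k0 : 0 <= 2 / s by rewrite divr_ge0 // ltW.
apply: sum_boundedW (sum_boundedZ k0 aS) => nu /=.
rewrite rnormM [leRHS]mulrCA; apply: ler_wpM2l; first exact: rnorm_ge0.
rewrite mulrAC ler_pdivlMr // mulrC.
apply: le_trans (rnorm_dmonomial_le _ _ (ltW s0) zs) _.
apply: half_geometric; first exact: ltW.
apply: leq_trans (nu_le_mdeg _ _) _; apply: leq_trans (sqrn_le_exp2 _).
by case: (mdeg nu) => // d; rewrite expnS expn1 leq_pmulr.
Qed.

Lemma derived_series : exists D : 'I_n -> 'rV[C]_n -> C, forall j z,
  rnorm (z - p) <= s ->
  partial_sum (fun nu => a nu * dmonomial j nu (z - p)) @ totally --> D j z.
Proof.
have hD (jz : 'I_n * 'rV[C]_n) : exists l : C, rnorm (jz.2 - p) <= s ->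
    partial_sum (fun nu => a nu * dmonomial jz.1 nu (jz.2 - p)) @ totally --> l.
  have [zs|_] := boolP (rnorm (jz.2 - p) <= s); last by exists 0.
  by have [l hl] := sum_bounded_cvg (derived_summable jz.1 zs); exists l.
have [D hD'] := choice hD.
by exists (fun j z => D (j, z)) => j z zs; exact: (hD' (j, z)).
Qed.

(** Termwise [taylor_bound_monomial] with [X = s]; as [rho] is twice [s], the factor [(mdeg nu) ^ 2]
    is absorbed by [half_geometric]. *)
Lemma series_remainder (D : 'I_n -> 'rV[C]_n -> C) z h :
  (forall j z, rnorm (z - p) <= s ->
   partial_sum (fun nu => a nu * dmonomial j nu (z - p)) @ totally --> D j z) ->
  rnorm (z - p) <= s / 2 -> rnorm h <= s / 2 ->
  rnorm (f (z + h) - f z - lin_form (D^~ z) h) <= 2 / s ^+ 2 * S * rnorm h ^+ 2.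
Proof.
move=> hD zp hs.
have ss2 : s / 2 <= s by have := s0; lra.
have srho : s <= rho by rewrite /s; have := rho0; lra.
have zhp : rnorm (z - p + h) <= s.
  by apply: le_trans (rnormD _ _) _; lra.
have zps : rnorm (z - p) <= s by lra.
have hss : rnorm h <= s by lra.
have c1 := fa (le_trans zps srho).
have c2 : partial_sum (fun nu => a nu * monomial nu (z - p + h)) @ totally --> f (z + h).
  rewrite (_ : z - p + h = z + h - p); last by rewrite addrAC.
  by apply: fa; rewrite addrAC; exact: le_trans zhp srho.
have c3 : partial_sum (fun nu => \sum_(j <- index_enum _) h 0 j * (a nu * dmonomial j nu (z - p)))
    @ totally --> lin_form (D^~ z) h.
  by apply: cvg_sum_big => j; apply: cvg_sumZ; exact: hD.
have c4 := cvg_sumD (cvg_sumD c2 (@cvg_sumZ _ _ _ _ (-1) c1)) (@cvg_sumZ _ _ _ _ (-1) c3).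
rewrite !mulN1r in c4; apply: cvg_sum_le c4 _.
have k0 : 0 <= 2 / s ^+ 2 * rnorm h ^+ 2.
  by rewrite mulr_ge0 ?divr_ge0 ?exprn_ge0 ?rnorm_ge0 // ltW.
rewrite mulrAC; apply: sum_boundedW (sum_boundedZ k0 aS) => nu /=.
rewrite (_ : _ + _ + _ = a nu * (monomial nu (z - p + h) - monomial nu (z - p) -
   \sum_j h 0 j * dmonomial j nu (z - p))); last first.
  rewrite !mulN1r !mulrBr mulr_sumr; congr (_ - _).
  by apply: eq_bigr => j _; rewrite mulrCA.
rewrite rnormM [leRHS]mulrCA; apply: ler_wpM2l; first exact: rnorm_ge0.
have [_ _ _ _] := taylor_bound_monomial nu (ltW s0) (rnorm_ge0 h) zps zhp (lexx _).
have s20 : 0 < s ^+ 2 by rewrite exprn_gt0.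
rewrite -ler_pdivlMl // => /le_trans; apply.
rewrite [leRHS](_ : _ = (s ^+ 2)^-1 * (2 * rho ^+ mdeg nu * rnorm h ^+ 2)); last by ring.
apply: ler_wpM2l; first by rewrite invr_ge0 ltW.
apply: ler_wpM2r; first by rewrite exprn_ge0 // rnorm_ge0.
by apply: half_geometric (sqrn_le_exp2 _); exact: ltW.
Qed.

Lemma series_diff (D : 'I_n -> 'rV[C]_n -> C) z :
  (forall j z, rnorm (z - p) <= s ->
   partial_sum (fun nu => a nu * dmonomial j nu (z - p)) @ totally --> D j z) ->
  rnorm (z - p) <= s / 2 ->
  differentiable f z /\ 'd f z = lin_form (D^~ z) :> ('rV[C]_n -> C).
Proof.
move=> hD zp; have s20 : 0 < s / 2 by rewrite divr_gt0.
pose k := 2 / s ^+ 2 * S.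
have k0 : 0 <= k.
  by rewrite mulr_ge0 ?(sum_bounded_ge0 aS) // divr_ge0 // exprn_ge0 // ltW.
apply: (@quadratic_remainder_diff C 'rV[C]_n C f z (lin_form (D^~ z)) (k%:C)%C).
- exact: lin_form_continuous.
- by rewrite ler0c.
- apply/rnorm_near; exists (s / 2) => // h; rewrite subr0 => /ltW hs.
  by rewrite !normE -rmorphXn -rmorphM lecR; exact: series_remainder.
Qed.

Lemma partial_series (D : 'I_n -> 'rV[C]_n -> C) :
  (forall j z, rnorm (z - p) <= s ->
   partial_sum (fun nu => a nu * dmonomial j nu (z - p)) @ totally --> D j z) ->
  forall j z, rnorm (z - p) <= s / 2 -> partial f j z = D j z.
Proof.
move=> hD j z zp; rewrite /partial (series_diff hD zp).2 /lin_form.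
rewrite (bigD1 j) //= mxE !eqxx mul1r big1 ?addr0 // => i ij.
by rewrite mxE (negbTE ij) andbF mul0r.
Qed.

End AtPoint.
End PowerSeriesCalculus.

Section Holomorphic.
Variables (R : realType) (n : nat).
Local Notation C := (complexField R).
Implicit Types (f : 'rV[C]_n -> C) (p z h : 'rV[C]_n) (a : multi_index n -> C).

Lemma abs_summableW a (rho rho' S S' : R) : 0 <= rho' -> rho' <= rho -> S <= S' ->
  abs_summable a rho S -> abs_summable a rho' S'.
Proof.
move=> r0 rr SS aS A; apply: le_trans SS; apply: le_trans (aS A).
apply: ler_sum => nu _; apply: ler_wpM2l; first exact: rnorm_ge0.
by apply: lerXn2r; rewrite ?nnegrE // (le_trans r0).
Qed.

(** The derivatives are recorded in the form [z_j d_jf], with coefficients [(nu j)%:R * a nu]. These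
    vanish wherever [a] does, so at the origin the monomials that dominate [f] also control its
    logarithmic gradient. *)
Lemma power_series_local f p a : has_power_series f p a ->
  exists (s K : R), [/\ 0 < s, abs_summable a s K,
    forall j : 'I_n, abs_summable (fun nu : multi_index n => (nu j)%:R * a nu) s K,
    forall z, rnorm (z - p) <= s ->
    [/\ partial_sum (fun nu => a nu * monomial nu (z - p)) @ totally --> f z,
        forall j : 'I_n, partial_sum (fun nu : multi_index n => (nu j)%:R * a nu * monomial nu (z - p))
          @ totally --> (z - p) 0 j * partial f j z,
        differentiable f z & 'd f z = lin_form ((partial f)^~ z) :> ('rV[C]_n -> C)] &
    forall z h, rnorm (z - p) <= s -> rnorm h <= s ->
    rnorm (f (z + h) - f z - lin_form ((partial f)^~ z) h) <= K * rnorm h ^+ 2].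
Proof.
move=> /power_series_summable[rho [S [rho0 aS fa]]].
have [D hD] := derived_series p rho0 aS.
(* The derived series converge on radius [rho / 2]; halving once more leaves room for the increment
   [h]. *)
pose s := rho / 2 / 2; pose K := Num.max (2 * S) (2 / (rho / 2) ^+ 2 * S).
have s0 : 0 < s by rewrite !divr_gt0.
have S0 : 0 <= S := sum_bounded_ge0 aS.
have Dp := partial_series rho0 aS fa hD.
have sr : s <= rho by rewrite /s; lra.
exists s, K; split => //.
- by apply: abs_summableW aS; rewrite ?(ltW s0) // le_max; apply/orP; left; lra.
- move=> j A; apply: (@le_trans _ _ (2 * S)); last by rewrite le_max lexx.
  apply: le_trans (_ : _ <= \sum_(i <- A) 2 * (rnorm (a i) * rho ^+ mdeg i)) _; last first.
    by rewrite -mulr_sumr; apply: ler_wpM2l.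
  apply: ler_sum => nu _; rewrite rnormM rnorm_nat.
  rewrite mulrAC mulrC [leRHS]mulrCA; apply: ler_wpM2l; first exact: rnorm_ge0.
  apply: (@le_trans _ _ ((nu j)%:R * (rho / 2) ^+ mdeg nu)).
    apply: ler_wpM2l => //; apply: lerXn2r; rewrite ?nnegrE ?(ltW s0) //; rewrite /s; lra.
  apply: half_geometric; first exact: ltW.
  apply: leq_trans (nu_le_mdeg _ _) _; apply: leq_trans (sqrn_le_exp2 _).
  by case: (mdeg nu) => // d; rewrite expnS expn1 leq_pmulr.
- move=> z zs; have [df dfE] := series_diff rho0 aS fa hD zs.
  have zs2 : rnorm (z - p) <= rho / 2 by apply: le_trans zs _; rewrite /s; lra.
  split=> //.
  + by apply: fa; exact: le_trans zs sr.
  + move=> j; rewrite Dp //.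
    rewrite (_ : (fun nu => _) = fun nu => (z - p) 0 j * (a nu * dmonomial j nu (z - p))).
      by apply: cvg_sumZ; exact: hD.
    by apply/funext => nu; rewrite mulrCA mul_dmonomial mulrCA mulrA.
  + rewrite dfE; apply/funext => h; apply: eq_bigr => j _; by rewrite Dp.
- move=> z h zs hs.
  rewrite (_ : lin_form _ h = lin_form (D^~ z) h); last first.
    by apply: eq_bigr => j _; rewrite Dp.
  apply: le_trans (series_remainder rho0 aS fa hD zs hs) _.
  by apply: ler_wpM2r; rewrite ?exprn_ge0 ?rnorm_ge0 // le_max lexx orbT.
Qed.

Lemma partial_power_series f p a (j : 'I_n) : has_power_series f p a ->
  has_power_series (partial f j) p (fun nu : multi_index n => (nu j).+1%:R * a (raise j nu)).
Proof.
move=> /power_series_summable[rho [S [rho0 aS fa]]].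
have [D hD] := derived_series p rho0 aS.
have Dp := partial_series rho0 aS fa hD.
apply/rnorm_near; exists (rho / 2 / 2) => [|z /ltW zs]; first by rewrite !divr_gt0.
have zs2 : rnorm (z - p) <= rho / 2 by apply: le_trans zs _; lra.
have ri : injective (raise j : multi_index n -> _) := can_inj (raiseK j).
have h0 nu : (forall mu, nu <> raise j mu) -> a nu * dmonomial j nu (z - p) = 0.
  move=> hnu; rewrite /dmonomial; case nuj: (nu j) => [|k]; first by rewrite mul0r mulr0.
  by case: (hnu (lower j nu)); rewrite lowerK // nuj.
rewrite Dp //; have := cvg_sum_reindex ri h0 (hD j z zs2).
rewrite (_ : (fun nu : multi_index n => _) = fun nu : multi_index n =>
  (nu j).+1%:R * a (raise j nu) * monomial nu (z - p)) //.
by apply/funext => nu; rewrite /dmonomial raiseK ffunE eqxx addn1 mulrCA mulrA.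
Qed.

(** Needed for the gradients of [f] and [g], which are coefficients of a linear system, to be
    Lipschitz on the sphere. *)
Lemma holomorphic_partial (U : set 'rV[C]_n) f (j : 'I_n) :
  holomorphic_on U f -> holomorphic_on U (partial f j).
Proof.
move=> hf p /hf[a fa]; exists (fun nu : multi_index n => (nu j).+1%:R * a (raise j nu)).
exact: partial_power_series.
Qed.

Lemma holomorphic_taylor (U : set 'rV[C]_n) f p : holomorphic_on U f -> U p ->
  exists (s K : R), [/\ 0 < s, 0 <= K, differentiable f p,
    'd f p = lin_form ((partial f)^~ p) :> ('rV[C]_n -> C) &
    forall z h, rnorm (z - p) <= s -> rnorm h <= s ->
    rnorm (f (z + h) - f z - lin_form ((partial f)^~ z) h) <= K * rnorm h ^+ 2].
Proof.
move=> hf /hf[a /power_series_local[s [K [s0 aK _ h1 h2]]]]; exists s, K.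
have pp : rnorm (p - p) <= s by rewrite subrr rnorm0 ltW.
have [_ _ df dfE] := h1 p pp.
by split=> //; exact: sum_bounded_ge0 aK.
Qed.

End Holomorphic.

(** * Newton boundaries and limits along ultrafilters *)

Section NewtonPolyhedron.
Variables (R : realType) (n : nat).
Local Notation C := (complexField R).
Implicit Types (a : multi_index n -> C) (P nu : {ffun 'I_n -> nat}) (l x : 'rV[R]_n).

Definition weight P nu : nat := \sum_j (P j * nu j)%N.

Lemma dot_weight P nu : dot (nat_row R P) (nat_row R nu) = (weight P nu)%:R.
Proof.
rewrite /dot /weight natr_sum; apply: eq_bigr => j _.
by rewrite !mxE natrM.
Qed.

(** A half-space is convex, so the bound has to be checked on the generators only; the sign of [l]
    reduces the orthants to their vertices. *)
Lemma newton_polyhedron_ge a l (c : R) : (forall j, 0 <= l 0 j) ->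
  (forall nu, a nu != 0 -> c <= dot l (nat_row R nu)) ->
  forall x, newton_polyhedron a x -> c <= dot l x.
Proof.
move=> l0 hc x; apply: (@smallest_sub _ _ _ [set x | c <= dot l x]).
  move=> y z t /set_mem /= yc /set_mem /= zc; apply/mem_set => /=.
  have dotD (u v : 'rV[R]_n) : dot l (u + v) = dot l u + dot l v.
    by rewrite /dot -big_split; apply: eq_bigr => j _; rewrite /= mxE mulrDr.
  have dotZ (k : R) (u : 'rV[R]_n) : dot l (k *: u) = k * dot l u.
    by rewrite /dot mulr_sumr; apply: eq_bigr => j _; rewrite mxE mulrCA.
  rewrite /conv /= dotD !dotZ.
  have t0 : 0 <= t%:num by [].
  have t1 : t%:num <= 1 by [].
  have := ler_wpM2l t0 yc; have := ler_wpM2l (_ : 0 <= 1 - t%:num) zc; rewrite ?subr_ge0 => /(_ t1).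
  by rewrite /unstable.onem; lra.
move=> y [nu anu hy] /=; apply: le_trans (hc _ anu) _.
by apply: ler_sum => j _; rewrite mxE; apply: ler_wpM2l.
Qed.

Lemma newton_polyhedron_support a nu : a nu != 0 -> newton_polyhedron a (nat_row R nu).
Proof.
by move=> anu A [_ hA]; apply: hA; exists nu => // j; rewrite mxE.
Qed.

Lemma newton_degE a P nu0 : a nu0 != 0 ->
  (forall nu, a nu != 0 -> (weight P nu0 <= weight P nu)%N) ->
  newton_deg P a = (weight P nu0)%:R.
Proof.
move=> a0 hmin; rewrite /newton_deg.
set E := [set _ | _ in _].
have E0 : E (weight P nu0)%:R.
  by exists (nat_row R nu0); [exact: newton_polyhedron_support|rewrite dot_weight].
have lb : lbound E (weight P nu0)%:R.
  move=> _ [x hx <-]; apply: newton_polyhedron_ge hx.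
    by move=> j; rewrite mxE.
  by move=> nu anu; rewrite dot_weight ler_nat; exact: hmin.
apply/eqP; rewrite eq_le; apply/andP; split.
  by apply: ge_inf => //; exists (weight P nu0)%:R.
by apply: lb_le_inf => //; exists (weight P nu0)%:R.
Qed.

Definition axis_index (i : 'I_n) (k : nat) : multi_index n :=
  [ffun j => if j == i then k else 0%N].

(** Without a monomial on the i-th axis every exponent of the support has another positive entry.
    The sum of the other coordinates would then be at least 1 on the whole polyhedron, whereas it is
    0 at the boundary point on the axis. *)
Lemma convenient_axis a : convenient a ->
  forall i, exists k, a (axis_index i k) != 0.
Proof.
move=> ca i; have [x [F [[_ [l FE]] _] Fx] xi] := ca i.
have px : newton_polyhedron a x by move: Fx; rewrite FE => -[].
apply: contrapT => ha.
pose l' : 'rV[R]_n := \row_j (if j == i then 0 else 1).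
have l'0 j : 0 <= l' 0 j by rewrite mxE; case: ifP.
have : 1 <= dot l' x.
  apply: newton_polyhedron_ge px => // nu anu.
  have [j /andP[ji nuj]] : exists j, (j != i) && (0 < nu j)%N.
    apply: contrapT => hj; apply: ha; exists (nu i).
    rewrite (_ : axis_index i (nu i) = nu) //; apply/ffunP => j; rewrite ffunE.
    case: eqVneq => [->//|ji]; apply/esym/eqP; rewrite -leqn0 leqNgt.
    by apply/negP => nuj; apply: hj; exists j; rewrite ji.
  rewrite /dot (bigD1 j) //= !mxE (negbTE ji) mul1r.
  rewrite -[leLHS]addr0 lerD ?ler1n //.
  by apply: sumr_ge0 => k _; rewrite mulr_ge0 // mxE.
rewrite /dot big1 ?ler10 // => j _; rewrite mxE; case: eqVneq => [_|ji].
  by rewrite mul0r.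
by rewrite xi // mulr0.
Qed.

Section FaceFunction.
Variables (a : multi_index n -> C) (P : {ffun 'I_n -> nat}) (D : seq (multi_index n)).
Hypothesis uD : uniq D.
Variable d : nat.
Hypothesis Dw : forall nu, nu \in D -> weight P nu = d.
Hypothesis degd : newton_deg P a = d%:R.
Hypothesis wD : forall nu, a nu != 0 -> weight P nu = d -> nu \in D.

(** The list [D] may replace the set of all exponents of weight [d] because the exponents left out
    have coefficient 0. *)
Lemma face_functionE z :
  face_function P a z = \sum_(nu <- D) a nu * monomial nu z.
Proof.
rewrite /face_function [RHS]fsbig_seq //; apply/esym/fsbig_widen.
  by move=> nu /= /Dw nud; rewrite dot_weight nud degd.
move=> nu /= [+ nuD]; rewrite dot_weight degd => /eqP; rewrite eqr_nat => /eqP nud.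
apply/eqP; rewrite mulf_eq0; apply/orP; left; apply/negPn/negP => anu.
by apply: nuD; exact: wD.
Qed.

Lemma face_function_diff z : 'd (face_function P a) z =
  lin_form (fun j => \sum_(nu <- D) a nu * dmonomial j nu z) :> ('rV[C]_n -> C).
Proof.
pose X := rnorm z + 1.
have X1 : 1 <= X by rewrite /X lerDr rnorm_ge0.
pose k := \sum_(nu <- D) rnorm (a nu) * ((mdeg nu ^ 2)%:R * X ^+ mdeg nu).
have k0 : 0 <= k.
  by apply: sumr_ge0 => nu _; rewrite !mulr_ge0 ?rnorm_ge0 ?exprn_ge0 // (le_trans _ X1).
apply: (proj2 (@quadratic_remainder_diff C 'rV[C]_n C (face_function P a) z
  (lin_form (fun j => \sum_(nu <- D) a nu * dmonomial j nu z)) (k%:C)%C _ _ _)).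
- exact: lin_form_continuous.
- by rewrite ler0c.
apply/rnorm_near; exists 1 => // h; rewrite subr0 => /ltW h1.
rewrite !normE -rmorphXn -rmorphM lecR !face_functionE.
rewrite (_ : _ - _ - _ = \sum_(nu <- D) a nu * (monomial nu (z + h) - monomial nu z -
   \sum_j h 0 j * dmonomial j nu z)); last first.
  rewrite -sumrB /lin_form; under [X in _ - X]eq_bigr do rewrite mulr_sumr.
  rewrite exchange_big -sumrB; apply: eq_bigr => nu _ /=.
  rewrite !mulrBr mulr_sumr; congr (_ - _); apply: eq_bigr => j _.
  by rewrite mulrCA.
apply: le_trans (rnorm_sum _ _ _) _; rewrite /k mulr_suml.
apply: ler_sum => nu _; rewrite rnormM -[leRHS]mulrA; apply: ler_wpM2l; first exact: rnorm_ge0.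
have X0 : 0 <= X by rewrite (le_trans _ X1).
have zX : rnorm z <= X by rewrite /X lerDl.
have zhX : rnorm (z + h) <= X by apply: le_trans (rnormD _ _) _; rewrite lerD2l.
have [_ _ _ _] := taylor_bound_monomial nu X0 (rnorm_ge0 h) zX zhX (lexx _).
by apply: le_trans; rewrite ler_peMl ?rnorm_ge0 // expr_ge1.
Qed.

Lemma face_function_partial (z : 'rV[C]_n) (j : 'I_n) : z 0 j * partial (face_function P a) j z =
  \sum_(nu <- D) (nu j)%:R * a nu * monomial nu z.
Proof.
rewrite /partial face_function_diff /lin_form.
rewrite (bigD1 j) //= mxE !eqxx mul1r [X in _ + X]big1 ?addr0; last first.
  by move=> i ij; rewrite mxE (negbTE ij) andbF mul0r.
rewrite mulr_sumr; apply: eq_bigr => nu _.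
by rewrite mulrCA mul_dmonomial mulrCA mulrA.
Qed.

(** Euler's identity for a weighted homogeneous polynomial, read off monomial by monomial. *)
Lemma face_function_euler (z : 'rV[C]_n) :
  \sum_j (P j)%:R * (z 0 j * partial (face_function P a) j z) =
  d%:R * face_function P a z.
Proof.
under eq_bigr do rewrite face_function_partial mulr_sumr.
rewrite exchange_big /= face_functionE mulr_sumr.
rewrite big_seq [RHS]big_seq; apply: eq_bigr => nu /Dw <-.
rewrite /weight natr_sum mulr_suml; apply: eq_bigr => j _.
by rewrite natrM !mulrA.
Qed.
End FaceFunction.
End NewtonPolyhedron.

(** * Limits along ultrafilters *)

Section UltraLimits.
Variables (T : Type) (F : set_system T).

(** The substitute for passing to a subsequence on which one of finitely many alternatives holds:
    otherwise all the complements would be in the ultrafilter. *)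
Lemma ultra_ex (FU : UltraFilter F) (I : finType) (Q : I -> T -> Prop) :
  (\forall t \near F, exists i, Q i t) -> exists i, \forall t \near F, Q i t.
Proof.
move=> h; apply: contrapT => hn.
have hc i : \forall t \near F, ~ Q i t.
  have [hi|//] := in_ultra_setVsetC (Q i) FU.
  by case: hn; exists i.
have : \forall t \near F, forall i, ~ Q i t by exact: filter_forall.
move=> h2; have [t [[i Qi] /(_ i)]] := filter_ex (filterI h h2).
by apply.
Qed.

(** A cluster point exists in a compact segment, and for an ultrafilter a cluster point is a limit,
    since each neighbourhood or its complement belongs to the filter. *)
Lemma ultra_bounded_cvg (FU : UltraFilter F) (R : realType) (q : T -> R) (M : R) :
  (\forall t \near F, `|q t| <= M) -> exists l : R, q @ F --> l.
Proof.
move=> qM; have FF : ProperFilter (q @ F) by exact: fmap_proper_filter.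
have [|l [_ hl]] := @segment_compact R (- M) M (q @ F) FF.
  by near=> t; rewrite /= in_itv /= -ler_norml; near: t.
exists l; apply/cvgrPdist_lt => e e0.
have [//|hc] := in_ultra_setVsetC [set t | `|l - q t| < e] FU.
have hq : F (q @^-1` (q @` [set t | ~ `|l - q t| < e])).
  by apply: filterS hc => t ht; exists t.
have [y [/= [t yt qt] ly]] := hl _ _ hq (nbhsx_ballx l e e0).
by exfalso; apply: yt; rewrite qt.
Unshelve. all: by end_near. Qed.

Lemma ultra_bounded_ccvg (FU : UltraFilter F) (R : realType)
    (q : T -> complexField R) (M : R) :
  (\forall t \near F, rnorm (q t) <= M) -> exists l : complexField R, q @ F --> l.
Proof.
move=> qM.
have [|l1 /cvgrPdist_lt h1] := @ultra_bounded_cvg FU R (fun t => complex.Re (q t)) M.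
  by apply: filterS qM => t; apply: le_trans; exact: Re_le_rnorm.
have [|l2 /cvgrPdist_lt h2] := @ultra_bounded_cvg FU R (fun t => complex.Im (q t)) M.
  by apply: filterS qM => t; apply: le_trans; exact: Im_le_rnorm.
exists (l1 +i* l2)%C; apply: rnorm_cvg => e e0.
have e20 : 0 < e / 2 by lra.
apply: filterS2 (h1 _ e20) (h2 _ e20) => t.
have := rnorm_le_ReIm (q t - (l1 +i* l2)%C).
case: (q t) => x y; rewrite /= (distrC l1) (distrC l2).
have -> : ((x +i* y)%C - (l1 +i* l2)%C : complexField R) = ((x - l1) +i* (y - l2))%C by [].
by move=> /=; lra.
Qed.

Lemma ccvg_unique {FF : ProperFilter F} (R : realType) (q : T -> complexField R)
    (k l : complexField R) : q @ F --> k -> q @ F --> l -> k = l.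
Proof.
move=> /cvg_rnorm hk /cvg_rnorm hl; apply/eqP; rewrite -subr_eq0 -rnorm_eq0.
rewrite eq_le rnorm_ge0 andbT; apply/ler_addgt0Pr => e e0; rewrite add0r.
have e20 : 0 < e / 2 by lra.
have [t [h1 h2]] := filter_ex (filterI (hk _ e20) (hl _ e20)).
have := rnormD (k - q t) (q t - l); rewrite subrKA (rnormB k (q t)).
by move: h1 h2 => /=; lra.
Qed.

End UltraLimits.

Lemma rcvg_sum (R : realType) (T : Type) (F : set_system T) {FF : Filter F}
    (I : Type) (s : seq I) (G : I -> T -> R) (l : I -> R) :
  (forall i, G i @ F --> l i) ->
  (fun x => \sum_(i <- s) G i x) @ F --> \sum_(i <- s) l i.
Proof.
move=> h; elim: s => [|i s IH].
  by rewrite big_nil; under eq_fun do rewrite big_nil; exact: (@cvg_cst R 0 _ F FF).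
rewrite big_cons; under eq_fun do rewrite big_cons.
exact: (@cvgD R R T F FF _ _ _ _ (h i) IH).
Qed.

(** * Integral weights from coordinates of unequal size *)

Section RationalDirection.
Variable R : realType.

Lemma common_denominator (I : finType) (r : I -> rat) :
  exists (d : int) (N : I -> int), 0 < d /\ forall i, d%:~R * r i = (N i)%:~R.
Proof.
exists (\prod_i denq (r i)), (fun i => numq (r i) * \prod_(k | k != i) denq (r k)).
split; first by rewrite prodr_gt0.
move=> i; rewrite (bigD1 i) //= !rmorphM /= -[r i in X in _ * X]divq_num_den.
by rewrite mulrAC mulrCA mulfV ?mulr1 // intr_eq0.
Qed.

(* The rational subspace orthogonal to the functionals that stay bounded along F
   contains vectors on which the functionals tending to infinity are positive. *)
Lemma rational_direction (T : Type) (F : set_system T) {FF : ProperFilter F}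
    (n : nat) (I J : finType) (dA : I -> 'I_n -> int) (dB : J -> 'I_n -> int)
    (x : T -> 'I_n -> R) (l : I -> R) :
  (forall i, (fun t => \sum_j (dA i j)%:~R * x t j) @ F --> l i) ->
  (forall k M, \forall t \near F, M <= \sum_j (dB k j)%:~R * x t j) ->
  exists (P : 'I_n -> int) (y : 'I_n -> R),
    [/\ forall i, \sum_j dA i j * P j = 0, forall k, 0 < \sum_j dB k j * P j &
        forall i, l i = \sum_j (dA i j)%:~R * y j].
Proof.
move=> hA hB.
pose A : 'M[rat]_(n, #|I|) := \matrix_(j, i) (dA (enum_val i) j)%:~R.
(* A rational projection: every [x *m Q] is annihilated by the functionals [dA]. The difference
   between [x] and [x *m Q] factors through [x *m A], which converges, so the functionals [dB] still
   tend to infinity on [x *m Q]. *)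
pose Q : 'M[rat]_n := 1%:M - A *m pinvmx A.
have QA : Q *m A = 0.
  by rewrite /Q mulmxBl mul1mx -mulmxA mulmxA mulmxKpV ?submx_refl // subrr.
pose AR : 'M[R]_(n, #|I|) := map_mx ratr A.
pose VR : 'M[R]_(#|I|, n) := map_mx ratr (pinvmx A).
pose QR : 'M[R]_n := map_mx ratr Q.
have QAR : QR *m AR = 0 by rewrite -map_mxM QA map_mx0.
have QRE : QR = 1%:M - AR *m VR by rewrite /QR /Q map_mxB map_mx1 map_mxM.
have AVA : AR *m VR *m AR = AR.
  by rewrite -!map_mxM /= mulmxKpV // submx_refl.
pose xr t : 'rV[R]_n := \row_j x t j.
pose lr : 'rV[R]_#|I| := \row_i l (enum_val i).
have xA i : (fun t => (xr t *m AR) 0 i) @ F --> lr 0 i.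
  rewrite mxE (_ : (fun t => _) = fun t => \sum_j (dA (enum_val i) j)%:~R * x t j).
    exact: hA.
  apply/funext => t; rewrite mxE; apply: eq_bigr => j _.
  by rewrite !mxE ratr_int mulrC.
have lim_mul m (N : 'M[R]_(#|I|, m)) k :
    (fun t => (xr t *m AR *m N) 0 k) @ F --> (lr *m N) 0 k.
  rewrite mxE (_ : (fun t => _) = fun t => \sum_i (xr t *m AR) 0 i * N i k).
    apply: rcvg_sum => i; exact: cvgMl (xA i).
  by apply/funext => t; rewrite mxE.
(* The vectors [xr t *m AR] are fixed by [VR *m AR], hence so is their limit. Thus [lr *m VR] is a
   point [y] at which the functionals [dA] take the limit values. *)
have lrE : lr *m VR *m AR = lr.
  apply/rowP => i; have := lim_mul _ (VR *m AR) i.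
  rewrite mulmxA (_ : (fun t => _) = fun t => (xr t *m AR) 0 i); last first.
    by apply/funext => t; rewrite -mulmxA (mulmxA AR) AVA.
  by move=> h; apply: cvg_unique h (xA i).
have [d [N [d0 hN]]] := common_denominator (fun ij : 'I_n * 'I_n => Q ij.1 ij.2).
pose B k : 'cV[R]_n := \col_j (dB k j)%:~R.
(* The right-hand side dominates the change of the k-th functional when each coordinate of [x t]
   moves by at most 1, so positivity will survive rounding. *)
have [t ht] : exists t, forall k, \sum_j `|(QR *m B k) j 0| < (xr t *m QR *m B k) 0 0.
  apply: (@filter_ex _ F); apply: filter_forall => k.
  pose c := (lr *m (VR *m B k)) 0 0.
  have h1 := lim_mul _ (VR *m B k) 0.
  move/cvgrPdist_lt : h1 => /(_ 1 ltr01) h1.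
  have h2 := hB k (c + 1 + \sum_j `|(QR *m B k) j 0|).
  apply: filterS2 h1 h2 => t /=.
  have -> : \sum_j (dB k j)%:~R * x t j = (xr t *m B k) 0 0.
    by rewrite mxE; apply: eq_bigr => j _; rewrite !mxE mulrC.
  have -> : (xr t *m QR *m B k) 0 0 = (xr t *m B k) 0 0 - (xr t *m AR *m (VR *m B k)) 0 0.
    by rewrite QRE mulmxBr mulmx1 mulmxBl -!mulmxA [LHS]mxE [X in _ + X]mxE.
  rewrite -/c; move: (\sum_j _) => S; rewrite ltr_norml => h3 h4.
  by move: h3 h4; lra.
(* [d] clears the denominators of [Q], so the image under [d * Q] of the rounded vector is integral;
   it remains orthogonal to [dA] because [Q *m A = 0]. *)
pose q j : int := Num.floor (x t j).
pose P j : int := \sum_i q i * N (i, j).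
have PE j : (P j)%:~R = d%:~R * ((\row_i (q i)%:~R : 'rV[R]_n) *m QR) 0 j.
  rewrite /P rmorph_sum /= mxE mulr_sumr; apply: eq_bigr => i _.
  rewrite rmorphM /= [QR _ _]mxE [(\row_i _) 0 i]mxE mulrCA; congr (_ * _).
  by have := congr1 (ratr : rat -> R) (hN (i, j)); rewrite /= rmorphM /= !ratr_int => <-.
have PB (c : 'cV[R]_n) (z : 'I_n -> int) : (forall j, c j 0 = (z j)%:~R) ->
    (\sum_j z j * P j)%:~R = d%:~R * ((\row_i (q i)%:~R : 'rV[R]_n) *m QR *m c) 0 0.
  move=> cz; rewrite rmorph_sum mxE mulr_sumr; apply: eq_bigr => j _.
  by rewrite rmorphM /= PE cz mulrC mulrA.
exists P, (fun j => (lr *m VR) 0 j); split.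
- move=> i; apply/eqP; rewrite -(intr_eq0 R) (PB (col (enum_rank i) AR)); last first.
    by move=> j; rewrite !mxE enum_rankK ratr_int.
  by rewrite colE mulmxA -(mulmxA _ QR) QAR mulmx0 mul0mx mxE mulr0.
- move=> k; rewrite -(ltr0z R) (PB (B k)); last by move=> j; rewrite mxE.
  rewrite mulr_gt0 ?ltr0z //.
  have := ht k; rewrite -!mulmxA; set w := QR *m B k.
  rewrite ![(_ *m w) 0 0]mxE -subr_gt0 => /lt_le_trans; apply.
  rewrite -sumrB; apply: ler_sum => j _; rewrite !mxE.
  have q1 := floor_le_tmp (x t j).
  have q2 := floorD1_gt (x t j).
  rewrite -/(q j) rmorphD in q2; rewrite -/(q j) in q1.
  rewrite lerBlDr -lerBlDl -mulrBl; apply: le_trans (ler_norm _) _.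
  by rewrite normrM ler_piMl // ler_norml; apply/andP; split; move: q2 => /=; lra.
- move=> i; have := congr1 (fun M : 'rV_ _ => M 0 (enum_rank i)) lrE.
  rewrite /lr mxE [RHS]mxE enum_rankK => <-; apply: eq_bigr => j _.
  by rewrite [AR _ _]mxE [A _ _]mxE enum_rankK ratr_int mulrC.
Qed.

End RationalDirection.

(** * Reduction to finitely many monomials on the torus *)

Section Box.
Variables (R : realType) (n K : nat).
Local Notation C := (complexField R).
Implicit Types (z : 'rV[C]_n) (nu : multi_index n).

Local Notation box := {ffun 'I_n -> 'I_K.+1}.

Definition box_index (beta : box) : multi_index n := [ffun j => beta j : nat].

Lemma box_index_inj : injective box_index.
Proof.
move=> b1 b2 /ffunP h; apply/ffunP => j; apply: val_inj.
by have := h j; rewrite !ffunE.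
Qed.

Lemma box_indexP nu : (exists beta, nu = box_index beta) \/ exists i, (K < nu i)%N.
Proof.
have [/forallP h|] := boolP [forall i, (nu i <= K)%N].
  left; exists [ffun i => inord (nu i)]; apply/ffunP => j; rewrite !ffunE.
  by rewrite inordK // ltnS.
by rewrite negb_forall => /existsP[j]; rewrite -ltnNge; right; exists j.
Qed.

(* Monomials live on the torus, so zero coordinates are replaced by a power of
   |z| which is negligible against every monomial of the box. *)
Definition shift z : 'rV[C]_n :=
  \row_j (if z 0 j == 0 then (rnorm z ^+ K.+1)%:C%C else z 0 j).

Section Shift.
Variable z : 'rV[C]_n.
Hypotheses (z0 : z != 0) (z1 : rnorm z <= 1).

Let m0 : 0 < rnorm z. Proof. by rewrite rnorm_gt0. Qed.

Lemma shift_torus : torus (shift z).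
Proof.
move=> j; rewrite mxE; case: ifPn => // _.
apply/eqP => /(congr1 (@complex.Re R)) /= /eqP; apply/negP.
by rewrite expf_neq0 // gt_eqF.
Qed.

Lemma rnorm_shift_ge j : rnorm (z 0 j) <= rnorm (shift z 0 j).
Proof.
by rewrite mxE; case: eqVneq => // ->; rewrite rnorm0 rnorm_ge0.
Qed.

Lemma rnorm_shift_le j : rnorm (shift z 0 j) <= rnorm z.
Proof.
rewrite mxE; case: eqVneq => [_|_]; last exact: rnorm_coord.
rewrite rnorm_real ger0_norm ?exprn_ge0 ?rnorm_ge0 // exprS ler_piMr ?rnorm_ge0 //.
by rewrite exprn_ile1 // rnorm_ge0.
Qed.

Lemma rnorm_monomial nu w : rnorm (monomial nu w : C) = \prod_j rnorm (w 0 j) ^+ nu j.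
Proof. by rewrite /monomial rnorm_prod; apply: eq_bigr => j _; rewrite rnormX. Qed.

Variables (k : 'I_n -> nat) (M : R).
Hypotheses (kK : forall i, (k i <= K)%N).
Hypothesis kM : forall i, rnorm (shift z 0 i) ^+ k i <= M.

(** In use, [k i] is the exponent of an axis monomial of the series and [M] the modulus of its
    dominant monomial. The two values differ only if a zero coordinate occurs in the monomial; then
    the shifted one contains [|z| ^ (K + 1)], and [|z| ^ K] is bounded by the axis monomial of a
    coordinate [i] with [|z_i| = |z|]. *)
Lemma monomial_shift nu :
  rnorm (monomial nu z - monomial nu (shift z)) <= rnorm z * M.
Proof.
have M0 (i : 'I_n) : 0 <= M by apply: le_trans (kM i); rewrite exprn_ge0 ?rnorm_ge0.
have [i zi] := rnorm_row_arg z0.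
have [/forallP h|] := boolP [forall j, (z 0 j == 0) ==> (nu j == 0%N)].
  rewrite (_ : monomial nu z = monomial nu (shift z)) ?subrr ?rnorm0 ?mulr_ge0 ?(M0 i) ?ltW //.
  apply: eq_bigr => j _; rewrite mxE; have := h j; case: eqVneq => //= zj /eqP ->.
  by rewrite !expr0.
rewrite negb_forall => /existsP[j]; rewrite negb_imply => /andP[/eqP zj nuj].
have -> : monomial nu z = 0.
  by rewrite /monomial (bigD1 j) //= zj expr0n (negbTE nuj) mul0r.
rewrite sub0r rnormN rnorm_monomial (bigD1 j) //=.
apply: (@le_trans _ _ (rnorm z ^+ K.+1)).
  rewrite -[leRHS]mulr1; apply: ler_pM; rewrite ?exprn_ge0 ?rnorm_ge0 //.
  - by apply: prodr_ge0 => l _; rewrite exprn_ge0 // rnorm_ge0.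
  - have := nuj; rewrite -lt0n; case: (nu j) => // q _.
    rewrite mxE zj eqxx rnorm_real ger0_norm ?exprn_ge0 ?rnorm_ge0 // exprS ler_piMr //.
      by rewrite exprn_ge0 ?rnorm_ge0.
    by rewrite exprn_ile1 ?exprn_ge0 ?exprn_ile1 ?rnorm_ge0.
  - apply: prodr_ile1 => l _; rewrite exprn_ge0 ?rnorm_ge0 //= exprn_ile1 ?rnorm_ge0 //.
    exact: le_trans (rnorm_shift_le _) z1.
rewrite exprS; apply: ler_wpM2l; first exact: ltW.
apply: le_trans (kM i); rewrite mxE.
have -> : (z 0 i == 0) = false by apply/negbTE; rewrite -rnorm_eq0 -zi gt_eqF.
by rewrite -zi; apply: ler_wiXn2l => //; exact: ltW.
Qed.

(** A factor of degree [k i] in the i-th coordinate is bounded by [M], one further factor by [|z|],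
    and the rest by powers of [s]. The factor [s^-1 ^+ K.+1] restores the at most [K + 1] powers of
    [s] spent in this way. *)
Lemma monomial_tail (s : R) nu i : 0 < s -> s <= 1 -> rnorm z <= s -> (K < nu i)%N ->
  rnorm (monomial nu z) <= rnorm z * M * s^-1 ^+ K.+1 * s ^+ mdeg nu.
Proof.
move=> s0 s1 zs nui.
have M0 : 0 <= M by apply: le_trans (kM i); rewrite exprn_ge0 ?rnorm_ge0.
have ki : (k i < nu i)%N by apply: leq_ltn_trans nui.
apply: (@le_trans _ _ (M * rnorm z ^+ (mdeg nu - k i))).
  rewrite rnorm_monomial (bigD1 i) //=.
  rewrite (_ : (mdeg nu - k i = (nu i - k i) + \sum_(j | j != i) nu j)%N); last first.
    by rewrite /mdeg (bigD1 i) //= addnBAC // ltnW.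
  rewrite exprD mulrA; apply: ler_pM; rewrite ?exprn_ge0 ?rnorm_ge0 //.
  - by apply: prodr_ge0 => l _; rewrite exprn_ge0 // rnorm_ge0.
  - rewrite -[in leLHS](subnKC (ltnW ki)) exprD; apply: ler_pM; rewrite ?exprn_ge0 ?rnorm_ge0 //.
      apply: le_trans (kM i); apply: lerXn2r; rewrite ?nnegrE ?rnorm_ge0 //.
      exact: rnorm_shift_ge.
    by apply: lerXn2r; rewrite ?nnegrE ?rnorm_ge0 // rnorm_coord.
  - rewrite -prodrXr; apply: ler_prod => j _; rewrite exprn_ge0 ?rnorm_ge0 //=.
    by apply: lerXn2r; rewrite ?nnegrE ?rnorm_ge0 // rnorm_coord.
rewrite [rnorm z * M]mulrC -!mulrA; apply: ler_wpM2l => //.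
have kd : (k i < mdeg nu)%N by apply: leq_trans ki (nu_le_mdeg _ _).
rewrite -(subnSK kd) exprS; apply: ler_wpM2l; first exact: ltW.
apply: (@le_trans _ _ (s ^+ (mdeg nu - (k i).+1))).
  by apply: lerXn2r; rewrite ?nnegrE ?(ltW m0) ?(ltW s0).
rewrite -{2}(subnKC kd) exprD mulrA -{1}[s ^+ _]mul1r.
apply: ler_wpM2r; first by rewrite exprn_ge0 // ltW.
rewrite exprVn mulrC ler_pdivlMr ?exprn_gt0 // mul1r.
by apply: ler_wiXn2l; rewrite ?ltnS // ltW.
Qed.
End Shift.

(** The error has order [|z| * M]: [monomial_tail] bounds the exponents outside the box and
    [monomial_shift] the change of point inside it. After division by a monomial of modulus [M] it
    tends to 0. *)
Lemma shift_expansion (c : multi_index n -> C) (F : 'rV[C]_n -> C) (s S : R)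
    (k : 'I_n -> nat) : 0 < s -> s <= 1 -> abs_summable c s S ->
  (forall z, rnorm z <= s ->
   partial_sum (fun nu => c nu * monomial nu z) @ totally --> F z) ->
  (forall i, (k i <= K)%N) ->
  exists C0 : R, forall z M, z != 0 -> rnorm z <= s ->
    (forall i, rnorm (shift z 0 i) ^+ k i <= M) ->
    rnorm (F z - \sum_beta c (box_index beta) * monomial (box_index beta) (shift z))
    <= C0 * rnorm z * M.
Proof.
move=> s0 s1 cS hF kK.
exists (s^-1 ^+ K.+1 * S + \sum_beta rnorm (c (box_index beta))) => z M z0 zs kM.
have z1 := le_trans zs s1.
have m0 : 0 <= rnorm z by exact: rnorm_ge0.
pose J := [fset box_index beta | beta in box]%fset.
have bigJ (G : multi_index n -> C) : \sum_(nu <- J) G nu = \sum_beta G (box_index beta).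
  rewrite big_imfset /=; last by move=> ? ? _ _; exact: box_index_inj.
  by rewrite big_enum.
have c1 := @cvg_sumB _ _ _ _ J (hF z zs); rewrite bigJ in c1.
pose k0 := rnorm z * M * s^-1 ^+ K.+1.
have [[i1 _]|n0] := pselect (exists i : 'I_n, True); last first.
  by case/eqP: z0; apply/rowP => j; case: n0; exists j.
have M0 : 0 <= M by apply: le_trans (kM i1); rewrite exprn_ge0 ?rnorm_ge0.
have k00 : 0 <= k0 by rewrite !mulr_ge0 // exprn_ge0 // invr_ge0 ltW.
have h1 : rnorm (F z - \sum_beta c (box_index beta) * monomial (box_index beta) z) <= k0 * S.
  apply: cvg_sum_le c1 _; apply: sum_boundedW (sum_boundedZ k00 cS) => nu /=.
  case: ifPn => [_|nuJ].
    rewrite rnorm0; apply: mulr_ge0 => //; apply: mulr_ge0; first exact: rnorm_ge0.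
    by rewrite exprn_ge0 // ltW.
  rewrite rnormM mulrCA; apply: ler_wpM2l; first exact: rnorm_ge0.
  have [[beta nub]|[l nul]] := box_indexP nu.
    by case/negP: nuJ; apply/imfsetP; exists beta.
  exact: monomial_tail nul.
have h2 : rnorm (\sum_beta c (box_index beta) * monomial (box_index beta) z -
    \sum_beta c (box_index beta) * monomial (box_index beta) (shift z)) <=
    (\sum_beta rnorm (c (box_index beta))) * (rnorm z * M).
  rewrite -sumrB; apply: le_trans (rnorm_sum _ _ _) _; rewrite mulr_suml.
  apply: ler_sum => beta _; rewrite -mulrBr rnormM; apply: ler_wpM2l; first exact: rnorm_ge0.
  exact: monomial_shift kM _.
rewrite -(subrKA (\sum_beta c (box_index beta) * monomial (box_index beta) z)).
apply: le_trans (rnormD _ _) _; apply: le_trans (lerD h1 h2) _.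
rewrite /k0 -subr_ge0 (_ : _ - _ = 0) //; ring.
Qed.
End Box.

(** * Dominant monomials *)

Section LeadingTerm.
Variables (R : realType) (n K : nat).
Local Notation C := (complexField R).
Local Notation box := {ffun 'I_n -> 'I_K.+1}.
Variables (F : set_system 'rV[C]_n) (FU : UltraFilter F).
Hypothesis Fsmall : forall e : R, 0 < e -> \forall z \near F, rnorm z < e.
Hypothesis Fneq0 : \forall z \near F, z != 0.

Let mon (beta : box) (z : 'rV[C]_n) : C := monomial (box_index beta) (shift K z).

Variables (a : multi_index n -> C) (k : 'I_n -> nat).
Hypothesis kK : forall i, (k i <= K)%N.
Hypothesis ak : forall i, a (axis_index i (k i)) != 0.

Definition axis_box (i : 'I_n) : box :=
  [ffun j => if j == i then inord (k i) else ord0].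

Lemma axis_boxE i : box_index (axis_box i) = axis_index i (k i).
Proof.
apply/ffunP => j; rewrite !ffunE; case: eqVneq => // _.
by rewrite inordK // ltnS.
Qed.

Lemma monomial_axis i z : monomial (axis_index i (k i)) z = z 0 i ^+ k i :> C.
Proof.
rewrite /monomial (bigD1 i) //= ffunE eqxx big1 ?mulr1 // => j ji.
by rewrite ffunE (negbTE ji) expr0.
Qed.

Lemma mon_neq0 beta z : z != 0 -> mon beta z != 0.
Proof.
move=> z0; rewrite /mon /monomial; apply/prodf_neq0 => j _.
by apply: expf_neq0; exact: shift_torus.
Qed.

(** [ultra_ex] picks one monomial of the support that is largest near [F]; the quotients by it are
    bounded by 1 and converge. It dominates the axis monomials, so the error of [shift_expansion] is
    negligible against it. The last clause is stated for every [c] supported in the support of [a],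
    in order to cover both [f] and [z_j d_jf]. *)
Lemma leading_term : exists (betaf : box) (rho : box -> C),
  [/\ a (box_index betaf) != 0,
      \forall z \near F, forall beta, a (box_index beta) != 0 ->
        rnorm (mon beta z) <= rnorm (mon betaf z),
      forall beta, a (box_index beta) != 0 ->
        (fun z => mon beta z / mon betaf z) @ F --> rho beta &
      forall (c : multi_index n -> C) (f : 'rV[C]_n -> C) (s S : R),
        0 < s -> s <= 1 -> abs_summable c s S ->
        (forall z, rnorm z <= s ->
         partial_sum (fun nu => c nu * monomial nu z) @ totally --> f z) ->
        (forall nu, a nu = 0 -> c nu = 0) ->
        (fun z => f z / mon betaf z) @ F -->
        \sum_(beta | a (box_index beta) != 0) c (box_index beta) * rho beta].
Proof.
have [betaf hbetaf] : exists betaf, \forall z \near F,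
    a (box_index betaf) != 0 /\ forall beta, a (box_index beta) != 0 ->
      rnorm (mon beta z) <= rnorm (mon betaf z).
  apply: (ultra_ex FU); apply: filterS Fneq0 => z z0.
  have [i0 _] := rnorm_row_arg z0.
  have ai0 : a (box_index (axis_box i0)) != 0 by rewrite axis_boxE.
  have [beta abeta hmax] := @arg_maxP _ _ _ (axis_box i0)
    (fun beta => a (box_index beta) != 0) (fun beta => rnorm (mon beta z)) ai0.
  by exists beta.
have abf : a (box_index betaf) != 0 by have [z []] := filter_ex hbetaf.
have hmax : \forall z \near F, forall beta, a (box_index beta) != 0 ->
    rnorm (mon beta z) <= rnorm (mon betaf z).
  by apply: filterS hbetaf => z [].
have hrho beta : exists l : C, a (box_index beta) != 0 ->
    (fun z => mon beta z / mon betaf z) @ F --> l.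
  have [abeta|_] := boolP (a (box_index beta) != 0); last by exists 0.
  have [|l hl] := @ultra_bounded_ccvg _ F FU R (fun z => mon beta z / mon betaf z) 1.
    apply: filterS2 hmax Fneq0 => z hz z0.
    rewrite rnormM rnormV ler_pdivrMr ?mul1r; first exact: hz.
    by rewrite rnorm_gt0; exact: mon_neq0.
  by exists l.
have [rho rhoP] := choice hrho.
exists betaf, rho; split => // c f s S s0 s1 cS hf ac.
have [C0 hC0] := shift_expansion s0 s1 cS hf kK.
have h1 : (fun z => \sum_(beta | a (box_index beta) != 0)
    c (box_index beta) * (mon beta z / mon betaf z)) @ F -->
    \sum_(beta | a (box_index beta) != 0) c (box_index beta) * rho beta.
  rewrite big_mkcond; under eq_fun do rewrite big_mkcond.
  apply: (@ccvg_sum R _ F _ _ _ (fun beta z => if a (box_index beta) != 0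
    then c (box_index beta) * (mon beta z / mon betaf z) else 0)) => beta.
  by case: ifPn => [/rhoP h|_]; [exact: ccvgMl h|exact: ccvg_cst].
apply: rnorm_cvg => e e0.
have e20 : 0 < e / 2 by lra.
have C10 : 0 < `|C0| + 1 by rewrite ltr_wpDl.
have hs := Fsmall s0; have he := Fsmall (divr_gt0 e20 C10).
near=> z.
have z0 : z != 0 by near: z.
have zs : rnorm z <= s by apply: ltW; near: z.
have zm : forall beta, a (box_index beta) != 0 ->
  rnorm (mon beta z) <= rnorm (mon betaf z) by near: z.
have mz0 : 0 < rnorm (mon betaf z) by rewrite rnorm_gt0; exact: mon_neq0.
have hk i : rnorm (shift K z 0 i) ^+ k i <= rnorm (mon betaf z).
  have := zm (axis_box i); rewrite /mon axis_boxE monomial_axis rnormX; apply.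
  exact: ak.
have := hC0 z (rnorm (mon betaf z)) z0 zs hk.
rewrite (bigID (fun beta => a (box_index beta) != 0)) /= [X in _ - (_ + X)]big1 ?addr0; last first.
  by move=> beta /negPn /eqP /ac ->; rewrite mul0r.
move=> h2.
have h3 : rnorm (\sum_(beta | a (box_index beta) != 0)
    c (box_index beta) * (mon beta z / mon betaf z) -
    \sum_(beta | a (box_index beta) != 0) c (box_index beta) * rho beta) < e / 2.
  by near: z; exact: cvg_rnorm h1 _ e20.
have h4 : rnorm (f z / mon betaf z - \sum_(beta | a (box_index beta) != 0)
    c (box_index beta) * (mon beta z / mon betaf z)) <= C0 * rnorm z.
  under eq_bigr do rewrite mulrA.
  rewrite -mulr_suml -mulrBl rnormM rnormV ler_pdivrMr //.
have h5 : C0 * rnorm z <= e / 2.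
  apply: (@le_trans _ _ ((`|C0| + 1) * rnorm z)).
    by apply: ler_wpM2r; [exact: rnorm_ge0|have := ler_norm C0; lra].
  rewrite mulrC -ler_pdivlMr //; apply: ltW; near: z; exact: he.
rewrite -(subrKA (\sum_(beta | a (box_index beta) != 0)
    c (box_index beta) * (mon beta z / mon betaf z))).
by apply: le_lt_trans (rnormD _ _) _; lra.
Unshelve. all: by end_near. Qed.
End LeadingTerm.

(** * The limiting face and the limiting point of the torus *)

Section NewtonLimits.
Variables (R : realType) (n : nat).
Local Notation C := (complexField R).

Lemma monomial_polar (y : 'I_n -> R) (w t : 'rV[C]_n) (nu : multi_index n) :
  (forall j, w 0 j = (expR (- y j))%:C%C * t 0 j) ->
  monomial nu w = (expR (- \sum_j (nu j)%:R * y j))%:C%C * monomial nu t.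
Proof.
move=> wE; rewrite /monomial; under eq_bigr do rewrite wE exprMn.
rewrite big_split /=; congr (_ * _).
rewrite -sumrN (big_morph expR (@expRD R) (@expR0 R)) rmorph_prod /=.
apply: eq_bigr => j _; rewrite -rmorphXn /= -expRM_natl; congr (_ %:C)%C.
by rewrite mulrN.
Qed.

Lemma ccvg_monomial (T : Type) (F : set_system T) {FF : Filter F}
    (u : T -> 'rV[C]_n) (l : 'rV[C]_n) (nu : multi_index n) :
  (forall j, (fun t => u t 0 j) @ F --> l 0 j) ->
  (fun t => monomial nu (u t)) @ F --> monomial nu l.
Proof.
move=> h; rewrite /monomial; elim: (index_enum _) => [|j s IH].
  by rewrite big_nil; under eq_fun do rewrite big_nil; exact: ccvg_cst.
rewrite big_cons; under eq_fun do rewrite big_cons.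
apply: (@cvgM C _ F FF _ _ _ _ _ IH).
elim: (nu j) => [|q IHq].
  by rewrite expr0; under eq_fun do rewrite expr0; exact: ccvg_cst.
rewrite exprS; under eq_fun do rewrite exprS.
exact: (@cvgM C _ F FF _ _ _ _ (h j) IHq).
Qed.

Lemma cvg_real_complex (T : Type) (F : set_system T) {FF : Filter F}
    (u : T -> R) (l : R) : u @ F --> l ->
  (fun t => (u t)%:C%C : C) @ F --> (l%:C%C : C).
Proof.
move=> /cvgrPdist_lt h; apply: rnorm_cvg => e /h; apply: filterS => t.
by rewrite -rmorphB /= rnorm_real distrC.
Qed.

Lemma cvg_rnorm_norm (T : Type) (F : set_system T) {FF : Filter F}
    (u : T -> C) (l : C) : u @ F --> l -> (fun t => rnorm (u t)) @ F --> rnorm l.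
Proof.
move=> /cvg_rnorm h; apply/cvgrPdist_lt => e /h; apply: filterS => t.
apply: le_lt_trans; rewrite ler_norml; apply/andP; split.
  by have := rnormD (u t - l) l; rewrite subrK; lra.
by have := rnormD (l - u t) (u t); rewrite subrK rnormB; lra.
Qed.

Lemma rcvg_near (T : Type) (F : set_system T) {FF : Filter F} (u : T -> R) (l e : R) :
  u @ F --> l -> 0 < e -> \forall t \near F, `|l - u t| < e.
Proof. by move=> /cvgrPdist_lt h; exact: h. Qed.

Let div_mulK (K : fieldType) (p q s t : K) : t != 0 -> q != 0 ->
  p * s / (q * t) * t = p / q * s.
Proof. by move=> t0 q0; field; rewrite t0 q0. Qed.

(** The index [e : bool] stands for the pair [f], [g]. The weight and the torus point must be common
    to both, so the monomial quotients of both functions enter one application of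
    [rational_direction]. [M e] is the dominant monomial at the shifted point, and [m e] the inverse
    of its value at [b]. *)
Theorem newton_limits (F : set_system 'rV[C]_n) (f : bool -> 'rV[C]_n -> C)
    (a : bool -> multi_index n -> C) : UltraFilter F ->
  (forall e : R, 0 < e -> \forall z \near F, rnorm z < e) ->
  (\forall z \near F, z != 0) ->
  (forall e, has_power_series (f e) 0 (a e)) -> (forall e, convenient (a e)) ->
  exists (P : {ffun 'I_n -> nat}) (b : 'rV[C]_n) (M : bool -> 'rV[C]_n -> C)
    (m : bool -> C) (d : bool -> nat),
  [/\ strictly_positive P, torus b &
  forall e,
  [/\ (\forall z \near F, M e z != 0) /\ m e != 0,
      (fun z => f e z / M e z) @ F --> m e * face_function P (a e) b,
      forall j, (fun z : 'rV[C]_n => z 0 j * partial (f e) j z / M e z) @ F -->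
        m e * (b 0 j * partial (face_function P (a e)) j b),
      newton_deg P (a e) = (d e)%:R &
      \sum_j (P j)%:R * (b 0 j * partial (face_function P (a e)) j b) =
        (d e)%:R * face_function P (a e) b]].
Proof.
move=> FU Fsmall Fneq0 fa ca.
have FP : ProperFilter F by exact: ultra_proper.
have FF : Filter F by exact _.
have [k ak] := choice (fun ei : bool * 'I_n => convenient_axis (ca ei.1) ei.2).
(* One box holds the axis monomials of both functions; an exponent outside it is heavier than an
   axis monomial for every strictly positive weight. *)
pose K := (\max_ei k ei)%N.
have kK e i : (k (e, i) <= K)%N by exact: (leq_bigmax (e, i)).
pose box := {ffun 'I_n -> 'I_K.+1}.
pose mon (beta : box) (z : 'rV[C]_n) : C := monomial (box_index beta) (shift K z).
pose leading e (p : box * (box -> C)) : Prop :=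
  [/\ a e (box_index p.1) != 0,
      \forall z \near F, forall beta, a e (box_index beta) != 0 ->
        rnorm (mon beta z) <= rnorm (mon p.1 z),
      forall beta, a e (box_index beta) != 0 ->
        (fun z => mon beta z / mon p.1 z) @ F --> p.2 beta &
      forall (c : multi_index n -> C) (h : 'rV[C]_n -> C) (s S : R),
        0 < s -> s <= 1 -> abs_summable c s S ->
        (forall z, rnorm z <= s ->
         partial_sum (fun nu => c nu * monomial nu z) @ totally --> h z) ->
        (forall nu, a e nu = 0 -> c nu = 0) ->
        (fun z => h z / mon p.1 z) @ F -->
        \sum_(beta | a e (box_index beta) != 0) c (box_index beta) * p.2 beta].
have exleading e : exists p, leading e p.
  have [betaf [rho h]] :=
    @leading_term R n K F FU Fsmall Fneq0 (a e) (fun i => k (e, i)) (kK e) (fun i => ak (e, i)).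
  by exists (betaf, rho).
have [L LP] := choice exleading.
pose bf e := (L e).1; pose rho e := (L e).2.
(* Polar coordinates of the shifted point: logarithmic sizes, which tend to infinity, and phases
   [th], which converge along the ultrafilter. *)
pose x (z : 'rV[C]_n) (j : 'I_n) : R := - ln (rnorm (shift K z 0 j)).
pose th (z : 'rV[C]_n) : 'rV[C]_n :=
  \row_j (shift K z 0 j / (rnorm (shift K z 0 j))%:C%C).
have shift_pos z j : z != 0 -> 0 < rnorm (shift K z 0 j).
  by move=> z0; rewrite rnorm_gt0; exact: shift_torus.
have rC0 (r : R) : 0 < r -> (r%:C%C : C) != 0.
  by move=> r0; rewrite -rnorm_eq0 rnorm_real normr_eq0 gt_eqF.
have polar z beta : z != 0 -> mon beta z =
    (expR (- \sum_j (box_index beta j)%:R * x z j))%:C%C * monomial (box_index beta) (th z).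
  move=> z0; apply: monomial_polar => j; rewrite /x opprK lnK ?posrE ?shift_pos //.
  by rewrite [th z 0 j]mxE mulrC divfK // rC0 // shift_pos.
have th1 z j : z != 0 -> rnorm (th z 0 j) = 1.
  move=> z0; rewrite [th z 0 j]mxE rnormM rnormV rnorm_real ger0_norm ?rnorm_ge0 //.
  by rewrite mulfV // gt_eqF // shift_pos.
have mth1 z beta : z != 0 -> rnorm (monomial (box_index beta) (th z)) = 1.
  by move=> z0; rewrite rnorm_monomial big1 // => j _; rewrite th1 // expr1n.
have expdiff (v : 'I_n -> R) e (beta : box) :
    (expR (- \sum_j (box_index beta j)%:R * v j))%:C%C /
    (expR (- \sum_j (box_index (bf e) j)%:R * v j))%:C%C =
    (expR (- \sum_j ((beta j)%:Z - (bf e j)%:Z)%:~R * v j))%:C%C :> C.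
  rewrite -fmorphV -rmorphM /= -expRN -expRD; congr (expR _)%:C%C.
  rewrite opprK addrC -sumrB -sumrN; apply: eq_bigr => j _.
  by rewrite !ffunE rmorphB /=; ring.
have normratio e beta z : z != 0 -> rnorm (mon beta z / mon (bf e) z) =
    expR (- \sum_j ((beta j)%:Z - (bf e j)%:Z)%:~R * x z j).
  move=> z0; rewrite rnormM rnormV !polar // !rnormM !mth1 // !mulr1.
  rewrite !rnorm_real !ger0_norm ?expR_ge0 // -expRN -expRD; congr expR.
  rewrite opprK addrC -sumrB -sumrN; apply: eq_bigr => j _.
  by rewrite !ffunE rmorphB /=; ring.
have xinf j (M : R) : \forall z \near F, M <= x z j.
  have h := Fsmall _ (expR_gt0 (- M)).
  apply: filterS3 h Fneq0 (Fsmall 1 ltr01) => z zM z0 z1.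
  rewrite /x lerNr -[- M]expRK ler_ln ?posrE ?shift_pos ?expR_gt0 //.
  by apply: le_trans (ltW zM); apply: rnorm_shift_le => //; exact: ltW.
have [thl thlP] : {thl : 'I_n -> C & forall j, (fun z => th z 0 j) @ F --> thl j}.
  apply: (@choice 'I_n C (fun j l => (fun z => th z 0 j) @ F --> l)) => j.
  apply: (@ultra_bounded_ccvg _ F FU R (fun z => th z 0 j) 1).
  by apply: filterS Fneq0 => z z0; rewrite th1.
have thl1 j : rnorm (thl j) = 1.
  have h1 := @cvg_rnorm_norm _ F FF _ _ (thlP j).
  have h2 : (fun z => rnorm (th z 0 j)) @ F --> (1 : R).
    by apply: cvg_near_cst; apply: filterS Fneq0 => z z0; rewrite th1.
  by apply: (cvg_unique _ h1 h2).
(* A monomial quotient with nonzero limit gives a convergent functional of the sizes, and one with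
   limit 0 ([cond2]) a functional tending to infinity. The weight must vanish on the former and be
   positive on the latter. *)
pose cond e beta := (a e (box_index beta) != 0) && (rho e beta != 0).
pose dA (i : bool * box) j : int := if cond i.1 i.2 then (i.2 j)%:Z - (bf i.1 j)%:Z else 0.
pose cond2 e beta := (a e (box_index beta) != 0) && (rho e beta == 0).
have [z1 z1n0] := filter_ex Fneq0; have [j0 _] := rnorm_row_arg z1n0.
(* An index that imposes no condition receives the coordinate [j0], which also tends to infinity.
   The [inr] functionals are the coordinates themselves; positivity on them makes the weight
   strictly positive. *)
pose dB (i : (bool * box) + 'I_n) j : int :=
  match i with
  | inl i => if cond2 i.1 i.2 then (i.2 j)%:Z - (bf i.1 j)%:Z else (j == j0)%:Z
  | inr i => (j == i)%:Z
  end.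
have sum_delta (i : 'I_n) (v : 'I_n -> R) : \sum_j ((j == i)%:Z)%:~R * v j = v i.
  by rewrite (bigD1 i) //= eqxx mul1r big1 ?addr0 // => j /negbTE ->; rewrite mul0r.
pose l (i : bool * box) : R := if cond i.1 i.2 then - ln (rnorm (rho i.1 i.2)) else 0.
have hA i : (fun z => \sum_j (dA i j)%:~R * x z j) @ F --> l i.
  case: i => e beta; rewrite /dA /l /=; case: ifPn => [/andP[ab rb]|_]; last first.
    under eq_fun do under eq_bigr do rewrite mul0r.
    under eq_fun do rewrite big1 //.
    exact: (@cvg_cst R 0 _ F _).
  have h1 := @cvg_rnorm_norm _ F FF _ _ (let: And4 _ _ h _ := LP e in h beta ab).
  have rp : 0 < rnorm (rho e beta) by rewrite rnorm_gt0.
  have h2 := cvg_comp _ _ h1 (continuous_ln rp).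
  have h3 := @cvgN _ _ _ F FF _ _ h2.
  apply/cvgrPdist_lt => eps eps0; have := @rcvg_near _ F FF _ _ _ h3 eps0.
  apply: filterS2 Fneq0 => z z0 /=.
  by rewrite fctE /= normratio // expRK opprK.
have hB i (M : R) : \forall z \near F, M <= \sum_j (dB i j)%:~R * x z j.
  case: i => [[e beta]|i] /=; last first.
    by apply: filterS (xinf i M) => z; rewrite sum_delta.
  case: (boolP (cond2 e beta)) => [/andP[ab /eqP rb]|_]; last first.
    by apply: filterS (xinf j0 M) => z; rewrite sum_delta.
  have [_ _ h _] := LP e; have h1 := @cvg_rnorm_norm _ F FF _ _ (h beta ab).
  rewrite -/(rho e beta) rb rnorm0 in h1.
  have := @rcvg_near _ F FF _ _ _ h1 (expR_gt0 (- M)).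
  apply: filterS2 Fneq0 => z z0; rewrite sub0r normrN ger0_norm ?rnorm_ge0 //.
  by rewrite -/(bf e) normratio // ltr_expR ltrN2 => /ltW.
have [P [y [PA PB yA]]] := rational_direction hA hB.
have P0 j : 0 < P j.
  have := PB (inr j); rewrite /dB (bigD1 j) //= eqxx mul1r big1 ?addr0 //.
  by move=> i /negbTE ->; rewrite mul0r.
pose PN : {ffun 'I_n -> nat} := [ffun j => `|P j|%N].
have PNE j : (PN j)%:Z = P j by rewrite ffunE gez0_abs // ltW.
have wE nu : (weight PN nu)%:Z = \sum_j (nu j)%:Z * P j.
  by rewrite /weight (big_morph Posz PoszD (erefl 0)); apply: eq_bigr => j _; rewrite PoszM PNE mulrC.
have wdiff e (beta : box) : \sum_j ((beta j)%:Z - (bf e j)%:Z) * P j =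
    (weight PN (box_index beta))%:Z - (weight PN (box_index (bf e)))%:Z.
  by rewrite !wE -sumrB; apply: eq_bigr => j _; rewrite !ffunE mulrBl.
have wA e (beta : box) : cond e beta -> weight PN (box_index beta) = weight PN (box_index (bf e)).
  move=> c; have := PA (e, beta); rewrite /dA /= c wdiff => /eqP.
  by rewrite subr_eq0 => /eqP [].
have wB e (beta : box) : cond2 e beta -> (weight PN (box_index (bf e)) < weight PN (box_index beta))%N.
  by move=> c; have := PB (inl (e, beta)); rewrite /dB /= c wdiff subr_gt0 ltz_nat.
have abf e : a e (box_index (bf e)) != 0 by case: (LP e).
have wbox e (beta : box) : a e (box_index beta) != 0 ->
    (weight PN (box_index (bf e)) <= weight PN (box_index beta))%N.
  move=> ab; have [r0|r0] := eqVneq (rho e beta) 0.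
    by apply: ltnW; apply: wB; rewrite /cond2 ab r0 eqxx.
  by rewrite (@wA e beta) // /cond ab.
(* Such an exponent is heavier than the i-th axis monomial, whose weight is already at least that of
   the dominant monomial. *)
have wout e (nu : multi_index n) i : (K < nu i)%N -> (weight PN (box_index (bf e)) < weight PN nu)%N.
  have axE := @axis_boxE n K (fun i => k (e, i)) (kK e) i.
  move=> Knu; have := ak (e, i); rewrite /= -axE => /wbox wi.
  apply: leq_ltn_trans wi _; rewrite axE.
  rewrite /weight (bigD1 i) //= [X in (_ + X)%N]big1 ?addn0; last first.
    by move=> j ji; rewrite !ffunE (negbTE ji) muln0.
  rewrite [axis_index _ _ _]ffunE eqxx [in X in (_ < X)%N](bigD1 i) //=.
  apply: leq_trans (leq_addr _ _); rewrite ltn_pmul2l.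
    exact: leq_ltn_trans (kK e i) Knu.
  by rewrite -ltz_nat PNE.
(* The exponents of the face: those whose quotient by the dominant monomial has a nonzero limit. *)
pose D e := [seq box_index beta | beta <- enum box & cond e beta].
have uD e : uniq (D e).
  rewrite map_inj_uniq; last exact: box_index_inj.
  by rewrite filter_uniq // enum_uniq.
have Dw e nu : nu \in D e -> weight PN nu = weight PN (box_index (bf e)).
  by move=> /mapP[beta]; rewrite mem_filter => /andP[c _] ->; exact: wA.
have degE e : newton_deg PN (a e) = (weight PN (box_index (bf e)))%:R.
  apply: newton_degE => // nu anu; have [[beta nub]|[i Ki]] := box_indexP K nu.
    by rewrite nub; apply: wbox; rewrite -nub.
  by apply: ltnW; exact: wout Ki.
have wD e nu : a e nu != 0 -> weight PN nu = weight PN (box_index (bf e)) -> nu \in D e.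
  move=> anu wnu; have [[beta nub]|[i Ki]] := box_indexP K nu; last first.
    by have := wout e nu i Ki; rewrite wnu ltnn.
  apply/mapP; exists beta => //; rewrite mem_filter mem_enum andbT.
  rewrite /cond -nub anu /=; apply/negP => r0.
  by have := @wB e beta; rewrite /cond2 -nub anu r0 wnu ltnn => /(_ isT).
(* The sizes themselves diverge, but [y] reproduces the limits of the convergent functionals. With
   the limit phases it gives a torus point at which the monomials of the face have the limiting
   quotients. *)
pose b : 'rV[C]_n := \row_j ((expR (- y j))%:C%C * thl j).
have bt : torus b.
  move=> j; rewrite mxE mulf_neq0 ?rC0 ?expR_gt0 //.
  by rewrite -rnorm_eq0 thl1 oner_eq0.
pose tl : 'rV[C]_n := \row_j thl j.
have bE nu : monomial nu b = (expR (- \sum_j (nu j)%:R * y j))%:C%C * monomial nu tl.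
  by apply: monomial_polar => j; rewrite !mxE.
have mtl nu : (fun z => monomial nu (th z)) @ F --> monomial nu tl.
  by apply: ccvg_monomial => j; rewrite mxE; exact: thlP.
have mb0 nu : monomial nu b != 0.
  by rewrite /monomial; apply/prodf_neq0 => j _; apply: expf_neq0; exact: bt.
(* The size of the quotient converges to an exponential in [y] and its phase to a quotient of
   monomials in [thl]; uniqueness of limits identifies [rho]. *)
have rhoE e (beta : box) : cond e beta ->
    rho e beta = monomial (box_index beta) b / monomial (box_index (bf e)) b.
  move=> c; have ab : a e (box_index beta) != 0 by case/andP: c.
  have [_ _ h _] := LP e; have h1 := h beta ab.
  have h2 := @ccvgM _ _ F FF _ _ _ _ h1 (mtl (box_index (bf e))).
  have h3 : (fun z => expR (- \sum_j ((beta j)%:Z - (bf e j)%:Z)%:~R * x z j)) @ F -->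
      expR (- \sum_j ((beta j)%:Z - (bf e j)%:Z)%:~R * y j).
    have := hA (e, beta); rewrite (yA (e, beta)) /dA /= c => h4.
    exact: cvg_comp _ _ (@cvgN _ _ _ F FF _ _ h4) (@continuous_expR R _).
  have h5 := @ccvgM _ _ F FF _ _ _ _ (@cvg_real_complex _ F FF _ _ h3) (mtl (box_index beta)).
  have mtl0 : monomial (box_index (bf e)) tl != 0.
    by rewrite /monomial; apply/prodf_neq0 => j _; rewrite expf_neq0 // mxE -rnorm_eq0 thl1 oner_eq0.
  have h6 : rho e beta * monomial (box_index (bf e)) tl =
      (expR (- \sum_j ((beta j)%:Z - (bf e j)%:Z)%:~R * y j))%:C%C * monomial (box_index beta) tl.
    apply: (ccvg_unique h2); apply: rnorm_cvg => eps eps0.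
    have h5' := @cvg_rnorm _ _ F FF _ _ _ h5 _ eps0.
    apply: filterS2 h5' Fneq0 => z + z0; congr (rnorm (_ - _) < _).
    have t0 : monomial (box_index (bf e)) (th z) != 0.
      by rewrite -rnorm_eq0 mth1 // oner_eq0.
    have e1 := polar z beta z0; have e2 := polar z (bf e) z0.
    have q0 := rC0 _ (expR_gt0 (- \sum_j (box_index (bf e) j)%:R * x z j)).
    by rewrite -(expdiff (x z) e beta) -(div_mulK _ _ t0 q0) -e1 -e2.
  have e1 := bE (box_index beta); have e2 := bE (box_index (bf e)).
  have q0 := rC0 _ (expR_gt0 (- \sum_j (box_index (bf e) j)%:R * y j)).
  apply: (mulIf mtl0); rewrite h6 e1 e2 -(expdiff y e beta).
  by rewrite (div_mulK _ _ mtl0 q0).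
have sumE e (c : multi_index n -> C) :
    \sum_(beta | a e (box_index beta) != 0) c (box_index beta) * rho e beta =
    (monomial (box_index (bf e)) b)^-1 * \sum_(nu <- D e) c nu * monomial nu b.
  rewrite /D big_map big_filter big_enum_cond /= mulr_sumr.
  rewrite (bigID (fun beta => rho e beta != 0)) /= [X in _ + X]big1 ?addr0; last first.
    by move=> beta /andP[_ /negPn/eqP ->]; rewrite mulr0.
  apply: eq_big => [beta|beta c1]; first by rewrite /cond.
  by rewrite rhoE // mulrA mulrC.
exists PN, b, (fun e => mon (bf e)), (fun e => (monomial (box_index (bf e)) b)^-1),
  (fun e => weight PN (box_index (bf e))); split=> [j||e].
- by rewrite -ltz_nat PNE.
- exact: bt.
have [s [S [s0 aS bS hs _]]] := power_series_local (fa e).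
pose s1 := Num.min s 1.
have s10 : 0 < s1 by rewrite lt_min s0 ltr01.
have s11 : s1 <= 1 by rewrite ge_min lexx orbT.
have s1s : s1 <= s by rewrite ge_min lexx.
have [_ _ _ hlim] := LP e.
split.
- split; last by rewrite invr_neq0.
  by apply: filterS Fneq0 => z z0; rewrite /mon /monomial; apply/prodf_neq0 => j _;
     apply: expf_neq0; exact: shift_torus.
- rewrite (@face_functionE _ _ (a e) PN (D e) (uD e) _ (@Dw e) (degE e) (wD e)) -sumE.
  apply: (hlim (a e) _ s1 S) => //.
    by apply: abs_summableW aS => //; exact: ltW.
  move=> z zs; have [|h _ _ _] := hs z; first by rewrite subr0 (le_trans zs).
  by rewrite subr0 in h.
- move=> j; rewrite (@face_function_partial _ _ (a e) PN (D e) (uD e) _ (@Dw e) (degE e) (wD e)).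
  rewrite -(sumE e (fun nu => (nu j)%:R * a e nu)).
  apply: (hlim (fun nu => (nu j)%:R * a e nu) _ s1 S) => //.
  + by apply: abs_summableW (bS j) => //; exact: ltW.
  + move=> z zs; have [|_ h _ _] := hs z; first by rewrite subr0 (le_trans zs).
    by have := h j; rewrite subr0.
  + by move=> nu ->; rewrite mulr0.
- exact: degE.
- exact: (@face_function_euler _ _ (a e) PN (D e) (uD e) _ (@Dw e) (degE e) (wD e)).
Qed.
End NewtonLimits.

(** * Exclusion of proportional logarithmic gradients *)

Section NoProportionalGradients.
Variables (R : realType) (n : nat).
Local Notation C := (complexField R).

Lemma diff_partial (F : 'rV[C]_n -> C) (z v : 'rV[C]_n) :
  'd F z v = \sum_j v 0 j * partial F j z.
Proof.
rewrite {1}(row_sum_delta v) linear_sum; apply: eq_bigr => j _.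
by rewrite linearZ.
Qed.

Let cross_identity (K : fieldType) (A B u v s mu c : K) : u != 0 -> v != 0 ->
  A / u - mu * (B / v) = c ->
  (v / s) * A - mu * (u / s) * B = c * (u * v / s).
Proof.
move=> u0 v0 <-; have [->|s0] := eqVneq s 0; first by rewrite invr0 !(mulr0, mul0r) subr0.
by field; rewrite u0 v0 s0.
Qed.

Let div_cancel (K : fieldType) (A f M : K) : M != 0 -> f != 0 -> (A / M) / (f / M) = A / f.
Proof. by move=> M0 f0; field; rewrite M0 f0. Qed.

Let scaled_identity (K : fieldType) (p v m x mu u m' y : K) :
  p * (v * (m * x) - mu * u * (m' * y)) = v * (m * (p * x)) - mu * u * (m' * (p * y)).
Proof. by ring. Qed.

Let scaled_identity2 (K : fieldType) (x v m p mu u m' p' : K) :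
  x * (v * m * p - mu * u * m' * p') = v * (m * (x * p)) - mu * u * (m' * (x * p')).
Proof. by ring. Qed.

Let combine_zero (K : fieldType) (c p c' q t : K) :
  c * p = c' * q -> c * (t * p) + - c' * (t * q) = 0.
Proof. by move=> h; rewrite mulrCA h mulNr mulrCA subrr. Qed.

Let quotient_identity (K : fieldType) (p m x phi mu m' y gam : K) :
  m != 0 -> phi != 0 -> m' != 0 -> gam != 0 ->
  p * (m * x / (m * phi) - mu * (m' * y / (m' * gam))) = p * x / phi - mu * (p * y / gam).
Proof. by move=> m0 phi0 m'0 gam0; field; rewrite m0 phi0 m'0 gam0. Qed.

Let sum_quotient (K : fieldType) (p X Y : 'I_n -> K) (m phi mu m' gam : K) :
  m != 0 -> phi != 0 -> m' != 0 -> gam != 0 ->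
  \sum_j p j * (m * X j / (m * phi) - mu * (m' * Y j / (m' * gam))) =
  (\sum_j p j * X j) / phi - mu * ((\sum_j p j * Y j) / gam).
Proof.
move=> m0 phi0 m'0 gam0; rewrite !mulr_suml mulr_sumr -sumrB.
by apply: eq_bigr => j _; exact: quotient_identity.
Qed.

Lemma ccvgV (T : Type) (F : set_system T) {FF : Filter F} (u : T -> C) (l : C) :
  l != 0 -> u @ F --> l -> (fun t => (u t)^-1) @ F --> l^-1.
Proof. exact: (@cvgV C T F FF u l). Qed.

(** [c] may be unbounded, but its phase is not, and a factor [r >= 0] does not change the phase. All
    the limits therefore lie on the ray of the limit phase. Where [c t = 0], the phase is set to
    1. *)
Lemma same_ray (T : Type) (F : set_system T) (FU : UltraFilter F) (J : Type)
    (c : T -> C) (r : J -> T -> R) (w : J -> C) :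
  (forall j t, 0 <= r j t) ->
  (forall j, (fun t => c t * (r j t)%:C%C) @ F --> w j) ->
  exists2 om : C, rnorm om = 1 & forall j, w j = om * (rnorm (w j))%:C%C.
Proof.
move=> r0 hw; have FP : ProperFilter F by exact: ultra_proper.
have FF : Filter F by exact _.
pose om t : C := if c t == 0 then 1 else c t / (rnorm (c t))%:C%C.
have om1 t : rnorm (om t) = 1.
  rewrite /om; case: eqVneq => [_|c0]; first by rewrite rnorm1.
  by rewrite rnormM rnormV rnorm_real ger0_norm ?rnorm_ge0 // mulfV // rnorm_eq0.
have cE j t : c t * (r j t)%:C%C = om t * (rnorm (c t * (r j t)%:C%C))%:C%C.
  rewrite rnormM rnorm_real (ger0_norm (r0 j t)) rmorphM mulrA; congr (_ * _).
  rewrite /om; case: eqVneq => [->|c0]; first by rewrite rnorm0 mulr0.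
  by rewrite divfK // -rnorm_eq0 rnorm_real normr_eq0 rnorm_eq0.
have [|omega homega] := @ultra_bounded_ccvg _ F FU R om 1.
  by apply: filterE => t; rewrite om1.
exists omega.
  have h1 := @cvg_rnorm_norm _ _ F FF _ _ homega.
  have h2 : (fun t => rnorm (om t)) @ F --> (1 : R).
    by apply: cvg_near_cst; apply: filterE => t; rewrite om1.
  by apply: (cvg_unique _ h1 h2).
move=> j; have h1 := @cvg_real_complex _ _ F FF _ _ (@cvg_rnorm_norm _ _ F FF _ _ (hw j)).
have h2 := @ccvgM _ _ F FF _ _ _ _ homega h1.
have e1 : (fun t => om t * (rnorm (c t * (r j t)%:C%C))%:C%C) =
    (fun t => c t * (r j t)%:C%C) by apply/funext => t; rewrite -cE.
rewrite e1 in h2; exact: (@ccvg_unique _ F FP R _ _ _ (hw j) h2).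
Qed.

(** The alternative [mu = 1 \/ lam = 0] serves the critical points of phi and those of [H] by one
    argument. *)
Theorem newton_no_proportional_gradients (f g : 'rV[C]_n -> C)
    (a b : multi_index n -> C) :
  f 0 = 0 -> has_power_series f 0 a -> has_power_series g 0 b ->
  convenient a -> convenient b -> non_degenerate a -> non_degenerate b ->
  non_degenerate_complete_intersection a b -> newton_multiplicity_condition a b ->
  exists2 eps : R, 0 < eps & forall z, rnorm z < eps -> f z != 0 -> g z != 0 ->
  forall (mu : C) (lam : R), rnorm mu = 1 -> mu = 1 \/ lam = 0 ->
  ~ (forall j, z 0 j * partial f j z / f z - mu * (z 0 j * partial g j z / g z) =
       (0 +i* lam)%C * (rnorm (z 0 j) ^+ 2)%:C%C).
Proof.
move=> f0 fa gb ca cb na nb ci mult; apply: contrapT => hn.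
pose rel z (p : C * R) := [/\ f z != 0, g z != 0, rnorm p.1 = 1, p.1 = 1 \/ p.2 = 0 &
   forall j, z 0 j * partial f j z / f z - p.1 * (z 0 j * partial g j z / g z) =
       (0 +i* p.2)%C * (rnorm (z 0 j) ^+ 2)%:C%C].
pose bad z := exists p, rel z p.
have hbad (e : R) : 0 < e -> exists2 z, rnorm z < e & bad z.
  move=> e0; apply: contrapT => h; apply: hn; exists e => // z ze fz gz mu lam mu1 ml hj.
  by apply: h; exists z => //; exists (mu, lam).
pose G : set_system 'rV[C]_n := filter_from [set e : R | 0 < e]
  (fun e => [set z | rnorm z < e /\ bad z]).
have GP : ProperFilter G.
  apply: filter_from_proper; last first.
    by move=> e /= e0; have [z ze bz] := hbad e e0; exists z.
  apply: filter_from_filter; first by exists 1 => /=.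
  move=> e1 e2 /= e10 e20; exists (Num.min e1 e2); first by rewrite /= lt_min e10.
  by move=> z /= [+ bz]; rewrite lt_min => /andP[? ?].
have [F [FU GF]] := ultraFilterLemma GP.
have FP : ProperFilter F by exact: ultra_proper.
have FF : Filter F by exact _.
have Fsmall (e : R) : 0 < e -> \forall z \near F, rnorm z < e.
  by move=> e0; apply: GF; exists e => // z [].
have Fbad : \forall z \near F, bad z by apply: GF; exists 1 => //= z [].
have Fneq0 : \forall z \near F, z != 0.
  by apply: filterS Fbad => z [p [fz _ _ _ _]]; apply: contra_neq fz => ->.
pose ff (e : bool) := if e then f else g.
pose aa (e : bool) := if e then a else b.
have [P [x [M [m [d [P0 xt H]]]]]] := @newton_limits R n F ff aa FU Fsmall Fneq0
  (fun e => if e is true then fa else gb) (fun e => if e is true then ca else cb).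
move: (H true) (H false); rewrite /ff /aa {H}.
move: (M true) (m true) (d true) (M false) (m false) (d false) => {M m d ff aa}.
move=> Mf mf df Mg mg dg [[Mf0 mf0] uphi hA dfE euf] [[Mg0 mg0] vgam hB dgE eug].
have [ml mlP] : {ml : 'rV[C]_n -> C * R & forall z, bad z -> rel z (ml z)}.
  apply: (@choice 'rV[C]_n (C * R) (fun z p => bad z -> rel z p)) => z.
  by have [[p hp]|nbad] := pselect (bad z); [exists p|exists (0, 0)].
pose fP := face_function P a; pose gP := face_function P b.
pose al j := mf * (x 0 j * partial fP j x); pose be j := mg * (x 0 j * partial gP j x).
(* [u] and [v] converge, but possibly to 0; the pair [(u, v) / s] keeps their direction. Where [s]
   vanishes, the quotients take the value 0 and are still bounded. *)
pose u z : C := f z / Mf z; pose v z : C := g z / Mg z.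
pose s z : C := (rnorm (u z) + rnorm (v z))%:C%C.
have uv0 z : 0 <= rnorm (u z) + rnorm (v z) by rewrite addr_ge0 ?rnorm_ge0.
have [u0 hu0] : exists l : C, (fun z => u z / s z) @ F --> l.
  apply: (@ultra_bounded_ccvg _ F FU R (fun z => u z / s z) 1); apply: filterE => z.
  rewrite rnormM rnormV rnorm_real (ger0_norm (uv0 z)).
  have [->|/eqP s0] := eqVneq (rnorm (u z) + rnorm (v z)) 0; first by rewrite invr0 mulr0.
  by rewrite ler_pdivrMr ?mul1r ?lerDl ?rnorm_ge0 // lt_neqAle eq_sym uv0 andbT; apply/eqP.
have [v0 hv0] : exists l : C, (fun z => v z / s z) @ F --> l.
  apply: (@ultra_bounded_ccvg _ F FU R (fun z => v z / s z) 1); apply: filterE => z.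
  rewrite rnormM rnormV rnorm_real (ger0_norm (uv0 z)).
  have [->|/eqP s0] := eqVneq (rnorm (u z) + rnorm (v z)) 0; first by rewrite invr0 mulr0.
  by rewrite ler_pdivrMr ?mul1r ?lerDr ?rnorm_ge0 // lt_neqAle eq_sym uv0 andbT; apply/eqP.
have [mu0 hmu0] : exists l : C, (fun z => (ml z).1) @ F --> l.
  apply: (@ultra_bounded_ccvg _ F FU R (fun z => (ml z).1) 1).
  by apply: filterS Fbad => z /mlP[_ _ -> _ _].
have mu01 : rnorm mu0 = 1.
  have h1 := @cvg_rnorm_norm _ _ F FF _ _ hmu0.
  have h2 : (fun z => rnorm (ml z).1) @ F --> (1 : R).
    by apply: cvg_near_cst; apply: filterS Fbad => z /mlP[_ _ -> _ _].
  by apply: (cvg_unique _ h1 h2).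
have nearE : \forall z \near F, [/\ Mf z != 0, Mg z != 0 & rel z (ml z)].
  by apply: filterS3 Mf0 Mg0 Fbad => z ? ? /mlP ?; split.
have unorm : rnorm u0 + rnorm v0 = 1.
  have h1 := @cvg_rnorm_norm _ _ F FF _ _ hu0; have h2 := @cvg_rnorm_norm _ _ F FF _ _ hv0.
  have h3 := @cvgD R R _ F FF _ _ _ _ h1 h2.
  have h4 : (fun z => rnorm (u z / s z)) + (fun z => rnorm (v z / s z)) @ F --> (1 : R).
    apply: cvg_near_cst; apply: filterS nearE => z [Mfz Mgz [fz gz _ _ _]].
    rewrite fctE (rnormM (u z)) (rnormM (v z)) (rnormV (s z)) rnorm_real (ger0_norm (uv0 z)) -mulrDl mulfV //.
    apply: lt0r_neq0; apply: ltr_wpDr; first exact: rnorm_ge0.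
    by rewrite rnorm_gt0 mulf_neq0 // invr_neq0.
  by apply: (cvg_unique _ h3 h4).
(* The limit of [(u / s) * v = (v / s) * u]: if only one of the two face functions vanishes at [x],
   it shows which of [u0] and [v0] is 0. *)
have uvphi : u0 * (mg * gP x) = v0 * (mf * fP x).
  have h1 := @ccvgM _ _ F FF _ _ _ _ hu0 vgam; have h2 := @ccvgM _ _ F FF _ _ _ _ hv0 uphi.
  have e1 : (fun z => u z / s z * (g z / Mg z)) = (fun z => v z / s z * (f z / Mf z)).
    by apply/funext => z; rewrite -/(v z) -/(u z) mulrAC [RHS]mulrAC [u z * v z]mulrC.
  rewrite e1 in h1; exact: (@ccvg_unique _ F FP R _ _ _ h1 h2).
(* The limit of the relation multiplied by [u * v / s], a product that stays bounded however small
   [f] or [g] is against its dominant monomial. *)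
pose w j := v0 * al j - mu0 * u0 * be j.
have hw j : (fun z => ((0 +i* (ml z).2)%C * (u z * v z / s z) : C) * (rnorm (z 0 j) ^+ 2)%:C%C)
    @ F --> w j.
  have h1 := @ccvgM _ _ F FF _ _ _ _ hv0 (hA j).
  have h2 := @ccvgM _ _ F FF _ _ _ _ (@ccvgM _ _ F FF _ _ _ _ hmu0 hu0) (hB j).
  have h3 := @ccvgB _ _ F FF _ _ _ _ h1 h2.
  apply: rnorm_cvg => e e0; have h4 := @cvg_rnorm _ _ F FF _ _ _ h3 e e0.
  apply: filterS2 h4 nearE => z + [Mfz Mgz [fz gz _ _ /(_ j) hz]].
  congr (rnorm (_ - _) < _).
  rewrite [RHS]mulrAC; apply: cross_identity.
  - by rewrite mulf_neq0 // invr_neq0.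
  - by rewrite mulf_neq0 // invr_neq0.
  - by rewrite /u /v (div_cancel _ Mfz fz) (div_cancel _ Mgz gz).
have [om om1 wray] := same_ray FU (fun j z => sqr_ge0 (rnorm (z 0 j))) hw.
have sumw : \sum_j (P j)%:R * w j = v0 * (mf * (df%:R * fP x)) - mu0 * u0 * (mg * (dg%:R * gP x)).
  rewrite -euf -eug !mulr_sumr -sumrB; apply: eq_bigr => j _.
  by rewrite /w /al /be; exact: scaled_identity.
(* The weighted sum is the unit number [om] times a sum of nonnegative reals with positive
   weights. *)
have w0 : \sum_j (P j)%:R * w j = 0 -> forall j, w j = 0.
  move=> h; have om0 : om != 0 by rewrite -rnorm_eq0 om1 oner_eq0.
  have : \sum_j (P j)%:R * rnorm (w j) = 0 :> R.
    apply: complexI; rewrite rmorph_sum /=; apply: (mulfI om0); rewrite mulr0 -[RHS]h mulr_sumr.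
    apply: eq_bigr => j _; rewrite [w j in RHS]wray rmorphM rmorph_nat mulrCA //.
  move=> /psumr_eq0P h0 j; apply/eqP; rewrite -rnorm_eq0.
  have /eqP := h0 (fun i _ => mulr_ge0 (ler0n _ _) (rnorm_ge0 (w i))) j isT.
  by rewrite mulf_eq0 pnatr_eq0 gtn_eqF.
have part0 (h : 'rV[C]_n -> C) : (forall j, x 0 j * partial h j x = 0) -> forall y, 'd h x y = 0.
  move=> h0 y; rewrite diff_partial big1 // => j _; have /eqP := h0 j.
  by rewrite mulf_eq0 (negbTE (xt j)) => /eqP ->; rewrite mulr0.
(* In the three cases where a face function vanishes, [sumw] is 0: either both its terms contain a
   vanishing face function, or [uvphi] cancels the other term. Hence every [w j] is 0. *)
have [phi0|phi0] := eqVneq (fP x) 0; have [gam0|gam0] := eqVneq (gP x) 0.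
- have wz : forall j, w j = 0.
    by apply: w0; rewrite sumw phi0 gam0 !mulr0 subrr.
  have [|v00 u00] := ci P P0 x xt phi0 gam0 (v0 * mf) (- (mu0 * u0 * mg)).
    move=> y.
    have e1 := diff_partial fP x y.
    have e2 := diff_partial gP x y.
    refine (etrans (f_equal2 (fun p q : C => v0 * mf * p + - (mu0 * u0 * mg) * q) e1 e2) _).
    rewrite [_ * \sum_j _]mulr_sumr [X in _ + X]mulr_sumr -big_split /=.
    apply: big1 => j _.
    apply: combine_zero.
    apply: (mulfI (xt j)).
    apply/eqP; rewrite -subr_eq0 -mulrBr; apply/eqP; rewrite -[RHS](wz j).
    by rewrite /w /al /be; exact: scaled_identity2.
  move/eqP: v00; rewrite mulf_eq0 (negbTE mf0) orbF => /eqP v00.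
  move/eqP: u00; rewrite oppr_eq0 !mulf_eq0 (negbTE mg0) orbF -[mu0 == 0]rnorm_eq0 mu01 oner_eq0 /=.
  move=> /eqP u00; move: unorm; rewrite u00 v00 rnorm0 addr0 => /esym/eqP.
  by rewrite oner_eq0.
- have u00 : u0 = 0.
    by apply/eqP; move/eqP: uvphi; rewrite phi0 !mulr0 !mulf_eq0 (negbTE mg0) (negbTE gam0) !orbF.
  have v00 : v0 != 0.
    by apply/eqP => v00; move/eqP: unorm; rewrite u00 v00 rnorm0 addr0 eq_sym oner_eq0.
  have wz : forall j, w j = 0.
    by apply: w0; rewrite sumw phi0 u00 !(mulr0, mul0r) subrr.
  apply: (na P P0 x xt phi0); apply: part0 => j; apply/eqP.
  have /eqP := wz j; rewrite /w /al u00 mulr0 mul0r subr0 mulf_eq0 (negbTE v00) /=.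
  by rewrite mulf_eq0 (negbTE mf0).
- have v00 : v0 = 0.
    by apply/eqP; move/eqP: uvphi; rewrite gam0 !mulr0 eq_sym !mulf_eq0 (negbTE mf0) (negbTE phi0) !orbF.
  have u00 : u0 != 0.
    by apply/eqP => u00; move/eqP: unorm; rewrite u00 v00 rnorm0 addr0 eq_sym oner_eq0.
  have wz : forall j, w j = 0.
    by apply: w0; rewrite sumw gam0 v00 !(mulr0, mul0r) subrr.
  apply: (nb P P0 x xt gam0); apply: part0 => j; apply/eqP.
  have /eqP := wz j; rewrite /w /be v00 mul0r sub0r oppr_eq0 !mulf_eq0 (negbTE u00) (negbTE mg0).
  by rewrite -[mu0 == 0]rnorm_eq0 mu01 oner_eq0.
(* Neither face function vanishes at [x], so the relation converges without a further
   normalisation. *)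
pose q j := mf * (x 0 j * partial fP j x) / (mf * fP x) -
  mu0 * (mg * (x 0 j * partial gP j x) / (mg * gP x)).
have hq j : (fun z : 'rV[C]_n => z 0 j * partial f j z / f z - (ml z).1 * (z 0 j * partial g j z / g z))
    @ F --> q j.
  have n1 : mf * fP x != 0 by rewrite mulf_neq0.
  have n2 : mg * gP x != 0 by rewrite mulf_neq0.
  have h1 := @ccvgM _ _ F FF _ _ _ _ (hA j) (@ccvgV _ F FF _ _ n1 uphi).
  have h2 := @ccvgM _ _ F FF _ _ _ _ (hB j) (@ccvgV _ F FF _ _ n2 vgam).
  have h3 := @ccvgB _ _ F FF _ _ _ _ h1 (@ccvgM _ _ F FF _ _ _ _ hmu0 h2).
  apply: rnorm_cvg => e e0; have h4 := @cvg_rnorm _ _ F FF _ _ _ h3 e e0.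
  apply: filterS2 h4 nearE => z + [Mfz Mgz [fz gz _ _ _]]; congr (rnorm (_ - _) < _).
  by rewrite (div_cancel _ Mfz fz) (div_cancel _ Mgz gz).
have sumq : \sum_j (P j)%:R * q j = df%:R - mu0 * dg%:R.
  refine (etrans (sum_quotient (fun j => (P j)%:R) (fun j => x 0 j * partial fP j x)
    (fun j => x 0 j * partial gP j x) mu0 mf0 phi0 mg0 gam0) _).
  refine (etrans (f_equal2 (fun p r : C => p / fP x - mu0 * (r / gP x)) euf eug) _).
  exact: (f_equal2 (fun p r : C => p - mu0 * r) (mulfK phi0 _) (mulfK gam0 _)).
have hne : (df%:R : R) <> dg%:R by rewrite -dfE -dgE; exact: mult.
(* Either [mu = 1] along the ultrafilter, the right-hand sides are purely imaginary, and the real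
   part of [sumq] equates the two degrees; or [lam = 0], so [q] vanishes, and comparing moduli in
   [sumq] equates them. *)
have [h1|h1] := in_ultra_setVsetC [set z | (ml z).1 = 1] FU.
- have mu1 : mu0 = 1.
    have h2 : (fun z => (ml z).1) @ F --> (1 : C) by exact: (@cvg_near_cst _ C 1 _ F FF h1).
    exact: (@ccvg_unique _ F FP R _ _ _ hmu0 h2).
  have Req j : complex.Re (q j) = 0.
    apply/eqP; rewrite -normr_eq0 eq_le normr_ge0 andbT; apply/ler_addgt0Pr => e e0.
    have [z [hz [_ _ [_ _ _ _ /(_ j) hz2]]]] :=
      filter_ex (filterI (@cvg_rnorm _ _ F FF _ _ _ (hq j) e e0) nearE).
    rewrite add0r; apply: ltW; move: hz; rewrite hz2 rnormB; apply: le_lt_trans.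
    apply: le_trans (Re_le_rnorm _); rewrite le_eqVlt; apply/orP; left; apply/eqP.
    congr (`|_|); case: (q j) => q1 q2.
    by rewrite /= !(mul0r, mulr0, subr0, sub0r, oppr0, addr0).
  apply: hne; apply/eqP; rewrite -subr_eq0; apply/eqP.
  have := congr1 (@complex.Re R) sumq; rewrite mu1 mul1r.
  have ReD : {morph (@complex.Re R : C -> R) : p r / p + r} by case=> [? ?] [? ?].
  rewrite (big_morph _ ReD erefl) big1 => [|j _].
    by rewrite -[df%:R]/(df%:R : C) -!(rmorph_nat (real_complex R)) -rmorphB /= => <-.
  by move: (Req j); case: (q j) => q1 q2 /= ->; rewrite -(rmorph_nat (real_complex R)) /= mulr0 mul0r subr0.
- have q0 j : q j = 0.
    apply: (@ccvg_unique _ F FP R _ _ _ (hq j)); apply: cvg_near_cst.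
    apply: filterS2 h1 nearE => z hz [_ _ [_ _ _ [//|l0] ->]].
    by rewrite l0 (_ : (0 +i* 0)%C = 0) ?mul0r.
  move: sumq; rewrite big1 => [|j _]; last by rewrite q0 mulr0.
  move=> /esym/eqP; rewrite subr_eq0 => /eqP /(congr1 (@rnorm R C)).
  by rewrite rnormM mu01 mul1r !rnorm_nat.
Qed.
End NoProportionalGradients.

(** * Ordinary differential equations *)

Section ScalarODE.
Variable R : realType.
Implicit Types (c u : R -> R).

Lemma is_derive_continuous c (dc t : R) : is_derive t 1 c dc -> {for t, continuous c}.
Proof.
by move=> h; apply: differentiable_continuous; apply/derivable1_diffP; exact: ex_derive.
Qed.

Lemma derive_mvt c (dc : R -> R) (a b : R) : a <= b ->
  (forall t : R, a <= t <= b -> is_derive t 1 c (dc t)) ->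
  exists2 s, a <= s <= b & c b - c a = dc s * (b - a).
Proof.
move=> ab hc.
have [s||s sab e] := @MVT_segment R c dc a b ab.
- by rewrite in_itv /= => /andP[h1 h2]; apply: hc; rewrite !ltW.
- apply: derivable_within_continuous => s; rewrite in_itv /= => h.
  by apply: ex_derive; exact: hc.
by exists s => //; move: sab; rewrite in_itv.
Qed.

Lemma derive_ndecr c (dc : R -> R) (a b : R) : a <= b ->
  (forall t : R, a <= t <= b -> is_derive t 1 c (dc t)) ->
  (forall t : R, a <= t <= b -> 0 <= dc t) -> c a <= c b.
Proof.
move=> ab hc d0; have [s sab e] := derive_mvt ab hc.
by rewrite -subr_ge0 e mulr_ge0 ?d0 // subr_ge0.
Qed.

Lemma derive0_cst c (N t : R) : (forall t : R, `|t| < N -> is_derive t 1 c 0) ->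
  `|t| < N -> c t = c 0.
Proof.
move=> hc tN; have [t0|t0] := leP 0 t.
  have [s s0|s _ e] := @derive_mvt c (fun=> 0) 0 t t0.
    apply: hc; move: s0 tN => /andP[s0 st]; rewrite !ger0_norm //; exact: le_lt_trans.
  by apply/eqP; rewrite -subr_eq0 e mul0r.
have [s|s _ e] := @derive_mvt c (fun=> 0) t 0 (ltW t0).
  move=> /andP[ts s0]; apply: hc; move: tN; rewrite (ltr0_norm t0) ler0_norm //.
  by apply: le_lt_trans; rewrite lerN2.
by apply/eqP; rewrite eq_sym -subr_eq0 e mul0r.
Qed.

Lemma is_derive_near c u (t d : R) : (\forall s \near t, c s = u s) ->
  is_derive t 1 u d -> is_derive t 1 c d.
Proof.
by move=> h hu; apply: near_eq_is_derive hu; apply: filterS h => s ->.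
Qed.

Lemma local_primitive c (N : R) : 0 < N -> continuous c ->
  exists C : R -> R, C 0 = 0 /\ forall t : R, `|t| < N -> is_derive t 1 C (c t).
Proof.
move=> N0 cc.
have [F hF] : exists F : R -> R, forall t : R, `|t| < N -> derivable F t 1 /\ derive1 F t = c t.
  exists (fun x => (\int[lebesgue_measure]_(t in `[- N, x]) c t)%R) => t tN.
  have [tN1 tN2] : - N < t /\ t < N by move: tN; rewrite ltr_norml => /andP[].
  apply: (@continuous_FTC1_closed R c (- N) t N tN2 _ tN1 (cc t)).
  apply: continuous_compact_integrable; first exact: segment_compact.
  exact: continuous_subspaceT.
exists (fun t => F t - F 0); split=> [|t tN]; first by rewrite subrr.
have [d1 d2] := hF t tN; rewrite derive1E in d2.
have h : is_derive t 1 F (c t) := DeriveDef d1 d2.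
by have := is_deriveB h (is_derive_cst (F 0) t 1); rewrite subr0.
Qed.

(** Primitives normalised at 0 on growing intervals agree where both are defined, because their
    difference is constant; the value at [t] is taken on the interval given by the integer part of
    [|t|]. *)
Lemma primitive c : continuous c ->
  exists C : R -> R, C 0 = 0 /\ forall t : R, is_derive t 1 C (c t).
Proof.
move=> cc; have h (k : nat) := local_primitive (ltr0Sn R k) cc.
have [C hC] := choice h.
have agree k l t : `|t| < k.+1%:R -> `|t| < l.+1%:R -> C k t = C l t.
  move=> tk tl; apply/eqP; rewrite -subr_eq0; apply/eqP.
  pose D t := C k t - C l t; rewrite -/(D t).
  have -> : D t = D 0.
    apply: (@derive0_cst D (Num.min k.+1%:R l.+1%:R)); last by rewrite lt_min tk.
    move=> s; rewrite lt_min => /andP[sk sl].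
    by have := is_deriveB ((hC k).2 s sk) ((hC l).2 s sl); rewrite subrr.
  by rewrite /D (hC k).1 (hC l).1 subrr.
pose K (t : R) := Num.truncn `|t|.
have KP t : `|t| < (K t).+1%:R by have /andP[] := truncn_itv (normr_ge0 t).
exists (fun t => C (K t) t); split; first by rewrite (hC _).1.
(* One interval further than [t] requires, so that it also contains the points near [t]. *)
move=> t; pose k := (K t).+1.
apply: (@is_derive_near _ (C k)); last first.
  by apply: (hC k).2; apply: lt_trans (KP t) _; rewrite ltr_nat.
near=> s; apply: agree; first exact: KP.
have st : `|s - t| < 1.
  rewrite distrC; near: s; apply/nbhs_ballP; exists 1 => //= s.
apply: (@le_lt_trans _ _ (`|s - t| + `|t|)).
  by rewrite -{1}(subrK t s) ler_normD.
by rewrite /k -(natr1 (K t).+1) addrC ltrD // KP.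
Unshelve. all: by end_near. Qed.

(** Integration gains the factor 1 / k against the weight [expR (k * |t|)]. With k equal to twice
    the Lipschitz constant, a Picard step halves the weighted distance on the whole line. *)
Lemma primitive_bound c (dc : R -> R) (K k : R) : 0 < k -> 0 <= K -> c 0 = 0 ->
  (forall t : R, is_derive t 1 c (dc t)) ->
  (forall t : R, `|dc t| <= K * expR (k * `|t|)) ->
  forall t : R, `|c t| <= K / k * expR (k * `|t|).
Proof.
move=> k0 K0.
have pos c' dc' : c' 0 = 0 -> (forall t : R, is_derive t 1 c' (dc' t)) ->
    (forall t : R, `|dc' t| <= K * expR (k * `|t|)) ->
    forall t : R, 0 <= t -> `|c' t| <= K / k * expR (k * `|t|).
  move=> c'0 hc hd t t0.
  pose E s := K / k * expR (k * s).
  have dE (s : R) : is_derive s 1 E (K * expR (k * s)).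
    by apply: is_derive_eq; rewrite /GRing.scale /=; field; rewrite gt_eqF.
  have E0 : 0 <= E 0 by rewrite /E mulr_ge0 ?expR_ge0 // divr_ge0 // ltW.
  have hle s : 0 <= s <= t -> `|dc' s| <= K * expR (k * s).
    by move=> /andP[s0 _]; have := hd s; rewrite (ger0_norm s0).
  have h1 : c' 0 - E 0 >= c' t - E t.
    have := @derive_ndecr (fun s => E s - c' s) (fun s => K * expR (k * s) - dc' s) 0 t t0
      (fun s _ => is_deriveB (dE s) (hc s)).
    move=> /(_ _); rewrite c'0 => h; have : E 0 - 0 <= E t - c' t.
      by apply: h => s /hle; rewrite ler_norml subr_ge0 => /andP[].
    lra.
  have h2 : c' 0 + E 0 <= c' t + E t.
    apply: (@derive_ndecr (fun s => c' s + E s) (fun s => dc' s + K * expR (k * s)) 0 t t0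
      (fun s _ => is_deriveD (hc s) (dE s))).
    by move=> s /hle; rewrite ler_norml => /andP[]; lra.
  rewrite (ger0_norm t0); move: h1 h2; rewrite -/(E t) c'0 ler_norml => h1 h2.
  by apply/andP; split; lra.
move=> c0 hc hd t; have [t0|t0] := leP 0 t; first exact: pos hd t t0.
have := @pos (fun s => c (- s)) (fun s => - dc (- s)) _ _ _ (- t) _.
rewrite opprK normrN; apply.
- by rewrite oppr0.
- move=> s; have h1 := hc (- s).
  have := @is_derive1_comp _ c -%R s (dc (- s)) (-1) h1 (is_deriveNid s 1).
  by rewrite mulrN1.
- by move=> s; rewrite normrN -[X in k * X]normrN; exact: hd.
- by rewrite lerNr oppr0 ltW.
Qed.

(** [c s * expR (- k * s)] does not increase for positive times; negative times follow by
    reflection. *)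
Lemma gronwall c (dc : R -> R) (k : R) : 0 <= k -> (forall t : R, 0 <= c t) ->
  (forall t : R, is_derive t 1 c (dc t)) -> (forall t : R, `|dc t| <= k * c t) ->
  forall t : R, c t <= c 0 * expR (k * `|t|).
Proof.
move=> k0.
have pos c' dc' : (forall t : R, 0 <= c' t) -> (forall t : R, is_derive t 1 c' (dc' t)) ->
    (forall t : R, `|dc' t| <= k * c' t) -> forall t : R, 0 <= t -> c' t <= c' 0 * expR (k * `|t|).
  move=> c'0 hc hd t t0; rewrite (ger0_norm t0).
  pose E s := c' s * expR (- k * s).
  have dE (s : R) : is_derive s 1 E ((dc' s - k * c' s) * expR (- k * s)).
    by have h := hc s; apply: is_derive_eq; rewrite /GRing.scale /=; ring.
  have : - E 0 <= - E t.
    apply: (@derive_ndecr (fun s => - E s) _ 0 t t0 (fun s _ => is_deriveN (dE s))).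
    move=> s _; rewrite oppr_ge0 mulr_le0_ge0 ?expR_ge0 // subr_le0.
    by apply: le_trans (hd s); exact: ler_norm.
  rewrite lerN2 /E mulr0 expR0 mulr1 mulNr expRN.
  by rewrite ler_pdivrMr ?expR_gt0.
move=> c0 hc hd t; have [t0|t0] := leP 0 t; first exact: pos hd t t0.
have := @pos (fun s => c (- s)) (fun s => - dc (- s)) _ _ _ (- t) _.
rewrite opprK oppr0 normrN; apply => //.
- move=> s; have h1 := hc (- s).
  have := @is_derive1_comp _ c -%R s (dc (- s)) (-1) h1 (is_deriveNid s 1).
  by rewrite mulrN1.
- by move=> s; rewrite normrN.
- by rewrite lerNr oppr0 ltW.
Qed.

(** With the tail bound [e k], the sequence [a - e] increases and [a + e] decreases; the supremum of
    the former lies between them, which gives the explicit rate. *)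
Lemma geometric_limit (a : nat -> R) (B : R) :
  (forall k, `|a k.+1 - a k| <= B * 2^-1 ^+ k) ->
  exists l, forall k, `|l - a k| <= 2 * B * 2^-1 ^+ k.
Proof.
move=> h; pose e k : R := 2 * B * 2^-1 ^+ k.
have eS k : e k = B * 2^-1 ^+ k + e k.+1 by rewrite /e exprS; field.
have B0 : 0 <= B by have := h 0%N; rewrite expr0 mulr1; apply: le_trans.
have lo : {homo (fun k => a k - e k) : k l / (k <= l)%N >-> k <= l}.
  apply: homo_leq => [//|? ? ?|k]; first exact: le_trans.
  by have := h k; rewrite ler_norml (eS k); lra.
have hi : {homo (fun k => a k + e k) : k l / (k <= l)%N >-> l <= k}.
  apply: homo_leq => [//|? ? ? h1 h2|k]; first exact: le_trans h2 h1.
  by have := h k; rewrite ler_norml (eS k); lra.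
have e0 k : 0 <= e k by rewrite /e !mulr_ge0 // exprn_ge0 // invr_ge0.
have lohi k l : a k - e k <= a l + e l.
  have [kl|lk] := leP k l.
    by apply: le_trans (lo _ _ kl) _; have := e0 l; lra.
  by apply: le_trans (hi _ _ (ltnW lk)); have := e0 k; lra.
pose E := [set a k - e k | k in [set: nat]].
have Eub l : ubound E (a l + e l) by move=> _ [k _ <-].
exists (sup E) => k; rewrite -/(e k) ler_norml; apply/andP; split.
  rewrite lerBrDr addrC; apply: ub_le_sup; first by exists (a 0%N + e 0%N).
  by exists k.
rewrite lerBlDr addrC; apply: ge_sup => //; by exists (a 0%N - e 0%N), 0%N.
Qed.

End ScalarODE.

(** * Picard iteration on the whole line *)

Section Picard.
Variables (R : realType) (m : nat).
Implicit Types (x y : 'rV[R]_m) (u v : R -> 'rV[R]_m).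

Lemma row_coord_le x j : `|x 0 j| <= `|x|.
Proof.
by rewrite [leRHS]/Num.norm /= mx_normrE; apply: le_bigmax (0, j).
Qed.

Lemma row_coordB_le x y j : `|x 0 j - y 0 j| <= `|x - y|.
Proof. by have := row_coord_le (x - y) j; rewrite !mxE. Qed.

Lemma row_norm_le x (e : R) : 0 <= e -> (forall j, `|x 0 j| <= e) -> `|x| <= e.
Proof.
move=> e0 h; rewrite [leLHS]/Num.norm /= mx_normrE; apply/bigmax_leP; split => //=.
by move=> [i j] _ /=; rewrite ord1.
Qed.

Definition coord_continuous_path u := forall j, continuous (fun t => u t 0 j).

Lemma coord_path_near u t (e : R) : coord_continuous_path u -> 0 < e ->
  \forall s \near t, `|u t - u s| <= e.
Proof.
move=> cu e0.
have h : \forall s \near t, forall j, `|u t 0 j - u s 0 j| < e.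
  have hj j : \forall s \near t, `|u t 0 j - u s 0 j| < e.
    by have /cvgrPdist_lt := cu j t; exact.
  exact: filter_forall hj.
apply: filterS h => s hs; apply: row_norm_le => [|j]; first exact: ltW.
by rewrite !mxE; exact: ltW.
Qed.

Definition solves (X : 'rV[R]_m -> 'rV[R]_m) u :=
  forall (t : R) (j : 'I_m), is_derive t 1 (fun t => u t 0 j) (X (u t) 0 j).

Section Existence.
Variables (X : 'rV[R]_m -> 'rV[R]_m) (L : R).
Hypotheses (L1 : 1 <= L) (XL : forall x y, `|X x - X y| <= L * `|x - y|).

Let L0 : 0 < L. Proof. exact: lt_le_trans L1. Qed.

Lemma field_path_continuous u j : coord_continuous_path u ->
  continuous (fun t => X (u t) 0 j).
Proof.
move=> cu t; apply/cvgrPdist_lt => e e0.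
have e1 : 0 < e / 2 / L by rewrite !divr_gt0.
apply: filterS (coord_path_near t cu e1) => s hs.
have := row_coord_le (X (u t) - X (u s)) j; rewrite !mxE => /le_lt_trans; apply.
apply: le_lt_trans (XL _ _) _; apply: (@le_lt_trans _ _ (L * (e / 2 / L))).
  by rewrite ler_pM2l.
by rewrite mulrC divfK ?gt_eqF //; lra.
Qed.

Lemma picard_step x u : coord_continuous_path u -> exists v,
  v 0 = x /\ forall (t : R) (j : 'I_m), is_derive t 1 (fun t => v t 0 j) (X (u t) 0 j).
Proof.
move=> cu; have h j := primitive (@field_path_continuous u j cu).
have [C hC] := choice h.
exists (fun t => \row_j (x 0 j + C j t)); split.
  by apply/rowP => j; rewrite mxE (hC j).1 addr0.
move=> t j; under eq_fun do rewrite mxE.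
by have := is_deriveD (is_derive_cst (x 0 j) t 1) ((hC j).2 t); rewrite add0r.
Qed.

Lemma derive_path_continuous v (dv : R -> 'I_m -> R) :
  (forall (t : R) j, is_derive t 1 (fun t => v t 0 j) (dv t j)) -> coord_continuous_path v.
Proof. by move=> h j t; exact: is_derive_continuous (h t j). Qed.

(** Successive iterates differ by at most [M * 2^-1 ^+ k * expR (2 * L * |t|)]. The weight lets the
    iteration converge for all times at once, so local solutions need not be glued. *)
Lemma picard x : exists u, u 0 = x /\ solves X u.
Proof.
have hnext u : exists v, coord_continuous_path u -> v 0 = x /\
    forall (t : R) (j : 'I_m), is_derive t 1 (fun t => v t 0 j) (X (u t) 0 j).
  have [cu|ncu] := pselect (coord_continuous_path u); last by exists u.
  by have [v hv] := picard_step x cu; exists v.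
have [next nextP] := choice hnext.
pose U k := iter k next (fun=> x).
have U0 k : U k 0 = x /\ coord_continuous_path (U k).
  elim: k => [|k [_ IH]] /=; first by split=> // j t; exact: cvg_cst.
  by have [h1 h2] := nextP _ IH; split => //; exact: derive_path_continuous h2.
have dU k (t : R) j : is_derive t 1 (fun t => U k.+1 t 0 j) (X (U k t) 0 j).
  exact: (nextP _ (U0 k).2).2.
pose M := `|X x|; have M0 : 0 <= M by exact: normr_ge0.
have hU k t j : `|U k.+1 t 0 j - U k t 0 j| <= M * 2^-1 ^+ k * expR (2 * L * `|t|).
  elim: k t j => [|k IH] t j.
    rewrite expr0 mulr1.
    have := @primitive_bound R (fun t => U 1%N t 0 j - x 0 j) (fun t => X x 0 j) M 1 ltr01 (normr_ge0 _).
    rewrite divr1; move=> h; apply: le_trans (h _ _ _ t) _.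
    - by rewrite (U0 1%N).1 subrr.
    - by move=> s; have := is_deriveB (dU 0%N s j) (is_derive_cst (x 0 j) s 1); rewrite subr0.
    - move=> s; apply: le_trans (row_coord_le _ _) _; rewrite ler_peMr //.
      by rewrite mul1r -[leLHS]expR0 ler_expR.
    - by apply: ler_wpM2l => //; rewrite ler_expR; apply: ler_wpM2r => //; (have := L1; lra).
  have k0 : 0 < 2 * L by rewrite mulr_gt0.
  have K0 : 0 <= L * (M * 2^-1 ^+ k).
    by rewrite !mulr_ge0 ?(ltW L0) // exprn_ge0 // invr_ge0.
  have := @primitive_bound R (fun t => U k.+2 t 0 j - U k.+1 t 0 j)
    (fun t => X (U k.+1 t) 0 j - X (U k t) 0 j) _ _ k0 K0.
  rewrite (_ : L * (M * 2^-1 ^+ k) / (2 * L) = M * 2^-1 ^+ k.+1); last first.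
    by rewrite exprS; field; rewrite gt_eqF.
  apply.
  - by rewrite !(U0 _).1 subrr.
  - move=> s; have := row_coord_le (X (U k.+1 s) - X (U k s)) j; rewrite !mxE => /le_trans; apply.
    apply: le_trans (XL _ _) _; rewrite -mulrA; apply: ler_wpM2l; first exact: ltW.
    apply: row_norm_le => [|i]; last by rewrite !mxE; exact: IH.
    by rewrite !mulr_ge0 ?expR_ge0 // exprn_ge0 // invr_ge0.
have hl (tj : R * 'I_m) : exists l, forall k,
    `|l - U k tj.1 0 tj.2| <= 2 * (M * expR (2 * L * `|tj.1|)) * 2^-1 ^+ k.
  apply: (@geometric_limit R (fun k => U k tj.1 0 tj.2)) => k.
  by rewrite mulrAC; exact: hU.
have [l lP] := choice hl.
pose u t : 'rV[R]_m := \row_j l (t, j).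
have uU k t : `|u t - U k t| <= 2 * M * 2^-1 ^+ k * expR (2 * L * `|t|).
  apply: row_norm_le => [|j].
    by rewrite !mulr_ge0 ?expR_ge0 // exprn_ge0 // invr_ge0.
  rewrite !mxE; apply: le_trans (lP (t, j) k) _.
  by rewrite le_eqVlt; apply/orP; left; apply/eqP => /=; ring.
have small (t e : R) : 0 < e -> exists k, 2 * M * 2^-1 ^+ k * expR (2 * L * `|t|) < e.
  move=> e0; have c0 : 0 <= 2 * M * expR (2 * L * `|t|) by rewrite !mulr_ge0 ?expR_ge0.
  have : (fun k => 2 * M * expR (2 * L * `|t|) * (2^-1 : R) ^+ k) @ \oo --> (0 : R).
    rewrite -[X in _ --> X](mulr0 (2 * M * expR (2 * L * `|t|))).
    by apply: cvgMl_tmp; apply: cvg_expr; rewrite ger0_norm ?invr_ge0 // invf_lt1 // ltr1n.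
  move=> /cvgrPdist_lt /(_ _ e0) [k _ /(_ k (leqnn k))] /=.
  rewrite sub0r normrN => h; exists k; apply: le_lt_trans (ler_norm _) _.
  by rewrite mulrAC.
have cu : coord_continuous_path u.
  move=> j t; apply/cvgrPdist_lt => e e0.
  have e3 : 0 < e / 3 by rewrite divr_gt0.
  have [k hk] := small (`|t| + 1) _ e3.
  have h1 := coord_path_near t (U0 k).2 e3.
  have h2 : \forall s \near t, `|s| <= `|t| + 1.
    apply/nbhs_ballP; exists 1 => //= s; rewrite /ball /= => ts.
    by have := ler_normD t (s - t); rewrite addrC subrK distrC; lra.
  apply: filterS2 h1 h2 => s hs s1.
  have b0 r : `|r| <= `|t| + 1 -> `|u r - U k r| < e / 3.
    move=> r1; apply: le_lt_trans (uU k r) _; apply: le_lt_trans hk.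
    apply: ler_wpM2l; first by rewrite !mulr_ge0 // exprn_ge0 // invr_ge0.
    rewrite ler_expR; apply: ler_wpM2l; first by rewrite mulr_ge0 // ltW.
    by rewrite [leRHS]ger0_norm // addr_ge0.
  have := row_coord_le (u t - u s) j; rewrite !mxE => /le_lt_trans; apply.
  have -> : u t - u s = (u t - U k t) + (U k t - U k s) - (u s - U k s).
    by rewrite addrA subrK opprB addrA subrK.
  have h3 := b0 t (_ : `|t| <= `|t| + 1); have h4 := b0 s s1.
  apply: le_lt_trans (ler_normB _ _) _; apply: le_lt_trans (lerD (ler_normD _ _) (lexx _)) _.
  by have := h3 (ler_wpDr ler01 (lexx _)); lra.
(* [v] is one more Picard step starting from the limit [u]. Both are limits of the same iterates,
   hence equal, which turns the integral equation into the differential one. *)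
have [v [v0 dv]] := picard_step x cu.
have uv : u = v.
  apply/funext => t; apply/rowP => j; apply/eqP; rewrite -subr_eq0 -normr_eq0.
  rewrite eq_le normr_ge0 andbT; apply/ler_addgt0Pr => e e0; rewrite add0r.
  have e20 : 0 < e / 2 by lra.
  have [k hk] := small t _ e20.
  have h1 : `|v t 0 j - U k.+1 t 0 j| <= M * 2^-1 ^+ k * expR (2 * L * `|t|).
    have k0 : 0 < 2 * L by rewrite mulr_gt0.
    have K0 : 0 <= L * (2 * M * 2^-1 ^+ k).
      by rewrite !mulr_ge0 ?(ltW L0) // exprn_ge0 // invr_ge0.
    have := @primitive_bound R (fun t => v t 0 j - U k.+1 t 0 j)
      (fun t => X (u t) 0 j - X (U k t) 0 j) _ _ k0 K0.
    rewrite (_ : L * (2 * M * 2^-1 ^+ k) / (2 * L) = M * 2^-1 ^+ k); last first.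
      by field; rewrite gt_eqF.
    apply.
    - by rewrite v0 (U0 _).1 subrr.
    - move=> s; have := row_coord_le (X (u s) - X (U k s)) j; rewrite !mxE => /le_trans; apply.
      by apply: le_trans (XL _ _) _; rewrite -mulrA; apply: ler_wpM2l; [exact: ltW|exact: uU].
  have h2 := row_coordB_le (u t) (U k.+1 t) j.
  have h3 := uU k.+1 t; rewrite exprS in h3.
  have h4 := ler_distD (U k.+1 t 0 j) (u t 0 j) (v t 0 j).
  rewrite (distrC (U k.+1 t 0 j) (v t 0 j)) in h4.
  have e1 : 2 * M * (2^-1 * 2^-1 ^+ k) * expR (2 * L * `|t|) =
     M * 2^-1 ^+ k * expR (2 * L * `|t|) by field.
  have e2 : 2 * M * 2^-1 ^+ k * expR (2 * L * `|t|) =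
     2 * (M * 2^-1 ^+ k * expR (2 * L * `|t|)) by ring.
  rewrite e1 in h3; rewrite e2 in hk; move: h1 h2 h3 h4 hk.
  by move: (M * _ * _) => q; lra.
by exists v; split => // t j; rewrite -uv; have := dv t j; rewrite uv.
Qed.
End Existence.

End Picard.

(** * Flows of globally Lipschitz fields *)

Section GlobalFlow.
Variables (R : realType) (m : nat).
Implicit Types (x y : 'rV[R]_m) (u v : R -> 'rV[R]_m).

Lemma is_derive_bigsum (I : Type) (s : seq I) (G : I -> R -> R) (d : I -> R) (t : R) :
  (forall j, is_derive t 1 (G j) (d j)) ->
  is_derive t 1 (fun t => \sum_(j <- s) G j t) (\sum_(j <- s) d j).
Proof.
move=> h; elim: s => [|j s IH].
  rewrite big_nil; under eq_fun do rewrite big_nil; exact: is_derive_cst.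
rewrite big_cons; under eq_fun do rewrite big_cons.
by have := is_deriveD (h j) IH.
Qed.

Lemma is_derive_mul (f g : R -> R) (df dg t : R) :
  is_derive t 1 f df -> is_derive t 1 g dg ->
  is_derive t 1 (fun t => f t * g t) (df * g t + f t * dg).
Proof.
move=> hf hg; have h := is_deriveM hf hg.
by apply: is_derive_eq; rewrite /GRing.scale /= addrC mulrC.
Qed.

Lemma dot_ge0 x : 0 <= dot x x.
Proof. by apply: sumr_ge0 => j _; rewrite -expr2 sqr_ge0. Qed.

Lemma norm_sqr_le_dot x : `|x| ^+ 2 <= dot x x.
Proof.
rewrite -[leRHS]sqr_sqrtr ?dot_ge0 //; apply: lerXn2r; rewrite ?nnegrE ?sqrtr_ge0 //.
apply: row_norm_le => [|j]; first exact: sqrtr_ge0.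
rewrite -sqrtr_sqr ler_wsqrtr // /dot (bigD1 j) //= expr2 lerDl.
by apply: sumr_ge0 => i _; rewrite -expr2 sqr_ge0.
Qed.

Lemma dot_le_norm_sqr x y : dot x y <= m%:R * (`|x| * `|y|).
Proof.
rewrite /dot; apply: (@le_trans _ _ (\sum_(j < m) `|x| * `|y|)).
  apply: ler_sum => j _; apply: le_trans (ler_norm _) _; rewrite normrM.
  by apply: ler_pM; rewrite ?row_coord_le.
by rewrite sumr_const card_ord mulr_natl.
Qed.

Lemma is_derive_dot u v (du dv : 'rV[R]_m) (t : R) :
  (forall j, is_derive t 1 (fun t => u t 0 j) (du 0 j)) ->
  (forall j, is_derive t 1 (fun t => v t 0 j) (dv 0 j)) ->
  is_derive t 1 (fun t => dot (u t) (v t)) (dot du (v t) + dot (u t) dv).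
Proof.
move=> hu hv; rewrite /dot -big_split /=.
exact: is_derive_bigsum (fun j => is_derive_mul (hu j) (hv j)).
Qed.

Variables (X : 'rV[R]_m -> 'rV[R]_m) (L : R).
Hypotheses (L1 : 1 <= L) (XL : forall x y, `|X x - X y| <= L * `|x - y|).

Let L0 : 0 < L. Proof. exact: lt_le_trans L1. Qed.

Let k : R := 2 * m%:R * L.
Let k0 : 0 <= k. Proof. by rewrite /k !mulr_ge0 // ltW. Qed.

(** Gronwall is applied to the squared Euclidean distance, which is differentiable where the sup
    norm is not. Comparing the two norms costs the factor [m] in [k]. *)
Lemma solves_dist u v t : solves X u -> solves X v ->
  dot (u t - v t) (u t - v t) <= dot (u 0 - v 0) (u 0 - v 0) * expR (k * `|t|).
Proof.
move=> su sv; pose w t := u t - v t.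
have dw (s : R) j : is_derive s 1 (fun s => w s 0 j) ((X (u s) - X (v s)) 0 j).
  rewrite !mxE; under eq_fun do rewrite !mxE.
  by have := is_deriveB (su s j) (sv s j).
apply: (@gronwall R (fun s => dot (w s) (w s)) _ k k0
  (fun s => dot_ge0 (w s)) (fun s => is_derive_dot (dw s) (dw s))) => s.
have dotC x y : dot x y = dot y x by apply: eq_bigr => j _; rewrite mulrC.
have dotN x y : - dot x y = dot (- x) y.
  by rewrite /dot -sumrN; apply: eq_bigr => j _; rewrite mxE mulNr.
rewrite (dotC (w s)) -mulr2n -mulr_natl normrM ger0_norm // /k -!mulrA ler_pM2l //.
have h : m%:R * (`|X (u s) - X (v s)| * `|w s|) <= m%:R * (L * dot (w s) (w s)).
  apply: ler_wpM2l => //; apply: le_trans (_ : _ <= L * `|w s| * `|w s|) _.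
    by apply: ler_wpM2r => //; exact: XL.
  by rewrite -mulrA ler_pM2l // -expr2; exact: norm_sqr_le_dot.
rewrite ler_norml; apply/andP; split.
  rewrite lerNl dotN; apply: le_trans h; apply: le_trans (dot_le_norm_sqr _ _) _.
  by rewrite normrN.
by apply: le_trans h; exact: dot_le_norm_sqr.
Qed.

Lemma solves_unique u v : solves X u -> solves X v -> u 0 = v 0 -> u = v.
Proof.
move=> su sv uv; apply/funext => t; apply/eqP; rewrite -subr_eq0 -normr_eq0 -sqrf_eq0.
rewrite eq_le sqr_ge0 andbT; apply: le_trans (norm_sqr_le_dot _) _.
apply: le_trans (solves_dist t su sv) _; rewrite uv subrr /dot big1 ?mul0r // => j _.
by rewrite mxE mul0r.
Qed.

(** The group law is uniqueness of solutions. Joint continuity combines the continuity of one orbit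
    in time with [solves_dist], which is locally uniform in time. *)
Theorem global_flow : exists Phi : R -> 'rV[R]_m -> 'rV[R]_m,
  [/\ forall x, Phi 0 x = x,
      forall x, solves X (Phi^~ x),
      forall s t x, Phi (s + t) x = Phi s (Phi t x) &
      forall t x (e : R), 0 < e -> exists2 d : R, 0 < d &
        forall s y, `|s - t| < d -> `|y - x| < d -> `|Phi s y - Phi t x| < e].
Proof.
have [P hP] := choice (fun x => picard L1 XL x).
exists (fun t x => P x t); split.
- by move=> x; exact: (hP x).1.
- by move=> x; exact: (hP x).2.
- move=> s t x; have := @solves_unique (fun s => P x (s + t)) (P (P x t)).
  move=> /(_ _ (hP _).2); rewrite (hP (P x t)).1 add0r => h.
  apply: (congr1 (fun f : R -> 'rV[R]_m => f s) (h _ erefl)).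
  move=> r j; have h1 := (hP x).2 (r + t) j.
  have h2 : is_derive r 1 (fun r : R => r + t) (1 : R).
    by have := is_deriveD (is_derive_id r 1) (is_derive_cst t r 1); rewrite addr0.
  have := @is_derive1_comp R (fun t => P x t 0 j) (fun r => r + t) r _ 1 h1 h2.
  by rewrite mulr1.
move=> t x e e0.
(* [B] bounds the growth factor of [solves_dist] at all times within 1 of [t]; [N] absorbs the
   passage from the Euclidean to the sup norm. *)
pose B := expR (k * (`|t| + 1)); pose N := m%:R + 1 : R.
have N0 : 0 < N by rewrite /N ltr_wpDl.
have B0 : 0 < B by exact: expR_gt0.
have cx : coord_continuous_path (P x).
  by move=> j s; exact: is_derive_continuous ((hP x).2 s j).
have e2 : 0 < e / 2 by lra.
have e4 : 0 < e / 4 by lra.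
have /nbhs_ballP[d1 /= d10 hd1] := coord_path_near t cx e4.
pose c := N * B; have c0 : 0 < c by rewrite mulr_gt0.
pose d2 := e / 2 / (c + 1).
have d20 : 0 < d2 by rewrite divr_gt0 // ltr_wpDl // ltW.
pose d := Num.min (Num.min d1 d2) 1.
exists d; first by rewrite /d !lt_min d10 d20 ltr01.
move=> s y; rewrite /d !lt_min => /andP[/andP[s1 _] s3] /andP[/andP[_ y2] _].
have h1 : `|P x t - P x s| <= e / 4.
  by apply: hd1; rewrite /ball /= distrC.
have h2 : `|P y s - P x s| < e / 2.
  rewrite -(@ltr_pXn2r _ 2) ?nnegrE ?(ltW e2) //.
  apply: le_lt_trans (norm_sqr_le_dot _) _.
  apply: le_lt_trans (solves_dist s (hP y).2 (hP x).2) _.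
  rewrite (hP y).1 (hP x).1.
  apply: (@le_lt_trans _ _ (m%:R * (`|y - x| * `|y - x|) * B)).
    apply: ler_pM; rewrite ?dot_ge0 ?expR_ge0 ?dot_le_norm_sqr //.
    rewrite /B ler_expR; apply: ler_wpM2l => //.
    by have := ler_normD t (s - t); rewrite addrC subrK; lra.
  have h3 : `|y - x| * (c + 1) < e / 2 by rewrite -ltr_pdivlMr // ltr_wpDl // ltW.
  have h4 : (`|y - x| * (c + 1)) ^+ 2 < (e / 2) ^+ 2.
    rewrite ltr_pXn2r ?nnegrE ?(ltW e2) //; rewrite mulr_ge0 //; lra.
  apply: le_lt_trans h4; rewrite exprMn mulrAC expr2 -/c.
  have : m%:R * B <= (c + 1) ^+ 2.
    apply: (@le_trans _ _ c); first by rewrite /c ler_pM2r // /N lerDl.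
    rewrite expr2; have := c0; nra.
  move=> /(ler_wpM2l (sqr_ge0 `|y - x|)); rewrite expr2; lra.
have := ler_distD (P x s) (P y s) (P x t); rewrite (distrC (P x s)); lra.
Qed.
End GlobalFlow.

(** * Lipschitz vector fields on spheres *)

Section LipschitzAlgebra.
Variables (R : realType) (m : nat) (S : set 'rV[R]_m).
Implicit Types (p q : 'rV[R]_m -> R) (x y : 'rV[R]_m).

(** Boundedness is included so that products of such functions are again Lipschitz. *)
Definition lipb q :=
  (exists L, forall x y, S x -> S y -> `|q x - q y| <= L * `|x - y|) /\
  (exists M, forall x, S x -> `|q x| <= M).

Lemma lipb_eq p q : (forall x, S x -> p x = q x) -> lipb p -> lipb q.
Proof.
move=> pq [[L hL] [M hM]]; split; [exists L => x y Sx Sy|exists M => x Sx].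
  by rewrite -!pq //; exact: hL.
by rewrite -pq //; exact: hM.
Qed.

Lemma lipb_cst (c : R) : lipb (fun=> c).
Proof.
split; last by exists `|c|.
by exists 0 => x y _ _; rewrite subrr normr0 mul0r.
Qed.

Lemma lipbD p q : lipb p -> lipb q -> lipb (fun x => p x + q x).
Proof.
move=> [[L hL] [M hM]] [[L' hL'] [M' hM']]; split.
  exists (L + L') => x y Sx Sy; rewrite opprD addrACA mulrDl.
  by apply: le_trans (ler_normD _ _) (lerD (hL _ _ Sx Sy) (hL' _ _ Sx Sy)).
by exists (M + M') => x Sx; apply: le_trans (ler_normD _ _) (lerD (hM _ Sx) (hM' _ Sx)).
Qed.

Lemma lipbM p q : lipb p -> lipb q -> lipb (fun x => p x * q x).
Proof.
move=> [[L hL] [M hM]] [[L' hL'] [M' hM']]; split.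
  exists (L * M' + M * L') => x y Sx Sy.
  rewrite (_ : p x * q x - p y * q y = (p x - p y) * q x + p y * (q x - q y)); last by ring.
  apply: le_trans (ler_normD _ _) _; rewrite !normrM mulrDl; apply: lerD.
    by rewrite mulrAC; apply: ler_pM => //; [exact: hL|exact: hM'].
  by rewrite -mulrA; apply: ler_pM => //; [exact: hM|exact: hL'].
by exists (M * M') => x Sx; rewrite normrM; apply: ler_pM => //; [exact: hM|exact: hM'].
Qed.

Lemma lipbN p : lipb p -> lipb (fun x => - p x).
Proof.
move=> hp; apply: lipb_eq (lipbM (lipb_cst (-1)) hp) => x _.
by rewrite mulN1r.
Qed.

Lemma lipb_sum (I : Type) (s : seq I) (P : pred I) (q : I -> 'rV[R]_m -> R) :
  (forall i, lipb (q i)) -> lipb (fun x => \sum_(i <- s | P i) q i x).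
Proof.
move=> hq; elim: s => [|i s IH].
  by apply: lipb_eq (lipb_cst 0) => x _; rewrite big_nil.
have [Pi|nPi] := boolP (P i).
  by apply: lipb_eq (lipbD (hq i) IH) => x _; rewrite big_cons Pi.
by apply: lipb_eq IH => x _; rewrite big_cons (negbTE nPi).
Qed.

Lemma lipb_prod (I : Type) (s : seq I) (P : pred I) (q : I -> 'rV[R]_m -> R) :
  (forall i, lipb (q i)) -> lipb (fun x => \prod_(i <- s | P i) q i x).
Proof.
move=> hq; elim: s => [|i s IH].
  by apply: lipb_eq (lipb_cst 1) => x _; rewrite big_nil.
have [Pi|nPi] := boolP (P i).
  by apply: lipb_eq (lipbM (hq i) IH) => x _; rewrite big_cons Pi.
by apply: lipb_eq IH => x _; rewrite big_cons (negbTE nPi).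
Qed.

Lemma lipb_within_continuous q : lipb q -> {within S, continuous q}.
Proof.
move=> [[L hL] _]; apply/subspace_continuousP => x Sx.
apply/cvgrPdist_lt => e e0; pose L' := `|L| + 1.
have L'0 : 0 < L' by rewrite ltr_wpDl.
near=> y.
have Sy : S y by near: y; exact: withinT.
apply: le_lt_trans (hL _ _ Sx Sy) _.
have xy : `|x - y| < e / L'.
  near: y; apply: cvg_within; apply/nbhs_ballP; exists (e / L'); first exact: divr_gt0.
  by move=> y; rewrite -ball_normE.
apply: (@le_lt_trans _ _ (L' * `|x - y|)).
  by apply: ler_wpM2r => //; rewrite /L'; have := ler_norm L; lra.
by rewrite mulrC -ltr_pdivlMr.
Unshelve. all: by end_near. Qed.

Hypothesis cptS : compact S.

(** Compactness bounds [|q|] away from 0: the minimum is taken for [q x * q x], which avoids a sign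
    distinction. *)
Lemma lipbV q : lipb q -> (forall x, S x -> q x != 0) -> lipb (fun x => (q x)^-1).
Proof.
move=> hq q0.
have [S0|/set0P Sn0] := eqVneq S set0.
  by split; exists 0 => x; rewrite ?S0.
have cq2 : {within S, continuous (fun x => q x * q x)}.
  by apply: lipb_within_continuous; exact: lipbM.
have [c Sc hc] := EVT_min_rV Sn0 cptS cq2.
have {}Sc : S c by exact: set_mem.
pose d := Num.sqrt (q c * q c).
have dE : d = `|q c| by rewrite /d -expr2 sqrtr_sqr.
have d0 : 0 < d by rewrite dE normr_gt0 q0.
have dq x : S x -> d <= `|q x|.
  move=> Sx; rewrite /d -(sqrtr_sqr (q x)) ler_wsqrtr // [leRHS]expr2.
  by apply: hc; exact: mem_set.
move: hq => [[L hL] [M hM]]; split; last first.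
  by exists d^-1 => x Sx; rewrite normfV lef_pV2 ?posrE ?dq // (lt_le_trans d0) ?dq.
exists (L / d ^+ 2) => x y Sx Sy.
have [x0 y0] := (q0 _ Sx, q0 _ Sy).
rewrite (_ : (q x)^-1 - (q y)^-1 = (q y - q x) / (q x * q y)); last by field; rewrite x0 y0.
rewrite normrM normfV distrC mulrAC; apply: ler_pM => //; first exact: hL.
rewrite lef_pV2 ?posrE ?normr_gt0 ?mulf_neq0 ?exprn_gt0 // expr2 normrM.
by apply: ler_pM; rewrite ?(ltW d0) ?dq.
Qed.

Definition locally_lipschitz q := forall p : 'rV[R]_m, S p -> exists s L : R, 0 < s /\
  forall x y, `|x - p| < s -> `|y - p| < s -> `|q x - q y| <= L * `|x - y|.

(** [S] is not convex, so local constants cannot be chained along segments. Instead S x S is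
    covered: near the diagonal a local constant works, and near a pair of distinct points the
    bounded difference of values is divided by a positive distance. *)
Lemma locally_lipschitz_lipb q : locally_lipschitz q -> lipb q.
Proof.
move=> hq.
have hL : exists L, forall x y, S x -> S y -> `|q x - q y| <= L * `|x - y|.
  have /compact_near_coveringP h := compact_setX cptS cptS.
  have := h R (pinfty_nbhs R) (fun L xy => `|q xy.1 - q xy.2| <= L * `|xy.1 - xy.2|) _ _.
  move=> /(_ _)[|M [_ hM]]; last first.
    by exists (M + 1) => x y Sx Sy; apply: (hM (M + 1) _ (x, y)) => //; rewrite ltrDl.
  move=> [p p'] /= [Sp Sp'].
  have [s [L [s0 hs]]] := hq p Sp; have [s' [L' [s'0 hs']]] := hq p' Sp'.
  have [pp'|pp'] := eqVneq p p'.
    exists (ball p s `*` ball p s, [set M | L < M]).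
      split; last by exists L; split => //; exact: num_real.
      by exists (ball p s, ball p s) => //=; split; rewrite -?pp'; exact: nbhsx_ballx.
    move=> [[x y] M] /= [[px py] LM]; apply: le_trans (hs x y _ _) _.
    - by move: px; rewrite -ball_normE /= distrC.
    - by move: py; rewrite -ball_normE /= distrC.
    - by apply: ler_wpM2r => //; exact: ltW.
  pose D := `|p - p'|; have D0 : 0 < D by rewrite normr_gt0 subr_eq0.
  (* Points within [D / 4] of [p] and of [p'] are at least [D / 2] apart. *)
  pose t := Num.min (Num.min s s') (D / 4).
  have [t0 [ts [ts' tD]]] : 0 < t /\ t <= s /\ t <= s' /\ t <= D / 4.
    by rewrite /t !lt_min !ge_min s0 s'0 !lexx !orbT divr_gt0.
  pose B := `|q p - q p'| + `|L| * t + `|L'| * t.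
  have B0 : 0 <= B by rewrite /B !addr_ge0 // mulr_ge0 // ltW.
  exists (ball p t `*` ball p' t, [set M | B / (D / 2) < M]).
    split; last by exists (B / (D / 2)); split => //; exact: num_real.
    by exists (ball p t, ball p' t) => //=; split; exact: nbhsx_ballx.
  move=> [[x y] M] /= [[px py] LM].
  have {}px : `|x - p| < t by move: px; rewrite -ball_normE /= distrC.
  have {}py : `|y - p'| < t by move: py; rewrite -ball_normE /= distrC.
  have h1 : `|q x - q p| <= `|L| * t.
    apply: le_trans (hs x p (lt_le_trans px ts) _) _; first by rewrite subrr normr0.
    apply: le_trans (ler_wpM2r (normr_ge0 _) (ler_norm L)) _; apply: ler_wpM2l => //; exact: ltW.
  have h2 : `|q y - q p'| <= `|L'| * t.
    apply: le_trans (hs' y p' (lt_le_trans py ts') _) _; first by rewrite subrr normr0.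
    apply: le_trans (ler_wpM2r (normr_ge0 _) (ler_norm L')) _; apply: ler_wpM2l => //; exact: ltW.
  have h3 : `|q x - q y| <= B.
    rewrite (_ : q x - q y = (q p - q p') + (q x - q p) - (q y - q p')); last by ring.
    apply: le_trans (ler_normB _ _) _; apply: lerD => //.
    by apply: le_trans (ler_normD _ _) _; rewrite lerD2l.
  have h4 : D / 2 <= `|x - y|.
    have := ler_normB (x - y) ((x - p) - (y - p')).
    rewrite (_ : x - y - (x - p - (y - p')) = p - p'); last first.
      by apply/rowP => j; rewrite !mxE; ring.
    have := ler_normB (x - p) (y - p'); rewrite -/D; lra.
  apply: le_trans h3 _; have D20 : 0 < D / 2 by lra.
  rewrite -(divfK (lt0r_neq0 D20) B).
  by apply: ler_pM; [rewrite divr_ge0 // ltW|exact: ltW|exact: ltW|exact: h4].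
split => //; have [L hLS] := hL.
have [S0|/set0P [p Sp]] := eqVneq S set0; first by exists 0 => x; rewrite S0.
have [M [_ hM]] := compact_bounded cptS.
exists (`|q p| + `|L| * (2 * (`|M| + 1))) => x Sx.
have xM y : S y -> `|y| <= `|M| + 1.
  by move=> Sy; apply: (hM (`|M| + 1)) => //; have := ler_norm M; lra.
have -> : q x = q p + (q x - q p) by rewrite addrC subrK.
apply: le_trans (ler_normD _ _) _; rewrite lerD2l.
apply: le_trans (hLS _ _ Sx Sp) _; apply: le_trans (ler_wpM2r (normr_ge0 _) (ler_norm L)) _.
apply: ler_wpM2l => //; apply: le_trans (ler_normB _ _) _.
by have := xM _ Sx; have := xM _ Sp; lra.
Qed.

End LipschitzAlgebra.

(** * Linear systems with Lipschitz coefficients *)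

Section RightInverse.
Variables (R : realType) (m : nat) (S : set 'rV[R]_m).
Hypothesis cptS : compact S.

Definition lipb_mx p q (A : 'rV[R]_m -> 'M[R]_(p, q)) :=
  forall i j, lipb S (fun w => A w i j).

Lemma lipb_mulmx p q k (A : 'rV[R]_m -> 'M[R]_(p, q)) (B : 'rV[R]_m -> 'M[R]_(q, k)) :
  lipb_mx A -> lipb_mx B -> lipb_mx (fun w => A w *m B w).
Proof.
move=> hA hB i j.
apply: (@lipb_eq _ _ _ (fun w => \sum_l A w i l * B w l j)) => [w _|].
  by rewrite mxE.
by apply: lipb_sum => l; apply: lipbM.
Qed.

Lemma lipb_det k (A : 'rV[R]_m -> 'M[R]_k) : lipb_mx A -> lipb S (fun w => \det (A w)).
Proof.
move=> hA; rewrite /determinant; apply: lipb_sum => s.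
by apply: lipbM; [exact: lipb_cst|apply: lipb_prod => i].
Qed.

Lemma lipb_invmx k (A : 'rV[R]_m -> 'M[R]_k) :
  lipb_mx A -> (forall w, S w -> A w \in unitmx) -> lipb_mx (fun w => invmx (A w)).
Proof.
move=> hA uA i j.
apply: (@lipb_eq _ _ _ (fun w => (\det (A w))^-1 * cofactor (A w) j i)) => [w Sw|].
  by rewrite /invmx uA // !mxE.
apply: lipbM; first apply: lipbV => //; first exact: lipb_det.
  by move=> w Sw; have := uA w Sw; rewrite unitmxE unitfE.
apply: lipbM; first exact: lipb_cst.
apply: lipb_det => i' j'; apply: lipb_eq (hA (lift j i') (lift i j')) => w _.
by rewrite !mxE.
Qed.

(** If [T^T T] annihilates a vector, then the sum of the squares of the entries of its image under
    [T] is 0, so that image vanishes. *)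
Lemma gram_unitmx q k (T : 'M[R]_(q, k)) :
  (forall c : 'cV_k, T *m c = 0 -> c = 0) -> T^T *m T \in unitmx.
Proof.
move=> T0; rewrite -unitmx_tr -row_free_unit; apply/inj_row_free => v.
rewrite trmx_mul trmxK => vT; apply/trmx_inj; rewrite trmx0; apply: T0.
have : (T *m v^T)^T *m (T *m v^T) = 0.
  by rewrite trmx_mul trmxK !mulmxA -(mulmxA v) vT mul0mx.
move=> /(congr1 (fun A : 'M[R]_1 => A 0 0)); rewrite !mxE => /eqP.
under eq_bigr => l _ do rewrite [in X in X * _]mxE -expr2.
rewrite psumr_eq0; last by move=> l _; exact: sqr_ge0.
move=> /allP h.
apply/matrixP => i j; rewrite ord1 [RHS]mxE; apply/eqP.
by rewrite -sqrf_eq0; apply: h; rewrite mem_index_enum.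
Qed.

(* The solution T (T^T T)^-1 e given by the Gram matrix is a rational function
   of the entries of T. *)
Lemma lipschitz_right_inverse q k (T : 'rV[R]_m -> 'M[R]_(q, k)) (e : 'cV[R]_k) :
  lipb_mx T -> (forall w, S w -> forall c : 'cV_k, T w *m c = 0 -> c = 0) ->
  exists2 x : 'rV[R]_m -> 'cV[R]_q, lipb_mx x &
    forall w, S w -> (T w)^T *m x w = e.
Proof.
move=> lT T0.
have lTt : lipb_mx (fun w => (T w)^T).
  by move=> i j; apply: lipb_eq (lT j i) => w _; rewrite mxE.
have uG w : S w -> (T w)^T *m T w \in unitmx.
  by move=> Sw; apply: gram_unitmx; exact: T0.
exists (fun w => T w *m (invmx ((T w)^T *m T w) *m e)).
  apply: lipb_mulmx => //; apply: lipb_mulmx.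
    by apply: lipb_invmx => //; exact: lipb_mulmx.
  by move=> i j; exact: lipb_cst.
by move=> w Sw; rewrite !mulmxA mulmxV ?uG // mul1mx.
Qed.

End RightInverse.

(** * Flows on a Euclidean sphere *)

Section SphereFlow.
Variables (R : realType) (m : nat) (r : R).
Hypothesis r0 : 0 < r.
Implicit Types (x y w : 'rV[R]_m).

Definition euclid_sphere : set 'rV[R]_m := [set w | dot w w = r ^+ 2].
Local Notation S := euclid_sphere.

Let eu x : R := Num.sqrt (dot x x).

Lemma dotZ (c d : R) x y : dot (c *: x) (d *: y) = c * d * dot x y.
Proof. by rewrite /dot mulr_sumr; apply: eq_bigr => j _; rewrite !mxE; ring. Qed.

Lemma dotC x y : dot x y = dot y x.
Proof. by apply: eq_bigr => j _; rewrite mulrC. Qed.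

Lemma euclid_sphere_compact : compact S.
Proof.
apply: bounded_closed_compact.
  exists r; split; first exact: num_real.
  move=> M rM x Sx; apply: ltW; apply: le_lt_trans rM.
  rewrite -(@ler_pXn2r _ 2) ?nnegrE ?(ltW r0) //.
  by apply: le_trans (norm_sqr_le_dot _) _; rewrite Sx.
have cd : continuous (fun x : 'rV[R]_m => dot x x).
  rewrite /dot; apply: continuous_big => [|j _ x]; first exact: add_continuous.
  have h : (fun w : 'rV[R]_m => w 0 j) w @[w --> x] --> x 0 j by exact: coord_continuous.
  exact: (cvgM h h).
apply: (@closed_comp _ _ (fun x : 'rV[R]_m => dot x x) [set r ^+ 2]).
  by move=> x _; exact: cd.
exact: closed_eq.
Qed.

Let euE x : eu x ^+ 2 = dot x x. Proof. by rewrite sqr_sqrtr ?dot_ge0. Qed.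
Let eu_ge0 x : 0 <= eu x. Proof. exact: sqrtr_ge0. Qed.
Let norm_le_eu x : `|x| <= eu x.
Proof. by rewrite -(@ler_pXn2r _ 2) ?nnegrE // euE norm_sqr_le_dot. Qed.

Let euB x y : `|eu x - eu y| <= m%:R * `|x - y|.
Proof.
have [e0|e0] := eqVneq (eu x + eu y) 0.
  have [-> ->] : eu x = 0 /\ eu y = 0 by have := eu_ge0 x; have := eu_ge0 y; lra.
  by rewrite subrr normr0 mulr_ge0.
have ep : 0 < eu x + eu y by rewrite lt_neqAle eq_sym e0 addr_ge0.
rewrite -(ler_pM2r ep) -{1}(ger0_norm (ltW ep)) -normrM.
have -> : (eu x - eu y) * (eu x + eu y) = dot (x - y) (x + y).
  rewrite -subr_sqr !euE /dot -sumrB; apply: eq_bigr => j _; rewrite !mxE; ring.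
have h : `|dot (x - y) (x + y)| <= m%:R * (`|x - y| * `|x + y|).
  rewrite ler_norml dot_le_norm_sqr andbT.
  have := dot_le_norm_sqr (- (x - y)) (x + y); rewrite normrN.
  have := dotZ (-1) 1 (x - y) (x + y); rewrite scaleN1r scale1r => ->; lra.
apply: le_trans h _; rewrite -mulrA; do 2 (apply: ler_wpM2l => //).
by apply: le_trans (ler_normD _ _) (lerD (norm_le_eu x) (norm_le_eu y)).
Qed.

Let proj x := (r / eu x) *: x.

Let proj_sphere x : x != 0 -> S (proj x) /\ 0 < eu x.
Proof.
move=> x0; have e0 : 0 < eu x by apply: lt_le_trans (norm_le_eu x); rewrite normr_gt0.
split => //; rewrite /S /= dotZ -euE -expr2 exprMn exprVn divfK //.
by rewrite expf_neq0 ?gt_eqF.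
Qed.

(** The radial projection has a Lipschitz constant that explodes at the origin; the factor [eu x]
    compensates for it. *)
Let projB x y : x != 0 -> y != 0 ->
  eu x * `|proj x - proj y| <= r * ((m%:R + 1) * `|x - y|).
Proof.
move=> x0 y0; have [_ ex] := proj_sphere x0; have [_ ey] := proj_sphere y0.
have exn : eu x != 0 by rewrite gt_eqF.
have eyn : eu y != 0 by rewrite gt_eqF.
have -> : proj x - proj y = (r / eu x) *: ((x - y) - ((eu x - eu y) / eu y) *: y).
  by apply/rowP => j; rewrite !mxE; field; rewrite exn eyn.
rewrite normrZ mulrA ger0_norm ?divr_ge0 ?(ltW r0) // mulrCA divff // mulr1.
apply: ler_wpM2l; first exact: ltW.
apply: le_trans (ler_normB _ _) _; rewrite [leRHS]mulrDl mul1r [leRHS]addrC lerD2l normrZ.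
apply: le_trans (euB x y); rewrite normrM normfV (gtr0_norm ey) -mulrA.
rewrite -[leRHS]mulr1; apply: ler_wpM2l => //.
by rewrite mulrC ler_pdivrMr // mul1r norm_le_eu.
Qed.

(** The extension that is homogeneous of degree 1 is Lipschitz even at the origin, and so produces a
    field to which [global_flow] applies. *)
Lemma homogeneous_extension_lipschitz (q : 'rV[R]_m -> R) : lipb S q ->
  exists L, forall x y, `|eu x / r * q (proj x) - eu y / r * q (proj y)| <= L * `|x - y|.
Proof.
move=> [[L hL] [M hM]].
pose K := m%:R / r * `|M| + `|L| * (m%:R + 1).
have hK0 x y : eu y = 0 -> `|eu x / r * q (proj x) - eu y / r * q (proj y)| <= K * `|x - y|.
  move=> ey; rewrite ey !mul0r subr0.
  have [->|x0] := eqVneq x 0.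
    rewrite /eu (_ : dot 0 0 = 0) ?sqrtr0 ?mul0r ?normr0.
      by rewrite mulr_ge0 // /K addr_ge0 // mulr_ge0 // ?divr_ge0 ?addr_ge0 // ltW.
    by rewrite /dot big1 // => j _; rewrite mxE mul0r.
  have [Sx ex] := proj_sphere x0.
  rewrite normrM; apply: (@le_trans _ _ (m%:R / r * `|x - y| * `|M|)).
    apply: ler_pM => //; last exact: le_trans (hM _ Sx) (ler_norm _).
    rewrite normrM normfV (gtr0_norm r0) [leRHS]mulrAC; apply: ler_wpM2r.
      by rewrite invr_ge0 ltW.
    by have := euB x y; rewrite ey subr0.
  rewrite mulrAC; apply: ler_wpM2r => //; rewrite /K lerDl.
  by rewrite mulr_ge0 // addr_ge0.
exists K => x y.
have [x0|x0] := eqVneq (eu x) 0; first by rewrite distrC (distrC x); exact: hK0.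
have [y0|y0] := eqVneq (eu y) 0; first exact: hK0.
have nz z : eu z != 0 -> z != 0.
  apply: contra_neq => ->; rewrite /eu /dot big1 ?sqrtr0 // => j _.
  by rewrite mxE mul0r.
have [Sx ex] := proj_sphere (nz _ x0); have [Sy ey] := proj_sphere (nz _ y0).
have -> : eu x / r * q (proj x) - eu y / r * q (proj y) =
  (eu x - eu y) / r * q (proj y) + eu x / r * (q (proj x) - q (proj y)) by ring.
apply: le_trans (ler_normD _ _) _; rewrite /K [leRHS]mulrDl; apply: lerD.
  rewrite normrM normrM normfV (gtr0_norm r0) [leRHS]mulrAC.
  apply: ler_pM => //; first by rewrite divr_ge0 // ltW.
    by rewrite [leRHS]mulrAC; apply: ler_wpM2r; [rewrite invr_ge0 ltW|exact: euB].
  exact: le_trans (hM _ Sy) (ler_norm _).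
rewrite normrM (ger0_norm _) ?divr_ge0 ?(ltW r0) //.
apply: (@le_trans _ _ (eu x / r * (`|L| * `|proj x - proj y|))).
  apply: ler_wpM2l; first by rewrite divr_ge0 // ltW.
  by apply: le_trans (hL _ _ Sx Sy) (ler_wpM2r (normr_ge0 _) (ler_norm L)).
rewrite mulrCA -[leRHS]mulrA; apply: ler_wpM2l => //.
rewrite mulrAC ler_pdivrMr // [leRHS]mulrC; exact: (projB (nz _ x0) (nz _ y0)).
Qed.

(** The homogeneous extension of a tangent field is orthogonal to the position vector everywhere,
    hence the squared radius is constant along orbits; on the sphere the extension agrees with
    [V]. *)
Lemma sphere_flow (V : 'rV[R]_m -> 'rV[R]_m) :
  (forall j, lipb S (fun w => V w 0 j)) -> (forall w, S w -> dot w (V w) = 0) ->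
  exists Phi : R -> 'rV[R]_m -> 'rV[R]_m,
    [/\ forall x, Phi 0 x = x,
      forall t x, S x -> S (Phi t x),
      forall x, S x -> solves V (Phi^~ x),
      forall s t x, Phi (s + t) x = Phi s (Phi t x) &
      forall t x (e : R), 0 < e -> exists2 d : R, 0 < d &
        forall s y, `|s - t| < d -> `|y - x| < d -> `|Phi s y - Phi t x| < e].
Proof.
move=> lV tV; pose X x := \row_j (eu x / r * V (proj x) 0 j).
have [L hL] := choice (fun j => homogeneous_extension_lipschitz (lV j)).
pose L' := \sum_j `|L j| + 1.
have L'1 : 1 <= L' by rewrite /L' lerDr sumr_ge0.
have XL x y : `|X x - X y| <= L' * `|x - y|.
  apply: row_norm_le => [|j].
    by rewrite mulr_ge0 // (le_trans ler01).
  rewrite !mxE; apply: le_trans (hL j x y) _; apply: ler_wpM2r => //.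
  rewrite /L' (bigD1 j) //=; have := ler_norm (L j).
  have : 0 <= \sum_(i < m | i != j) `|L i| by apply: sumr_ge0. 
  lra.
have [Phi [P0 PX Padd Pc]] := global_flow L'1 XL.
have XV w : S w -> X w = V w.
  move=> Sw; have ew : eu w = r by rewrite /eu Sw sqrtr_sqr gtr0_norm.
  by apply/rowP => j; rewrite mxE /proj ew divff ?gt_eqF // scale1r mul1r.
have tX x : dot x (X x) = 0.
  have [->|x0] := eqVneq x 0.
    by rewrite /dot big1 // => j _; rewrite mxE mul0r.
  have [Sx ex] := proj_sphere x0; have := tV _ Sx.
  rewrite -[X in dot _ X = _]scale1r dotZ mulr1 => /eqP.
  rewrite mulf_eq0 (gt_eqF (divr_gt0 r0 ex)) => /eqP h.
  have -> : X x = (eu x / r) *: V (proj x) by apply/rowP => j; rewrite !mxE.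
  by rewrite -[x in dot x _]scale1r dotZ h mulr0.
have PS t x : S x -> S (Phi t x).
  move=> Sx; have dd (s : R) : is_derive s 1 (fun s => dot (Phi s x) (Phi s x)) 0.
    have := is_derive_dot (PX x s) (PX x s).
    by rewrite (dotC (X _)) !tX addr0.
  have := @derive0_cst R (fun s => dot (Phi s x) (Phi s x)) (`|t| + 1) t (fun s _ => dd s).
  by rewrite ltrDl ltr01 => /(_ isT); rewrite /S /= P0 => ->.
exists Phi; split => //.
by move=> x Sx t j; rewrite -XV; [exact: PX|exact: PS].
Qed.

End SphereFlow.

(** * Flows that turn a product at unit speed *)

Section RotatingFlow.
Variables (R : realType) (m : nat) (r : R).
Hypothesis r0 : 0 < r.
Implicit Types (x y w : 'rV[R]_m).
Local Notation S := (@euclid_sphere R m r).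

Lemma linear_ode_solution (z alpha P : R -> R) :
  (forall t : R, is_derive t 1 P (alpha t)) -> P 0 = 0 ->
  (forall t : R, is_derive t 1 z (alpha t * z t)) -> forall t, z t = z 0 * expR (P t).
Proof.
move=> hP P0 hz t.
have dE (s : R) : is_derive s 1 (fun s => expR (- P s)) (- alpha s * expR (- P s)).
  have := is_derive1_comp (is_derive_expR _) (is_deriveN (hP s)).
  by move=> h; apply: is_derive_eq; rewrite mulrC.
have d0 (s : R) : `|s| < `|t| + 1 -> is_derive s 1 (fun s => z s * expR (- P s)) 0.
  move=> _; have := is_derive_mul (hz s) (dE s).
  by move=> h; apply: is_derive_eq; ring.
have := @derive0_cst R _ _ t d0; rewrite ltrDl ltr01 => /(_ isT).
rewrite P0 oppr0 expR0 mulr1 => <-.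
by rewrite expRN divfK // gt_eqF ?expR_gt0.
Qed.

(** The system says that [a + i b] has logarithmic derivative [alpha + i]. Undoing the rotation by
    the angle t leaves two real equations with coefficient [alpha]. *)
Lemma rotating_solution (a b alpha P : R -> R) :
  (forall t : R, is_derive t 1 P (alpha t)) -> P 0 = 0 ->
  (forall t : R, is_derive t 1 a (alpha t * a t - b t)) ->
  (forall t : R, is_derive t 1 b (alpha t * b t + a t)) ->
  forall t, a t = expR (P t) * (cos t * a 0 - sin t * b 0) /\
            b t = expR (P t) * (sin t * a 0 + cos t * b 0).
Proof.
move=> hP P0 ha hb t.
have d1 (s : R) : is_derive s 1 (fun s => a s * cos s + b s * sin s)
    (alpha s * (a s * cos s + b s * sin s)).
  have h := is_deriveD (is_derive_mul (ha s) (is_derive_cos s)) (is_derive_mul (hb s) (is_derive_sin s)).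
  by apply: (@is_derive_eq _ _ _ _ _ _ _ _ h); ring.
have d2 (s : R) : is_derive s 1 (fun s => b s * cos s - a s * sin s)
    (alpha s * (b s * cos s - a s * sin s)).
  have h := is_deriveB (is_derive_mul (hb s) (is_derive_cos s)) (is_derive_mul (ha s) (is_derive_sin s)).
  by apply: (@is_derive_eq _ _ _ _ _ _ _ _ h); ring.
have := linear_ode_solution hP P0 d1 t; have := linear_ode_solution hP P0 d2 t.
rewrite cos0 sin0 !mulr1 !mulr0 addr0 subr0 => e2 e1.
have cs : cos t ^+ 2 + sin t ^+ 2 = 1 :> R by rewrite cos2Dsin2.
split.
  rewrite -[LHS]mulr1 -cs; transitivity (cos t * (a t * cos t + b t * sin t)
    - sin t * (b t * cos t - a t * sin t)); first by ring.
  by rewrite e1 e2; ring.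
rewrite -[LHS]mulr1 -cs; transitivity (sin t * (a t * cos t + b t * sin t)
  + cos t * (b t * cos t - a t * sin t)); first by ring.
by rewrite e1 e2; ring.
Qed.

Variables (p1 p2 p3 p4 : 'rV[R]_m -> R) (G1 G2 G3 G4 : 'rV[R]_m -> 'rV[R]_m).

Definition gradient_on_sphere (p : 'rV[R]_m -> R) (G : 'rV[R]_m -> 'rV[R]_m) :=
  forall (u : R -> 'rV[R]_m) (du : 'rV[R]_m) (t : R), S (u t) ->
    (forall j, is_derive t 1 (fun t => u t 0 j) (du 0 j)) ->
    is_derive t 1 (fun t => p (u t)) (dot (G (u t)) du).

Hypotheses (lp1 : lipb S p1) (lp2 : lipb S p2) (lp3 : lipb S p3) (lp4 : lipb S p4).
Hypotheses (lG1 : forall j, lipb S (fun w => G1 w 0 j)) (lG2 : forall j, lipb S (fun w => G2 w 0 j))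
  (lG3 : forall j, lipb S (fun w => G3 w 0 j)) (lG4 : forall j, lipb S (fun w => G4 w 0 j)).
Hypotheses (hG1 : gradient_on_sphere p1 G1) (hG2 : gradient_on_sphere p2 G2)
  (hG3 : gradient_on_sphere p3 G3) (hG4 : gradient_on_sphere p4 G4).

(** The dual form of solvability. The multipliers belong to tangency to the sphere, to the real and
    imaginary parts of the equations for df and dg, and to the speed normalisation; the last four
    conditions are the coefficients of A1, A2, B1 and B2. *)
Hypothesis independent : forall w, S w -> forall c0 c1 c2 c3 c4 c5 : R,
  (forall i, c0 * w 0 i + c1 * G1 w 0 i + c2 * G2 w 0 i + c3 * G3 w 0 i + c4 * G4 w 0 i = 0) ->
  c1 * p1 w + c2 * p2 w = 0 -> c1 * p2 w - c2 * p1 w + c5 = 0 ->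
  c3 * p3 w + c4 * p4 w = 0 -> c3 * p4 w - c4 * p3 w - c5 = 0 ->
  [/\ c0 = 0, c1 = 0, c2 = 0, c3 = 0 & c4 = 0 /\ c5 = 0].

(** Columns are the six equations, rows the unknowns v, A1, A2, B1, B2. Entries missing at the end
    of a list take the default value 0; in particular v does not occur in the last equation. *)
Let T w : 'M[R]_(m + 4, 6) := col_mx
  (\matrix_(i < m, k < 6) nth 0 [:: w 0 i; G1 w 0 i; G2 w 0 i; G3 w 0 i; G4 w 0 i] k)
  (\matrix_(i < 4, k < 6) nth 0 (nth [::]
     [:: [:: 0; - p1 w; - p2 w];
         [:: 0; p2 w; - p1 w; 0; 0; 1];
         [:: 0; 0; 0; - p3 w; - p4 w];
         [:: 0; 0; 0; p4 w; - p3 w; - 1]] i) k).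

Let lipb_T : lipb_mx S T.
Proof.
have l0 := lipb_cst S (0 : R).
have lX (j : 'I_m) : lipb S (fun w => w 0 j).
  apply: locally_lipschitz_lipb; first exact: euclid_sphere_compact.
  by move=> p _; exists 1, 1; split => // x y _ _; rewrite mul1r row_coordB_le.
move=> i k; rewrite /T; case: (split_ordP i) => i1 ->.
  apply: (@lipb_eq _ _ _ (fun w => nth 0 [:: w 0 i1; G1 w 0 i1; G2 w 0 i1; G3 w 0 i1; G4 w 0 i1] k)).
    by move=> w _; rewrite col_mxEu mxE.
  by case: k => -[|[|[|[|[|[|k]]]]]] //=.
apply: (@lipb_eq _ _ _ (fun w => nth 0 (nth [::]
     [:: [:: 0; - p1 w; - p2 w];
         [:: 0; p2 w; - p1 w; 0; 0; 1];
         [:: 0; 0; 0; - p3 w; - p4 w];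
         [:: 0; 0; 0; p4 w; - p3 w; - 1]] i1) k)).
  by move=> w _; rewrite col_mxEd mxE.
have ln p := @lipbN R m S p.
case: i1 => -[|[|[|[|i1]]]] //= _; case: k => -[|[|[|[|[|[|k]]]]]] //= _;
  solve [exact: lipb_cst | exact: ln | done].
Qed.

(* A and B are the logarithmic derivatives of f and g along V, so that the phase
   of f * conj g grows at unit speed; the system stays regular where f or g is 0. *)
Lemma adapted_field : exists (V : 'rV[R]_m -> 'rV[R]_m) (A1 A2 B1 B2 : 'rV[R]_m -> R),
  [/\ forall j, lipb S (fun w => V w 0 j), lipb S A1, lipb S B1 &
   forall w, S w -> [/\ dot w (V w) = 0,
     dot (G1 w) (V w) = A1 w * p1 w - A2 w * p2 w /\
     dot (G2 w) (V w) = A1 w * p2 w + A2 w * p1 w,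
     dot (G3 w) (V w) = B1 w * p3 w - B2 w * p4 w /\
     dot (G4 w) (V w) = B1 w * p4 w + B2 w * p3 w &
     A2 w - B2 w = 1]].
Proof.
pose e : 'cV[R]_6 := \col_(i < 6) (i == 5 :> nat)%:R.
have [w Sw c Tc|x lx hx] := lipschitz_right_inverse (@euclid_sphere_compact R m r r0) e lipb_T.
  have s6 (F : 'I_6 -> R) : \sum_(i < 6) F i = F 0 + F 1 + F 2 + F 3 + F 4 + F 5.
    by rewrite !big_ord_recl big_ord0 addr0 !addrA; congr (_ + F _ + F _ + F _ + F _ + F _); exact: val_inj.
  have h1 i : (T w *m c) (lshift 4 i) 0 = 0 by rewrite Tc mxE.
  have h2 i : (T w *m c) (rshift m i) 0 = 0 by rewrite Tc mxE.
  have [||||| c0 c1 c2 c3 [c4 c5]] := independent Sw (c0 := c 0 0) (c1 := c 1 0) (c2 := c 2 0)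
    (c3 := c 3 0) (c4 := c 4 0) (c5 := c 5 0).
  - move=> i; have := h1 i; rewrite mxE s6 !col_mxEu !mxE /= => <-; ring.
  - have := h2 0; rewrite mxE s6 !col_mxEd !mxE /=; lra.
  - have := h2 1; rewrite mxE s6 !col_mxEd !mxE /=; lra.
  - have := h2 2; rewrite mxE s6 !col_mxEd !mxE /=; lra.
  - have := h2 3; rewrite mxE s6 !col_mxEd !mxE /=; lra.
  apply/matrixP => i j; rewrite ord1 [RHS]mxE; case: i => -[|[|[|[|[|[|i]]]]]] hi //;
   [rewrite -[RHS]c0|rewrite -[RHS]c1|rewrite -[RHS]c2|rewrite -[RHS]c3|rewrite -[RHS]c4|rewrite -[RHS]c5];
   by congr (c _ _); apply: val_inj.
exists (fun w => \row_j x w (lshift 4 j) 0), (fun w => x w (rshift m 0) 0),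
  (fun w => x w (rshift m 1) 0), (fun w => x w (rshift m 2) 0), (fun w => x w (rshift m 3) 0).
split; [|exact: lx|exact: lx|].
  by move=> j; apply: lipb_eq (lx (lshift 4 j) 0) => w _; rewrite mxE.
move=> w Sw; have /matrixP hw := hx w Sw.
have s4 (F : 'I_4 -> R) : \sum_(i < 4) F i = F 0 + F 1 + F 2 + F 3.
  by rewrite !big_ord_recl big_ord0 addr0 !addrA; congr (_ + F _ + F _ + F _); exact: val_inj.
have eq k : \sum_(j < m) T w (lshift 4 j) k * x w (lshift 4 j) 0 +
   (T w (rshift m 0) k * x w (rshift m 0) 0 + T w (rshift m 1) k * x w (rshift m 1) 0 +
    T w (rshift m 2) k * x w (rshift m 2) 0 + T w (rshift m 3) k * x w (rshift m 3) 0) =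
   (k == 5 :> nat)%:R.
  have e5 : e k 0 = (k == 5 :> nat)%:R by rewrite mxE.
  rewrite -e5 -(hw k 0) [RHS]mxE big_split_ord; congr (_ + _).
    by apply: eq_bigr => j _; rewrite [(T w)^T _ _]mxE.
  by rewrite s4 ![(T w)^T _ _]mxE.
have dE (v : 'rV[R]_m) k : (forall j, T w (lshift 4 j) k = v 0 j) ->
   dot v (\row_j x w (lshift 4 j) 0) = \sum_(j < m) T w (lshift 4 j) k * x w (lshift 4 j) 0.
  by move=> h; apply: eq_bigr => j _; rewrite mxE h.
split.
- rewrite (dE w 0); last by move=> j; rewrite /T col_mxEu mxE.
  by have := eq 0; rewrite {2 3 4 5}/T !col_mxEd !mxE /=; lra.
- split.
    rewrite (dE (G1 w) 1); last by move=> j; rewrite /T col_mxEu mxE.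
    by have := eq 1; rewrite {2 3 4 5}/T !col_mxEd !mxE /=; lra.
  rewrite (dE (G2 w) 2); last by move=> j; rewrite /T col_mxEu mxE.
  by have := eq 2; rewrite {2 3 4 5}/T !col_mxEd !mxE /=; lra.
- split.
    rewrite (dE (G3 w) 3); last by move=> j; rewrite /T col_mxEu mxE.
    by have := eq 3; rewrite {2 3 4 5}/T !col_mxEd !mxE /=; lra.
  rewrite (dE (G4 w) 4); last by move=> j; rewrite /T col_mxEu mxE.
  by have := eq 4; rewrite {2 3 4 5}/T !col_mxEd !mxE /=; lra.
have := eq 5; rewrite {2 3 4 5}/T !col_mxEd !mxE /= big1 => [|j _]; first by lra.
by rewrite /T col_mxEu mxE mul0r.
Qed.

Lemma lipb_path_continuous q (u : R -> 'rV[R]_m) : lipb S q -> (forall t, S (u t)) ->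
  coord_continuous_path u -> continuous (fun t => q (u t)).
Proof.
move=> [[L hL] _] Su cu t; apply/cvgrPdist_lt => e e0.
have L0 : 0 < `|L| + 1 by rewrite ltr_wpDl.
have e1 : 0 < e / 2 / (`|L| + 1) by rewrite !divr_gt0.
apply: filterS (coord_path_near t cu e1) => s hs.
apply: le_lt_trans (hL _ _ (Su t) (Su s)) _.
apply: (@le_lt_trans _ _ ((`|L| + 1) * `|u t - u s|)).
  by apply: ler_wpM2r => //; have := ler_norm L; lra.
apply: (@le_lt_trans _ _ (e / 2)); last by lra.
by rewrite mulrC -ler_pdivlMr.
Qed.

(** [a + i b] is [p1 + i p2] times the conjugate of [p3 + i p4]. Its logarithmic derivative along
    the field is [(A1 + B1) + i (A2 - B2)], with second part 1; [rho] is the exponential of a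
    primitive of [A1 + B1]. *)
Lemma rotating_flow : exists Phi : R -> 'rV[R]_m -> 'rV[R]_m,
  [/\ forall x, Phi 0 x = x,
      forall t x, S x -> S (Phi t x),
      forall s t x, Phi (s + t) x = Phi s (Phi t x),
      forall t x (e : R), 0 < e -> exists2 d : R, 0 < d &
        forall s y, `|s - t| < d -> `|y - x| < d -> `|Phi s y - Phi t x| < e &
      forall t x, S x -> exists2 rho : R, 0 < rho &
        let a y := p1 y * p3 y + p2 y * p4 y in let b y := p2 y * p3 y - p1 y * p4 y in
        a (Phi t x) = rho * (cos t * a x - sin t * b x) /\
        b (Phi t x) = rho * (sin t * a x + cos t * b x)].
Proof.
have [V [A1 [A2 [B1 [B2 [lV lA lB hV]]]]]] := adapted_field.
have [w Sw|Phi [P0 PS PV Padd Pc]] := sphere_flow r0 lV.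
  by have [] := hV w Sw.
exists Phi; split => // t x Sx.
have Su s : S (Phi s x) by exact: PS.
have cu : coord_continuous_path (Phi^~ x) by exact: derive_path_continuous (PV x Sx).
have [P [P00 hP]] := primitive (lipb_path_continuous (lipbD lA lB) Su cu).
exists (expR (P t)); first exact: expR_gt0.
move=> a b.
have d1 s := hG1 (Su s) (PV x Sx s); have d2 s := hG2 (Su s) (PV x Sx s).
have d3 s := hG3 (Su s) (PV x Sx s); have d4 s := hG4 (Su s) (PV x Sx s).
have := @rotating_solution (fun s => a (Phi s x)) (fun s => b (Phi s x)) _ P hP P00 _ _ t.
rewrite P0; apply => s; have [_ [e1 e2] [e3 e4] e5] := hV _ (Su s).
  have := is_deriveD (is_derive_mul (d1 s) (d3 s)) (is_derive_mul (d2 s) (d4 s)).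
  rewrite e1 e2 e3 e4 /a /b => h; apply: is_derive_eq.
  rewrite (_ : A2 _ = 1 + B2 (Phi s x)); [ring|lra].
have := is_deriveB (is_derive_mul (d2 s) (d3 s)) (is_derive_mul (d1 s) (d4 s)).
rewrite e1 e2 e3 e4 /a /b => h; apply: is_derive_eq.
rewrite (_ : A2 _ = 1 + B2 (Phi s x)); [ring|lra].
Qed.

End RotatingFlow.

(** * Real coordinates and critical points *)

Section RealCoordinates.
Variables (R : realType) (n : nat).
Local Notation C := (complexField R).
Implicit Types (z v : 'rV[C]_n) (w x : 'rV[R]_(n + n)) (F : 'rV[C]_n -> C).

Lemma of_realK w : to_real (of_real w) = w.
Proof.
apply/rowP => j; case: (split_ordP j) => k ->.
  by rewrite row_mxEl !mxE.
by rewrite row_mxEr !mxE.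
Qed.

Lemma to_realK z : of_real (to_real z) = z.
Proof. by apply/rowP => j; rewrite mxE row_mxEl row_mxEr !mxE; case: (z 0 j). Qed.

Lemma of_realD w x : of_real (w + x) = of_real w + of_real x.
Proof. by apply/rowP => j; rewrite !mxE. Qed.

Lemma of_realB w x : of_real (w - x) = of_real w - of_real x.
Proof. by apply/rowP => j; rewrite !mxE. Qed.

Lemma to_realD z v : to_real (z + v) = to_real z + to_real v.
Proof. by rewrite -[RHS]of_realK of_realD !to_realK. Qed.

Lemma to_realZ (c : R) z : to_real (c%:C%C *: z) = c *: to_real z.
Proof.
apply/rowP => j; case: (split_ordP j) => k ->.
  by rewrite [RHS]mxE !row_mxEl !mxE; case: (z 0 k) => a b /=; ring.
by rewrite [RHS]mxE !row_mxEr !mxE; case: (z 0 k) => a b /=; ring.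
Qed.

Lemma dot_to_real z v : dot (to_real z) (to_real v) =
  \sum_j (complex.Re (z 0 j) * complex.Re (v 0 j) + complex.Im (z 0 j) * complex.Im (v 0 j)).
Proof.
rewrite /dot big_split_ord big_split /=; congr (_ + _); apply: eq_bigr => j _.
  by rewrite !row_mxEl !mxE.
by rewrite !row_mxEr !mxE.
Qed.

Lemma tangent_sphereE z v : tangent_sphere z v <-> dot (to_real z) (to_real v) = 0.
Proof.
rewrite /tangent_sphere /=.
have -> : dot (to_real z) (to_real v) = (to_real z *m (to_real v)^T) 0 0.
  by rewrite [RHS]mxE; apply: eq_bigr => j _; rewrite [(to_real v)^T _ _]mxE.
split=> [->|h]; first by rewrite mxE.
by apply/matrixP => i j; rewrite !ord1 h mxE.
Qed.

Lemma sum_sqr_norm z : \sum_(j < n) `|z 0 j| ^+ 2 = (dot (to_real z) (to_real z))%:C%C.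
Proof.
rewrite dot_to_real rmorph_sum; apply: eq_bigr => j _.
by rewrite normE -rmorphXn /= rnorm_sqr -!expr2.
Qed.

Lemma sphere_ofE (r : R) z : sphere_of r z <-> euclid_sphere r (to_real z).
Proof.
rewrite /sphere_of /= sum_sqr_norm; split=> [/complexI //|h]; by rewrite /euclid_sphere /= in h; rewrite h.
Qed.

Lemma closed_ball_ofE (r : R) z : closed_ball_of r z <-> dot (to_real z) (to_real z) <= r ^+ 2.
Proof. by rewrite /closed_ball_of /= sum_sqr_norm lecR. Qed.

Lemma imaginary_unit_neq0 : ('i%C : C) != 0.
Proof. by rewrite -rnorm_eq0 rnormE /= expr0n expr1n add0r sqrtr1 oner_eq0. Qed.

Lemma sphere_sub_ball (r s : R) : 0 <= r -> r <= s -> @sphere_of R n r `<=` closed_ball_of s.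
Proof.
move=> r0 rs z /sphere_ofE h; apply/closed_ball_ofE; rewrite h.
by apply: lerXn2r => //; rewrite nnegrE // (le_trans r0).
Qed.

Lemma rnorm_of_real w : rnorm (of_real w) <= 2 * `|w|.
Proof.
apply: rnorm_row_le => [|j]; first by rewrite mulr_ge0.
rewrite mxE; apply: le_trans (rnorm_le_ReIm _) _ => /=.
by have := row_coord_le w (lshift n j); have := row_coord_le w (rshift n j); lra.
Qed.

Lemma rnorm_le_dot z : rnorm z ^+ 2 <= dot (to_real z) (to_real z).
Proof.
rewrite -[leRHS]sqr_sqrtr ?dot_ge0 //; apply: lerXn2r; rewrite ?nnegrE ?rnorm_ge0 ?sqrtr_ge0 //.
apply: rnorm_row_le => [|j]; first exact: sqrtr_ge0.
rewrite rnormE ler_wsqrtr // dot_to_real (bigD1 j) //= !expr2 lerDl.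
by apply: sumr_ge0 => i _; rewrite addr_ge0 // -expr2 sqr_ge0.
Qed.

Lemma dot_to_real_neq0 z : z != 0 -> dot (to_real z) (to_real z) != 0.
Proof.
move=> z0; rewrite gt_eqF //; apply: lt_le_trans (rnorm_le_dot z).
by rewrite exprn_gt0 // rnorm_gt0.
Qed.

(** The real gradients of Re F and Im F, expressed through the complex partial derivatives by the
    Cauchy-Riemann equations. *)
Definition grad_re F z : 'rV[R]_(n + n) :=
  row_mx (\row_j complex.Re (partial F j z)) (\row_j - complex.Im (partial F j z)).
Definition grad_im F z : 'rV[R]_(n + n) :=
  row_mx (\row_j complex.Im (partial F j z)) (\row_j complex.Re (partial F j z)).

Lemma dot_grad_re F z v : dot (grad_re F z) (to_real v) = complex.Re ('d F z v).
Proof.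
rewrite (diff_partial F z v) raddf_sum /dot big_split_ord /= -big_split /=.
apply: eq_bigr => j _; rewrite !row_mxEl !row_mxEr !mxE.
by case: (partial F j z) (v 0 j) => [a b] [c d] /=; ring.
Qed.

Lemma dot_grad_im F z v : dot (grad_im F z) (to_real v) = complex.Im ('d F z v).
Proof.
rewrite (diff_partial F z v) raddf_sum /dot big_split_ord /= -big_split /=.
apply: eq_bigr => j _; rewrite !row_mxEl !row_mxEr !mxE.
by case: (partial F j z) (v 0 j) => [a b] [c d] /=; ring.
Qed.

Variable U : set 'rV[C]_n.

Lemma holomorphic_bounded_near F p : holomorphic_on U F -> U p ->
  exists M : R, 0 <= M /\ \forall z \near p, rnorm (F z) <= M.
Proof.
move=> hF Up; have [s [K [s0 K0 _ _ h]]] := holomorphic_taylor hF Up.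
pose B := \sum_j rnorm (partial F j p).
have B0 : 0 <= B by apply: sumr_ge0 => j _; exact: rnorm_ge0.
exists (rnorm (F p) + K * s ^+ 2 + s * B); split.
  by rewrite !addr_ge0 ?rnorm_ge0 // mulr_ge0 ?exprn_ge0 // ltW.
apply/rnorm_near; exists s => // z zs.
have pz : p + (z - p) = z by rewrite addrC subrK.
have := h p (z - p); rewrite subrr rnorm0 pz => /(_ (ltW s0) (ltW zs)) hz.
pose L := lin_form ((partial F)^~ p) (z - p).
have hL : rnorm L <= s * B.
  rewrite /B mulr_sumr; apply: le_trans (rnorm_sum _ _ _) _; apply: ler_sum => j _.
  rewrite rnormM; apply: ler_wpM2r; first exact: rnorm_ge0.
  by apply: le_trans (ltW zs); exact: rnorm_coord.
have -> : F z = F p + (F z - F p - L) + L by rewrite -[RHS]addrA subrK [RHS]addrC subrK.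
apply: le_trans (rnormD _ _) _; apply: lerD => //.
apply: le_trans (rnormD _ _) _; rewrite lerD2l; apply: le_trans hz _.
by apply: ler_wpM2l => //; apply: lerXn2r; rewrite ?nnegrE ?rnorm_ge0 ?(ltW s0) ?(ltW zs).
Qed.

Lemma holomorphic_locally_lipschitz F p : holomorphic_on U F -> U p ->
  exists s L : R, [/\ 0 < s, 0 <= L & forall z z', rnorm (z - p) < s -> rnorm (z' - p) < s ->
    rnorm (F z - F z') <= L * rnorm (z - z')].
Proof.
move=> hF Up; have [s [K [s0 K0 _ _ h]]] := holomorphic_taylor hF Up.
have hM j := holomorphic_bounded_near (holomorphic_partial j hF) Up.
have [M hMj] := choice hM.
have /rnorm_near[t t0 ht] : \forall z \near p, forall j : 'I_n, rnorm (partial F j z) <= M j.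
  exact: filter_forall (fun j => (hMj j).2).
pose B := \sum_j M j; have B0 : 0 <= B by apply: sumr_ge0 => j _; exact: (hMj j).1.
pose d := Num.min (s / 2) t; exists d, (K * s + B); split.
- by rewrite /d lt_min t0 divr_gt0.
- by rewrite addr_ge0 // mulr_ge0 // ltW.
move=> z z'; rewrite /d !lt_min => /andP[zs zt] /andP[z's z't].
have zz' : rnorm (z - z') <= s.
  have := rnormD (z - p) (p - z'); rewrite addrA subrK (rnormB p z'); lra.
have z's' : rnorm (z' - p) <= s by lra.
have z'z : z' + (z - z') = z by rewrite addrC subrK.
have hz := h z' (z - z') z's' zz'; rewrite z'z in hz.
pose L := lin_form ((partial F)^~ z') (z - z').
have hL : rnorm L <= B * rnorm (z - z').
  rewrite /B mulr_suml; apply: le_trans (rnorm_sum _ _ _) _; apply: ler_sum => j _.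
  rewrite rnormM mulrC; apply: ler_pM; rewrite ?rnorm_ge0 //; first exact: ht.
  exact: rnorm_coord.
have -> : F z - F z' = (F z - F z' - L) + L by rewrite subrK.
apply: le_trans (rnormD _ _) _; rewrite mulrDl; apply: lerD => //.
apply: le_trans hz _; rewrite expr2 mulrA; apply: ler_wpM2r; first exact: rnorm_ge0.
exact: ler_wpM2l.
Qed.

Lemma lipb_holomorphic (S : set 'rV[R]_(n + n)) F : holomorphic_on U F -> compact S ->
  (forall w, S w -> U (of_real w)) ->
  lipb S (fun w => complex.Re (F (of_real w))) /\ lipb S (fun w => complex.Im (F (of_real w))).
Proof.
move=> hF cS SU.
have key w : S w -> exists s L : R, 0 < s /\ forall x y, `|x - w| < s -> `|y - w| < s ->
    rnorm (F (of_real x) - F (of_real y)) <= L * `|x - y|.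
  move=> /SU/(holomorphic_locally_lipschitz hF)[s [L [s0 L0 h]]].
  exists (s / 2), (L * 2); split=> [|x y xs ys]; first exact: divr_gt0.
  have cl x' : `|x' - w| < s / 2 -> rnorm (of_real x' - of_real w) < s.
    by move=> x's; rewrite -of_realB; apply: le_lt_trans (rnorm_of_real _) _; lra.
  apply: le_trans (h _ _ (cl _ xs) (cl _ ys)) _; rewrite -mulrA; apply: ler_wpM2l => //.
  by rewrite -of_realB rnorm_of_real.
split; apply: locally_lipschitz_lipb => // w Sw; have [s [L [s0 h]]] := key w Sw;
  exists s, L; split => // x y xs ys; apply: le_trans (h x y xs ys).
  by rewrite -raddfB Re_le_rnorm.
by rewrite -raddfB Im_le_rnorm.
Qed.

Lemma is_diff_grad F w : holomorphic_on U F -> U (of_real w) ->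
  is_diff w (fun x => complex.Re (F (of_real x)) : R^o) (dot (grad_re F (of_real w))) /\
  is_diff w (fun x => complex.Im (F (of_real x)) : R^o) (dot (grad_im F (of_real w))).
Proof.
move=> hF Uw; have [s [K [s0 K0 _ dF h]]] := holomorphic_taylor hF Uw.
(* The factor 4 is the square of the constant 2 of [rnorm_of_real]. *)
have hn : \forall k \near (0 : 'rV[R]_(n + n)), rnorm (F (of_real (w + k)) - F (of_real w) - 'd F (of_real w) (of_real k))
     <= 4 * K * `|k| ^+ 2.
  have s2 : 0 < s / 2 by lra.
  apply/nbhs_ballP; exists (s / 2) => //= k; rewrite -ball_normE /= sub0r normrN => ks.
  have ks' : rnorm (of_real k) <= 2 * `|k| by exact: rnorm_of_real.
  have := h (of_real w) (of_real k); rewrite subrr rnorm0 -of_realD dF.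
  move=> /(_ (ltW s0)) hk; apply: le_trans (hk _) _; first by lra.
  rewrite (mulrC 4) -mulrA; apply: ler_wpM2l => //.
  have -> : 4 * `|k| ^+ 2 = (2 * `|k|) ^+ 2 by ring.
  by apply: lerXn2r; rewrite ?nnegrE ?rnorm_ge0 ?mulr_ge0.
have K4 : 0 <= 4 * K by lra.
have key (G : 'rV[R]_(n + n)) (phi : 'rV[R]_(n + n) -> R) :
  (\forall k \near (0 : 'rV[R]_(n + n)), `|phi (w + k) - phi w - dot G k| <= 4 * K * `|k| ^+ 2) ->
  is_diff w (phi : _ -> R^o) (dot G).
  move=> hk; have lE k : lin_form (G 0) k = dot G k.
    by apply: eq_bigr => j _; rewrite mulrC.
  have hk' : \forall k \near (0 : 'rV[R]_(n + n)),
      `|phi (w + k) - phi w - lin_form (G 0) k| <= 4 * K * `|k| ^+ 2.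
    by apply: filterS hk => k; rewrite lE.
  have [d1 d2] := @quadratic_remainder_diff R _ R^o phi w (lin_form (G 0)) (4 * K)
    (@lin_form_continuous R _ (G 0)) K4 hk'.
  by split => //; rewrite d2; apply/funext => k; exact: lE.
split; apply: key; apply: filterS hn => k; apply: le_trans; rewrite -[k in dot _ k]of_realK.
  rewrite dot_grad_re; apply: le_trans (Re_le_rnorm _); by rewrite !raddfB.
rewrite dot_grad_im; apply: le_trans (Im_le_rnorm _); by rewrite !raddfB.
Qed.

End RealCoordinates.

(** * Real differentials of [H] and of its phase *)

Section Jacobians.
Variables (R : realType) (n : nat).
Local Notation C := (complexField R).
Implicit Types (z v : 'rV[C]_n) (w x : 'rV[R]_(n + n)) (F : 'rV[C]_n -> C).

Lemma is_diff_curve m (u : R -> 'rV[R]_m) (du : 'rV[R]_m) (phi : 'rV[R]_m -> R)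
    (dphi : 'rV[R]_m -> R) (t : R) :
  is_diff (u t) (phi : _ -> R^o) dphi ->
  (forall j, is_derive t 1 (fun t => u t 0 j) (du 0 j)) ->
  is_derive t 1 (fun t => phi (u t)) (dphi du).
Proof.
move=> hphi hu.
have du1 : derivable u t 1.
  by apply/derivable_mxP => i j; rewrite ord1; exact: (@ex_derive _ _ _ _ _ _ _ (hu j)).
have e : 'D_1 u t = du.
  rewrite derive_mx //; apply/rowP => j; rewrite mxE.
  exact: (@derive_val _ _ _ _ _ _ _ (hu j)).
have hd : is_diff t u (fun h => h *: du).
  split; first exact/derivable1_diffP.
  by apply/funext => h; rewrite diff1E ?derive1E ?e //; exact/derivable1_diffP.
have [d1 d2] := is_diff_comp hd hphi.
split; first exact/derivable1_diffP.
by rewrite deriveE // d2 /= scale1r.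
Qed.

Lemma is_diff_ext (V W : normedModType R) (x : V) (A A' B B' : V -> W) :
  is_diff x A B -> A =1 A' -> B =1 B' -> is_diff x A' B'.
Proof. by move=> h /funext <- /funext <-. Qed.

Section RealValued.
Variables (m : nat) (a b da db : 'rV[R]_m -> R) (x : 'rV[R]_m).
Hypotheses (ha : is_diff x (a : _ -> R^o) da) (hb : is_diff x (b : _ -> R^o) db).

Lemma is_diff_add : is_diff x (fun y => a y + b y : R^o) (fun y => da y + db y).
Proof. exact: is_diffD ha hb. Qed.

Lemma is_diff_sub : is_diff x (fun y => a y - b y : R^o) (fun y => da y - db y).
Proof. exact: is_diffB ha hb. Qed.

Lemma is_diff_mul : is_diff x (fun y => a y * b y : R^o) (fun y => a x * db y + b x * da y).
Proof. exact: is_diffM ha hb. Qed.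

End RealValued.

Lemma is_diff_row2 m (a b da db : 'rV[R]_m -> R) (x : 'rV[R]_m) :
  is_diff x (a : _ -> R^o) da -> is_diff x (b : _ -> R^o) db ->
  is_diff x (fun y => \row_(k < 2) if k == 0 then a y else b y)
    (fun y => \row_(k < 2) if k == 0 then da y else db y).
Proof.
move=> ha hb; pose e k : 'rV[R]_2 := delta_mx 0 k.
have rowE (p q : R) : p *: e 0 + q *: e 1 = \row_(k < 2) if k == 0 then p else q.
  apply/rowP => k; rewrite !mxE eqxx /=.
  by case: k => -[|[|k]] //= ?; rewrite ?mulr1 ?mulr0 ?addr0 ?add0r.
have h := is_diffD (is_diff_comp ha (is_diff_scalel (a x) (e 0)))
  (is_diff_comp hb (is_diff_scalel (b x) (e 1))).
by apply: (is_diff_ext h) => y; rewrite -rowE.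
Qed.

Lemma is_diff_inv_sqrt m (q dq : 'rV[R]_m -> R) (x : 'rV[R]_m) : 0 < q x ->
  is_diff x (q : _ -> R^o) dq ->
  is_diff x (fun y => (Num.sqrt (q y))^-1 : R^o)
    (fun y => - (2 * Num.sqrt (q x) ^+ 3)^-1 * dq y).
Proof.
move=> q0 hq; have s0 : Num.sqrt (q x) != 0 by rewrite gt_eqF ?sqrtr_gt0.
have h1 := is_derive1_sqrt q0.
have h2 := @realfun.is_deriveV R Num.sqrt (q x) _ 1 s0 h1.
have hd : is_diff (q x) (fun t : R => (Num.sqrt t)^-1 : R^o)
   (fun h => - (2 * Num.sqrt (q x) ^+ 3)^-1 * h).
  split; first by apply/derivable1_diffP; exact: (@ex_derive _ _ _ _ _ _ _ h2).
  apply/funext => h; rewrite diff1E; last first.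
    by apply/derivable1_diffP; exact: (@ex_derive _ _ _ _ _ _ _ h2).
  rewrite derive1E (@derive_val _ _ _ _ _ _ _ h2) /GRing.scale /=; field.
  by rewrite s0.
exact: is_diff_comp hq hd.
Qed.

Lemma jacobian_is_diff m k (G dG : 'rV[R]_m -> 'rV[R]_k) (x v : 'rV[R]_m) :
  is_diff x G dG -> v *m 'J G x = dG v.
Proof. by case=> _ h; rewrite /jacobian mul_rV_lin1 h. Qed.

Let Re_mul_conjc (x y : C) : complex.Re x * complex.Re y + complex.Im x * complex.Im y =
  complex.Re (x * conjc y).
Proof. by case: x y => [p q] [p' q'] /=; ring. Qed.

Let Im_mul_conjc (x y : C) : complex.Im x * complex.Re y - complex.Re x * complex.Im y =
  complex.Im (x * conjc y).
Proof. by case: x y => [p q] [p' q'] /=; ring. Qed.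

Let Re_dmul_conjc (x y dx dy : C) :
  complex.Re x * complex.Re dy + complex.Re y * complex.Re dx
  + (complex.Im x * complex.Im dy + complex.Im y * complex.Im dx) =
  complex.Re (dx * conjc y + x * conjc dy).
Proof. by case: x y dx dy => [p q] [p' q'] [r s] [r' s'] /=; ring. Qed.

Let Im_dmul_conjc (x y dx dy : C) :
  complex.Im x * complex.Re dy + complex.Re y * complex.Im dx
  - (complex.Re x * complex.Im dy + complex.Im y * complex.Re dx) =
  complex.Im (dx * conjc y + x * conjc dy).
Proof. by case: x y dx dy => [p q] [p' q'] [r s] [r' s'] /=; ring. Qed.

(** Conjugating [y] changes the sign of the imaginary part of [dy / y]; the right-hand side is the
    imaginary part of dH / H for [H = x * conjc y], written in real coordinates. *)
Let Im_log_derivative (x y dx dy : C) : x != 0 -> y != 0 ->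
  complex.Im (dx / x - dy / y) = (complex.Re (x * conjc y) * complex.Im (dx * conjc y + x * conjc dy)
    - complex.Im (x * conjc y) * complex.Re (dx * conjc y + x * conjc dy)) / rnorm (x * conjc y) ^+ 2.
Proof.
have nz (p q : R) : (p +i* q)%C != 0 -> p ^+ 2 + q ^+ 2 != 0.
  apply: contra_neq => /eqP; rewrite paddr_eq0 ?sqr_ge0 // !sqrf_eq0.
  by move=> /andP[/eqP -> /eqP ->].
rewrite rnorm_sqr; case: x y dx dy => [p q] [p' q'] [r s] [r' s'] /nz xn /nz yn /=.
field; rewrite xn yn /=.
have -> : (p * p' - q * - q') ^+ 2 + (p * - q' + q * p') ^+ 2 = (p ^+ 2 + q ^+ 2) * (p' ^+ 2 + q' ^+ 2).
  by ring.
by rewrite mulf_neq0.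
Qed.

(** The derivative of the unit vector (a, b) / N is its rotation by a right angle times the
    derivative of its angle. *)
Let unit_derivative (a b da db N : R) : N != 0 -> N ^+ 2 = a ^+ 2 + b ^+ 2 ->
  a * (- (2 * N ^+ 3)^-1 * (2 * (a * da + b * db))) + N^-1 * da =
    (a * db - b * da) / N ^+ 2 * - (b * N^-1) /\
  b * (- (2 * N ^+ 3)^-1 * (2 * (a * da + b * db))) + N^-1 * db =
    (a * db - b * da) / N ^+ 2 * (a * N^-1).
Proof.
move=> N0 NE.
have e c : c / N = (a ^+ 2 + b ^+ 2) * c / N ^+ 3 by rewrite -NE; field.
by split; rewrite mulrC [N^-1 * _]mulrC e; field.
Qed.

Variables (U : set 'rV[C]_n) (f g : 'rV[C]_n -> C).
Hypotheses (hf : holomorphic_on U f) (hg : holomorphic_on U g).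

Let dmixed z v : C := 'd f z v * conjc (g z) + f z * conjc ('d g z v).

Lemma is_diff_mixed w : U (of_real w) ->
  is_diff w (fun x => complex.Re (mixed f g (of_real x)) : R^o)
    (fun x => complex.Re (dmixed (of_real w) (of_real x))) /\
  is_diff w (fun x => complex.Im (mixed f g (of_real x)) : R^o)
    (fun x => complex.Im (dmixed (of_real w) (of_real x))).
Proof.
move=> Uw.
have key F : holomorphic_on U F ->
  is_diff w (fun x => complex.Re (F (of_real x)) : R^o)
    (fun x => complex.Re ('d F (of_real w) (of_real x))) /\
  is_diff w (fun x => complex.Im (F (of_real x)) : R^o)
    (fun x => complex.Im ('d F (of_real w) (of_real x))).
  move=> hF; have [h1 h2] := is_diff_grad hF Uw; split.
    apply: (is_diff_ext h1 (frefl _)) => y.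
    by rewrite -[y in LHS]of_realK dot_grad_re.
  apply: (is_diff_ext h2 (frefl _)) => y.
  by rewrite -[y in LHS]of_realK dot_grad_im.
have [h1 h2] := key f hf; have [h3 h4] := key g hg.
split.
  apply: (is_diff_ext (is_diff_add (is_diff_mul h1 h3) (is_diff_mul h2 h4))) => x.
    exact: Re_mul_conjc.
  exact: Re_dmul_conjc.
apply: (is_diff_ext (is_diff_sub (is_diff_mul h2 h3) (is_diff_mul h1 h4))) => x.
  exact: Im_mul_conjc.
exact: Im_dmul_conjc.
Qed.

Lemma mixed_jacobian z v : U z ->
  to_real v *m real_jacobian (mixed f g) z = reim (dmixed z v).
Proof.
rewrite -{1}(to_realK z) => /is_diff_mixed[h1 h2].
by rewrite /real_jacobian (jacobian_is_diff _ (is_diff_row2 h1 h2)) !to_realK.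
Qed.

Lemma mixed_eq0 z : (mixed f g z == 0) = (f z == 0) || (g z == 0).
Proof. by rewrite /mixed mulf_eq0 conjc_eq0. Qed.

(* d(H/|H|) = i Im(dH/H) H/|H|, and Im(dH/H) = Im(df/f - dg/g). *)
Lemma milnor_jacobian z v : U z -> f z != 0 -> g z != 0 ->
  to_real v *m real_jacobian (milnor_map f g) z =
  complex.Im ('d f z v / f z - 'd g z v / g z) *: reim ('i%C * milnor_map f g z).
Proof.
move=> Uz f0 g0.
have H0 : mixed f g z != 0 by rewrite mixed_eq0 negb_or f0.
have := Uz; rewrite -{1}(to_realK z) => /is_diff_mixed[h1 h2].
pose a x : R := complex.Re (mixed f g (of_real x)).
pose b x : R := complex.Im (mixed f g (of_real x)).
pose q x := a x ^+ 2 + b x ^+ 2.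
have qE x : Num.sqrt (q x) = rnorm (mixed f g (of_real x)) by rewrite rnormE.
have q0 : 0 < q (to_real z).
  by rewrite -sqrtr_gt0 qE to_realK rnorm_gt0.
have hq := is_diff_add (is_diff_mul h1 h1) (is_diff_mul h2 h2).
have {}hq : is_diff (to_real z) (q : _ -> R^o)
    (fun w => 2 * (a (to_real z) * complex.Re (dmixed (of_real (to_real z)) (of_real w))
                  + b (to_real z) * complex.Im (dmixed (of_real (to_real z)) (of_real w)))).
  apply: (is_diff_ext hq) => [x|w]; first by rewrite /q !expr2.
  by rewrite /=; ring.
have hs := is_diff_inv_sqrt q0 hq.
have := is_diff_row2 (is_diff_mul h1 hs) (is_diff_mul h2 hs) => h.
have milnorE w : \row_(k < 2) (if k == 0 then a w * (Num.sqrt (q w))^-1 else b w * (Num.sqrt (q w))^-1)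
   = reim (milnor_map f g (of_real w)).
  apply/rowP => k; rewrite !mxE qE /milnor_map normE -fmorphV /a /b.
  by case: (mixed _ _ _) (rnorm _)^-1 => c d e; case: k => -[|[|k]] //= _; ring.
have {}h := is_diff_ext h milnorE (frefl _).
rewrite /real_jacobian (jacobian_is_diff _ h) Im_log_derivative //.
have N0 : Num.sqrt (q (to_real z)) != 0 by rewrite gt_eqF ?sqrtr_gt0.
have NE : Num.sqrt (q (to_real z)) ^+ 2 = a (to_real z) ^+ 2 + b (to_real z) ^+ 2.
  by rewrite sqr_sqrtr // ltW.
have mE := milnorE (to_real z); rewrite to_realK in mE.
have aE : a (to_real z) = complex.Re (f z * conjc (g z)) by rewrite /a to_realK.
have bE : b (to_real z) = complex.Im (f z * conjc (g z)) by rewrite /b to_realK.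
have rN : rnorm (f z * conjc (g z)) = Num.sqrt (q (to_real z)) by rewrite qE to_realK.
rewrite -aE -bE rN.
pose d := dmixed z v.
have [e1 e2] := unit_derivative (complex.Re d) (complex.Im d) N0 NE.
have m1 : complex.Re (milnor_map f g z) = a (to_real z) * (Num.sqrt (q (to_real z)))^-1.
  by have /rowP/(_ 0) := mE; rewrite !mxE.
have m2 : complex.Im (milnor_map f g z) = b (to_real z) * (Num.sqrt (q (to_real z)))^-1.
  by have /rowP/(_ 1) := mE; rewrite !mxE.
have im (y : C) : complex.Re ('i%C * y) = - complex.Im y /\ complex.Im ('i%C * y) = complex.Re y.
  by case: y => y1 y2 /=; split; ring.
apply/rowP => k; rewrite !mxE (im _).1 (im _).2 m1 m2.
have -> : dmixed (of_real (to_real z)) (of_real (to_real v)) = d by rewrite !to_realK.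
by case: ifP => _; [exact: e1|exact: e2].
Qed.

End Jacobians.

Fact split_forms_field (K : fieldType) (x y i c t a b p q : K) :
  (i * c * a + t * p) / x - (i * c * b + t * q) / y = i * (c * (a / x - b / y)) + t * (p / x - q / y).
Proof. by ring. Qed.

Fact proportional_forms_field (K : fieldType) (k k' x y x' y' a b : K) :
  x != 0 -> y != 0 -> k * (x * y') != 0 ->
  a / x - - (k' * (x' * y) / (k * (x * y'))) * (b / y) = (k * y' * a + k' * x' * b) / (k * (x * y')).
Proof.
move=> x0 y0; rewrite !mulf_eq0 !negb_or => /and3P[k0 _ y'0].
by field; rewrite y'0 k0 y0 x0.
Qed.

Lemma dotDr (R : realType) m (w x y : 'rV[R]_m) : dot w (x + y) = dot w x + dot w y.
Proof. by rewrite /dot -big_split; apply: eq_bigr => j _; rewrite mxE mulrDr. Qed.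

(** * Critical points in terms of complex gradients *)

Section Criticality.
Variables (R : realType) (n : nat).
Local Notation C := (complexField R).
Variables (U : set 'rV[C]_n) (f g : 'rV[C]_n -> C).
Hypotheses (hf : holomorphic_on U f) (hg : holomorphic_on U g).
Implicit Types (z v : 'rV[C]_n).

(** The derivative in direction [v] of the argument of [H], that is, of phi. *)
Definition log_arg_diff z v : R := complex.Im ('d f z v / f z - 'd g z v / g z).

Lemma rnorm_conjc (x : C) : rnorm (conjc x) = rnorm x.
Proof. by rewrite !rnormE; case: x => a b /=; rewrite sqrrN. Qed.

Lemma rnorm_milnor z : mixed f g z != 0 -> rnorm (milnor_map f g z) = 1.
Proof.
move=> H0; rewrite /milnor_map normE -[_ / _]/(mixed f g z * _) rnormM rnormV rnorm_real.
by rewrite ger0_norm ?rnorm_ge0 // divff // rnorm_eq0.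
Qed.

Lemma tangent_circleE (c : C) (u : 'rV[R]_2) : rnorm c = 1 -> tangent_circle c u ->
  exists s, u = s *: reim ('i%C * c).
Proof.
move=> c1; rewrite /tangent_circle /= => /matrixP/(_ 0 0).
rewrite !mxE !big_ord_recl big_ord0 !mxE /= addr0 => h.
have := rnorm_sqr c; rewrite c1 expr1n.
exists (- complex.Im c * u 0 0 + complex.Re c * u 0 1).
have e1 : lift ord0 ord0 = 1 :> 'I_2 by exact: val_inj.
rewrite e1 in h.
apply/rowP => k; rewrite !mxE.
have -> : complex.Re ('i%C * c) = - complex.Im c by case: (c) => p q /=; ring.
have -> : complex.Im ('i%C * c) = complex.Re c by case: (c) => p q /=; ring.
case: k => -[|[|k]] //= hk.
  have -> : Ordinal hk = 0 by exact: val_inj.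
  transitivity (1 * u 0 0); first by rewrite mul1r.
  rewrite H; transitivity ((complex.Re c ^+ 2 + complex.Im c ^+ 2) * u 0 0
    - complex.Re c * (complex.Re c * u 0 0 + complex.Im c * u 0 1)); last by ring.
  by rewrite h mulr0 subr0.
have -> : Ordinal hk = 1 by exact: val_inj.
transitivity (1 * u 0 1); first by rewrite mul1r.
rewrite H; transitivity ((complex.Re c ^+ 2 + complex.Im c ^+ 2) * u 0 1
    - complex.Im c * (complex.Re c * u 0 0 + complex.Im c * u 0 1)); last by ring.
by rewrite h mulr0 subr0.
Qed.

(** The tangent line of the circle has dimension 1, so surjectivity of the differential amounts to
    one real linear form being nonzero on the tangent space of the sphere; a preimage is obtained by
    rescaling. *)
Lemma noncritical_milnor z : U z -> f z != 0 -> g z != 0 ->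
  ~ critical_milnor f g z <-> exists2 v, tangent_sphere z v & log_arg_diff z v != 0.
Proof.
move=> Uz f0 g0; have H0 : mixed f g z != 0 by rewrite mixed_eq0 negb_or f0.
have c1 := rnorm_milnor H0; pose c := milnor_map f g z.
split.
  move=> /contrapT/(_ (reim ('i%C * c))) [|v tv hv].
    rewrite /tangent_circle /=; apply/matrixP => i j; rewrite !ord1 !mxE.
    rewrite !big_ord_recl big_ord0 !mxE /=; rewrite -/c.
    by case: (c) => p q /=; ring.
  exists v => //; apply/negP => /eqP lv.
  move: hv; rewrite (milnor_jacobian hf hg v Uz f0 g0) -/(log_arg_diff z v) lv scale0r => hv.
  have ic : rnorm ('i%C * c) = 1 by rewrite rnormM c1 mulr1 rnormE /= expr0n expr1n add0r sqrtr1.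
  have := rnorm_sqr ('i%C * c); rewrite ic.
  have /rowP/(_ 0) := hv; rewrite !mxE /= => ->.
  have /rowP/(_ 1) := hv; rewrite !mxE /= => ->.
  by rewrite expr1n expr0n addr0 => /eqP; rewrite oner_eq0.
move=> [v tv lv] cz; apply: cz => u tu.
have [s ->] := tangent_circleE c1 tu.
exists ((s / log_arg_diff z v)%:C%C *: v).
  apply/tangent_sphereE; rewrite to_realZ -[to_real z]scale1r dotZ.
  by move/tangent_sphereE: tv => ->; rewrite mulr0.
rewrite to_realZ -scalemxAl (milnor_jacobian hf hg v Uz f0 g0) -/(log_arg_diff z v).
by rewrite scalerA divfK.
Qed.

Let delta_diff F z (c : C) j : 'd F z (c *: delta_mx 0 j) = c * partial F j z.
Proof. by rewrite linearZ. Qed.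

Let real_forms (x y : C) : (forall c : C, complex.Re (c * x) = complex.Re (c * y)) -> x = y.
Proof.
move=> h; have := h 1; have := h ('i%C); case: x y {h} => [p q] [p' q'] /=.
by move=> h1 h2; congr (_ +i* _)%C; lra.
Qed.

Let split_forms (x y i c t a b p q : C) :
  (i * c * a + t * p) / x - (i * c * b + t * q) / y = i * (c * (a / x - b / y)) + t * (p / x - q / y).
Proof. by apply: split_forms_field. Qed.

Let proportional_forms (k k' x y x' y' a b : C) : x != 0 -> y != 0 -> k * (x * y') != 0 ->
  a / x - - (k' * (x' * y) / (k * (x * y'))) * (b / y) = (k * y' * a + k' * x' * b) / (k * (x * y')).
Proof. exact: proportional_forms_field. Qed.

(* On the tangent space of the sphere Im(df/f - dg/g) vanishes, so it is a
   multiple of the normal form v |-> Re <v, z>. *)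
Lemma critical_milnor_gradients z : U z -> z != 0 -> f z != 0 -> g z != 0 ->
  critical_milnor f g z -> exists lam : R, forall j,
    partial f j z / f z - partial g j z / g z = (0 +i* lam)%C * conjc (z 0 j).
Proof.
move=> Uz z0 f0 g0 cz; pose w := to_real z.
have l0 v : tangent_sphere z v -> log_arg_diff z v = 0.
  move=> tv; apply/eqP/negPn/negP => lv.
  by apply: (noncritical_milnor Uz f0 g0).2 cz; exists v.
have w0 : dot w w != 0 by exact: dot_to_real_neq0.
exists (log_arg_diff z z / dot w w) => j; apply: real_forms => c.
(* Since Im (i c x) = Re (c x), testing on the vectors i c e_j recovers the j-th complex component
   of the form. Subtracting [t] times [z] makes the test vector tangent. *)
pose v : 'rV[C]_n := ('i%C * c) *: delta_mx 0 j.
pose t := dot w (to_real v) / dot w w.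
have tv : tangent_sphere z (v + (- t)%:C%C *: z).
  apply/tangent_sphereE; rewrite to_realD to_realZ -/w.
  have -> : dot w (to_real v + - t *: w) = dot w (to_real v) - t * dot w w.
    by rewrite dotDr -[X in dot X (_ *: _)]scale1r dotZ; ring.
  by rewrite /t divfK // subrr.
have lin F : 'd F z (v + (- t)%:C%C *: z) = 'i%C * c * partial F j z + (- t)%:C%C * 'd F z z.
  by rewrite linearD linearZ linearZ.
have h := etrans (esym (f_equal2 (fun a b : C => complex.Im (a / f z - b / g z)) (lin f) (lin g)))
  (l0 _ tv).
have dv : dot w (to_real v) = - complex.Im (c * conjc (z 0 j)).
  rewrite dot_to_real (bigD1 j) //= big1 ?addr0 => [|i ij].
    have -> : v 0 j = 'i%C * c by rewrite !mxE !eqxx mulr1.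
    by case: (c) (z 0 j) => [p q] [p' q'] /=; ring.
  have -> : v 0 i = 0 by rewrite !mxE (negbTE ij) andbF mulr0.
  by rewrite !mulr0 addr0.
have {}h := etrans (esym (congr1 (@complex.Im R) (split_forms _ _ _ _ _ _ _ _ _))) h.
move: h; rewrite /t dv /log_arg_diff.
move: (dot w w) w0 (_ - 'd g z z / g z) (_ - partial g j z / g z) (conjc (z 0 j)).
move=> D D0 [p q] [p' q'] [r s]; case: (c) => [c1 c2] /=.
move=> h; apply/eqP; rewrite -subr_eq0 -[X in _ == X]h; apply/eqP; field.
exact: D0.
Qed.

(** A rank below 2 yields a nonzero [k] with Re (conj k dH) = 0. Conjugating the antilinear part
    turns this into the vanishing of [X], a combination of the two gradients. The resulting [mu] is,
    up to sign, a number divided by its conjugate, hence has modulus 1. *)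
Lemma critical_mixed_gradients z : U z -> f z != 0 -> g z != 0 ->
  critical_mixed f g z -> exists2 mu : C, rnorm mu = 1 & forall j,
    partial f j z / f z - mu * (partial g j z / g z) = 0.
Proof.
move=> Uz f0 g0; rewrite /critical_mixed; set J := real_jacobian _ _ => rJ.
have : kermx J^T != 0.
  by rewrite kermx_eq0 /row_free mxrank_tr; apply/negP => /eqP e; rewrite e in rJ.
move=> /rowV0Pn[u /sub_kermxP uJ u0].
have Ju : J *m u^T = 0 by apply: trmx_inj; rewrite trmx_mul trmxK uJ trmx0.
pose k : C := (u 0 0 +i* u 0 1)%C.
have k0 : k != 0.
  apply: contra u0 => /eqP[e1 e2]; apply/eqP/rowP => i; rewrite mxE.
  by case: i => -[|[|i]] //= hi; [rewrite -[RHS]e1|rewrite -[RHS]e2]; congr (u _ _); exact: val_inj.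
pose eta := conjc k * (f z * conjc (g z)).
have eta0 : eta != 0 by rewrite !mulf_neq0 // conjc_eq0.
exists (- (k * (conjc (f z) * g z) / eta)).
  rewrite rnormN rnormM rnormV (_ : rnorm (k * _) = rnorm eta) ?divff ?rnorm_eq0 //.
  by rewrite /eta !rnormM !rnorm_conjc.
move=> j; pose X := conjc k * conjc (g z) * partial f j z + k * conjc (f z) * partial g j z.
have X0 : X = 0.
  apply: real_forms => c; rewrite mulr0.
  have := etrans (mixed_jacobian hf hg (c *: delta_mx 0 j) Uz)
    (f_equal2 (fun a b : C => reim (a * conjc (g z) + f z * conjc b))
      (delta_diff f z c j) (delta_diff g z c j)).
  rewrite -/J => /(congr1 (fun A : 'rV[R]_2 => (A *m u^T) 0 0)).
  rewrite -mulmxA Ju mulmx0 mxE => /esym.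
  rewrite mxE !big_ord_recl big_ord0 !mxE /= addr0 (_ : lift ord0 ord0 = 1); last exact: val_inj.
  rewrite /X /k; move: (partial f j z) (partial g j z) (f z) (g z) (u 0 0) (u 0 1) (c).
  by move=> [a b] [a' b'] [p q] [p' q'] r s [c1 c2] /= <-; ring.
refine (etrans (proportional_forms _ _ _ _ f0 g0 eta0) _).
exact: etrans (congr1 (fun x => x / eta) X0) (mul0r _).
Qed.

(** [zero_only_critical_value] is an equality of sets, so the value 0 must be attained at a critical
    point; at the origin both terms of dH vanish. *)
Lemma real_jacobian_mixed0 : U 0 -> f 0 = 0 -> g 0 = 0 -> critical_mixed f g 0.
Proof.
move=> U0 f0 g0; rewrite /critical_mixed (_ : real_jacobian _ _ = 0) ?mxrank0 //.
apply/row_matrixP => i; rewrite rowE row0 -(of_realK (delta_mx 0 i)).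
rewrite (mixed_jacobian hf hg _ U0) f0 g0 mul0r conjc0 mulr0 addr0.
by apply/rowP => l; rewrite !mxE; case: ifP.
Qed.

End Criticality.

(** * Radii without critical points *)

Section RegularRadii.
Variables (R : realType) (n : nat).
Local Notation C := (complexField R).
Variables (U : set 'rV[C]_n) (f g : 'rV[C]_n -> C).
Hypotheses (hf : holomorphic_on U f) (hg : holomorphic_on U g).

Lemma rnorm_in_ball (r : R) (z : 'rV[C]_n) : 0 <= r -> closed_ball_of r z -> rnorm z <= r.
Proof.
move=> r0 /closed_ball_ofE h; rewrite -(@ler_pXn2r _ 2) ?nnegrE ?rnorm_ge0 //.
exact: le_trans (rnorm_le_dot z) h.
Qed.

Lemma closed_ball_of_sub (r s : R) : 0 <= r -> r <= s ->
  @closed_ball_of R n r `<=` closed_ball_of s.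
Proof.
move=> r0 rs z /closed_ball_ofE h; apply/closed_ball_ofE; apply: le_trans h _.
by apply: lerXn2r => //; rewrite nnegrE // (le_trans r0).
Qed.

Lemma sphere_of_neq0 (r : R) (z : 'rV[C]_n) : 0 < r -> sphere_of r z -> z != 0.
Proof.
move=> r0 /sphere_ofE zr; apply/negP => /eqP z0; move: zr.
rewrite /euclid_sphere /= z0 dot_to_real big1 => [|j _]; last by rewrite !mxE /= !mul0r addr0.
by move/esym/eqP; rewrite sqrf_eq0 gt_eqF.
Qed.

Let mul_conjc_self (x : C) : x * conjc x = (rnorm x ^+ 2)%:C%C.
Proof. by rewrite rnorm_sqr; case: x => a b; congr (_ +i* _)%C => /=; ring. Qed.

Let scale_gradients (x a b p q c d : C) : a / p - b / q = c * d ->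
  x * a / p - 1 * (x * b / q) = c * (x * d).
Proof.
by move=> h; rewrite mul1r -!mulrA -mulrBr h mulrCA.
Qed.

Let scale_gradients0 (x a b p q mu : C) : a / p - mu * (b / q) = 0 ->
  x * a / p - mu * (x * b / q) = 0.
Proof. by move=> h; rewrite -[x * a / p]mulrA -[x * b / q]mulrA (mulrCA mu) -mulrBr h mulr0. Qed.

(** Multiplying the gradient relations by [z_j] turns the conjugate of [z_j] into [|z_j| ^ 2], the
    form excluded by [newton_no_proportional_gradients]. One radius serves both conclusions. *)
Lemma regular_radii (a b : multi_index n -> C) (r0 : R) : f 0 = 0 -> g 0 = 0 ->
  has_power_series f 0 a -> has_power_series g 0 b -> convenient a -> convenient b ->
  non_degenerate a -> non_degenerate b -> non_degenerate_complete_intersection a b ->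
  newton_multiplicity_condition a b -> 0 < r0 -> closed_ball_of r0 `<=` U -> U 0 ->
  exists r : R, [/\ 0 < r, r <= r0, no_critical_points_upto U f g r &
    zero_only_critical_value f g r].
Proof.
move=> f0 g0 fa gb ca cb na nb ci mult r00 BU U0.
have [eps eps0 he] := newton_no_proportional_gradients f0 fa gb ca cb na nb ci mult.
pose r := Num.min (eps / 2) r0.
have rpos : 0 < r by rewrite /r lt_min r00 divr_gt0.
have rr0 : r <= r0 by rewrite /r ge_min lexx orbT.
have req : r < eps by rewrite /r gt_min; apply/orP; left; lra.
have BrU : closed_ball_of r `<=` U.
  by move=> z /(closed_ball_of_sub (ltW rpos) rr0); exact: BU.
exists r; split => //.
  split=> // s /andP[s0 sr] z [zs zH].
  have H0 : mixed f g z != 0.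
    by apply/negP => /eqP H0; apply: zH.
  have [fz gz] : f z != 0 /\ g z != 0.
    by move: H0; rewrite mixed_eq0 negb_or => /andP.
  have zB : closed_ball_of r z by exact: sphere_sub_ball (ltW s0) sr _ zs.
  have ze : rnorm z < eps by apply: le_lt_trans req; exact: rnorm_in_ball (ltW rpos) zB.
  move=> /(critical_milnor_gradients hf hg (BrU _ zB) (sphere_of_neq0 s0 zs) fz gz)[lam hl].
  apply: (he z ze fz gz 1 lam (rnorm1 R)); first by left.
  by move=> j; rewrite (scale_gradients (z 0 j) (hl j)) mul_conjc_self.
rewrite /zero_only_critical_value; apply/seteqP; split => [_ [z [zB cz] <-] /=|c -> /=]; last first.
  exists 0; last by rewrite /mixed f0 mul0r.
  split; last exact: (real_jacobian_mixed0 hf hg).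
  apply/closed_ball_ofE; rewrite dot_to_real big1 ?sqr_ge0 // => j _.
  by rewrite !mxE /= !mul0r addr0.
apply/eqP/negPn/negP => H0.
have [fz gz] : f z != 0 /\ g z != 0 by move: H0; rewrite mixed_eq0 negb_or => /andP.
have ze : rnorm z < eps by apply: le_lt_trans req; exact: rnorm_in_ball (ltW rpos) zB.
have [mu mu1 hm] := critical_mixed_gradients hf hg (BrU _ zB) fz gz cz.
apply: (he z ze fz gz mu 0 mu1); first by right.
move=> j; have -> : ((0 +i* 0)%C : C) = 0 by [].
exact: etrans (scale_gradients0 (z 0 j) (hm j)) (esym (mul0r _)).
Qed.

End RegularRadii.

(** * The fibration *)

Section MilnorFlow.
Variables (R : realType) (n : nat).
Local Notation C := (complexField R).
Variables (U : set 'rV[C]_n) (f g : 'rV[C]_n -> C) (r0 r : R).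
Hypotheses (hf : holomorphic_on U f) (hg : holomorphic_on U g).
Hypotheses (adm : admissible_radius U f g r0) (rpos : 0 < r) (rr0 : r <= r0).
Hypothesis noncritical : forall z, sphere_of r z -> f z != 0 -> g z != 0 ->
  exists2 v, tangent_sphere z v & log_arg_diff f g z v != 0.
Implicit Types (z v u : 'rV[C]_n).

Let dZ (F : 'rV[C]_n -> C) z c v : 'd F z (c *: v) = c * 'd F z v.
Proof. by rewrite linearZ. Qed.

Let Re_iM (x : C) : complex.Re ('i%C * x) = - complex.Im x.
Proof. by case: x => a b /=; ring. Qed.

Let Re_mul_quot (c x d : C) : x != 0 -> c * x * (d / x) = c * d.
Proof. by move=> x0; rewrite mulrA (mulrAC _ _ d) mulrK ?unitfE. Qed.

Let Re_combine (ga de x y p q : C) (c : R) : x != 0 -> y != 0 ->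
  ga * x = - ('i%C * c%:C%C) -> de * y = 'i%C * c%:C%C ->
  complex.Re (ga * p + de * q) = c * complex.Im (p / x - q / y).
Proof.
move=> x0 y0 hx hy; rewrite -(Re_mul_quot ga p x0) -(Re_mul_quot de q y0) hx hy.
by case: (p / x) (q / y) => [p1 p2] [q1 q2] /=; ring.
Qed.

Let form_real (l : 'rV[C]_n -> C) : (forall c v, l (c *: v) = c * l v) ->
  (forall v, complex.Re (l v) = 0) -> forall v, l v = 0.
Proof.
move=> lZ h v; have := h v; have := h ('i%C *: v); rewrite lZ Re_iM.
by case: (l v) => a b /= h1 ->; congr (_ +i* _)%C; lra.
Qed.

(** Transversality writes [z] as a kernel vector plus a tangent vector, and testing on the kernel
    vector gives [c0 = 0]; the remaining form is complex linear, so smoothness of the variety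
    concludes. If neither value vanishes, the form on tangent vectors is [c5] times the derivative
    of the argument, which is nonzero somewhere. *)
Lemma functionals_independent z (df dg : 'rV[C]_n -> C) (fz gz : C) (c0 c5 : R) (ga de : C) :
  (forall c v, df (c *: v) = c * df v) -> (forall c v, dg (c *: v) = c * dg v) ->
  dot (to_real z) (to_real z) != 0 ->
  (fz = 0 -> ~ (forall v, df v = 0)) -> (gz = 0 -> ~ (forall v, dg v = 0)) ->
  (fz = 0 -> gz = 0 -> lin_indep df dg) ->
  (fz = 0 -> transverse_at [set v | df v = 0] z) ->
  (gz = 0 -> transverse_at [set v | dg v = 0] z) ->
  (fz = 0 -> gz = 0 -> transverse_at [set v | df v = 0 /\ dg v = 0] z) ->
  (fz != 0 -> gz != 0 -> exists2 v, tangent_sphere z v &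
     complex.Im (df v / fz - dg v / gz) != 0) ->
  (forall v, c0 * dot (to_real z) (to_real v) + complex.Re (ga * df v + de * dg v) = 0) ->
  ga * fz = - ('i%C * c5%:C%C) -> de * gz = 'i%C * c5%:C%C ->
  [/\ c0 = 0, c5 = 0, ga = 0 & de = 0].
Proof.
move=> dfZ dgZ zz0 sf sg sfg tf tg tfg nc hv hfz hgz.
have i0 := imaginary_unit_neq0 R.
have i_c (c : R) : 'i%C * c%:C%C = 0 :> C -> c = 0.
  by move/eqP; rewrite mulf_eq0 (negbTE i0) => /eqP/complexI.
have c0E u v : tangent_sphere z v -> z = u + v -> complex.Re (ga * df u + de * dg u) = 0 ->
    c0 = 0.
  move=> /tangent_sphereE tv zE hu; have := hv u; rewrite hu addr0.
  have -> : dot (to_real z) (to_real u) = dot (to_real z) (to_real z).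
    by rewrite {3}zE to_realD dotDr tv addr0.
  by move/eqP; rewrite mulf_eq0 (negbTE zz0) orbF => /eqP.
have forms : c0 = 0 -> forall v, ga * df v + de * dg v = 0.
  move=> c00; apply: form_real => [c v|v]; last by have := hv v; rewrite c00 mul0r add0r.
  rewrite dfZ dgZ.
  by rewrite [RHS]mulrDr (mulrCA ga) (mulrCA de).
have cancel (F : 'rV[C]_n -> C) c : ~ (forall v, F v = 0) ->
    (forall v, c * F v = 0) -> c = 0.
  move=> dF h; apply/eqP/negPn/negP => c00; apply: dF => v; apply/eqP.
  by have /eqP := h v; rewrite mulf_eq0 (negbTE c00).
have [f0|f0] := eqVneq fz 0; have [g0|g0] := eqVneq gz 0.
- have c50 : c5 = 0 by apply: i_c; rewrite -hgz g0 mulr0.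
  have [u [v [[fu gu] tv zE]]] := tfg f0 g0 z.
  have c00 : c0 = 0.
    by apply: (c0E u v tv zE); rewrite fu gu !mulr0 addr0.
  by have [-> ->] := sfg f0 g0 ga de (forms c00).
- have c50 : c5 = 0.
    by apply: i_c; apply/eqP; rewrite -oppr_eq0 -hfz f0 mulr0.
  have de0 : de = 0.
    by move/eqP: hgz; rewrite c50 mulr0 mulf_eq0 (negbTE g0) orbF => /eqP.
  have [u [v [fu tv zE]]] := tf f0 z.
  have c00 : c0 = 0 by apply: (c0E u v tv zE); rewrite de0 fu mulr0 mul0r addr0.
  split => //; apply: (cancel _ _ (sf f0)) => v'.
  by have := forms c00 v'; rewrite de0 mul0r addr0.
- have c50 : c5 = 0 by apply: i_c; rewrite -hgz g0 mulr0.
  have ga0 : ga = 0.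
    by move/eqP: hfz; rewrite c50 mulr0 oppr0 mulf_eq0 (negbTE f0) orbF => /eqP.
  have [u [v [gu tv zE]]] := tg g0 z.
  have c00 : c0 = 0 by apply: (c0E u v tv zE); rewrite ga0 gu mulr0 mul0r addr0.
  split => //; apply: (cancel _ _ (sg g0)) => v'.
  by have := forms c00 v'; rewrite ga0 mul0r add0r.
have [v tv lv] := nc f0 g0.
have c50 : c5 = 0.
  have := hv v; move/tangent_sphereE: tv => ->; rewrite mulr0 add0r.
  rewrite (Re_combine _ _ f0 g0 hfz hgz) => /eqP.
  by rewrite mulf_eq0 (negbTE lv) orbF => /eqP.
have ga0 : ga = 0.
  by move/eqP: hfz; rewrite c50 mulr0 oppr0 mulf_eq0 (negbTE f0) orbF => /eqP.
have de0 : de = 0.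
  by move/eqP: hgz; rewrite c50 mulr0 mulf_eq0 (negbTE g0) orbF => /eqP.
split => //; have := hv z; rewrite ga0 de0 !mul0r addr0 /= addr0 => /eqP.
by rewrite mulf_eq0 (negbTE zz0) orbF => /eqP.
Qed.

Let Re_form (c1 c2 c3 c4 d p q p' q' : R) (X Y : C) :
  p = complex.Re X -> q = complex.Im X -> p' = complex.Re Y -> q' = complex.Im Y ->
  d + c1 * p + c2 * q + c3 * p' + c4 * q' = 0 ->
  d + complex.Re ((c1 -i* c2)%C * X + (c3 -i* c4)%C * Y) = 0.
Proof.
by move=> -> -> -> ->; case: X Y => [a b] [a' b'] /= h; rewrite -[RHS]h; ring.
Qed.

Let rotated_product (X Y X' Y' : C) (rho c s : R) :
  complex.Re X' * complex.Re Y' + complex.Im X' * complex.Im Y' =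
    rho * (c * (complex.Re X * complex.Re Y + complex.Im X * complex.Im Y)
           - s * (complex.Im X * complex.Re Y - complex.Re X * complex.Im Y)) ->
  complex.Im X' * complex.Re Y' - complex.Re X' * complex.Im Y' =
    rho * (s * (complex.Re X * complex.Re Y + complex.Im X * complex.Im Y)
           + c * (complex.Im X * complex.Re Y - complex.Re X * complex.Im Y)) ->
  X' * conjc Y' = rho%:C%C * (c +i* s)%C * (X * conjc Y).
Proof.
case: X Y X' Y' => [a b] [a' b'] [p q] [p' q'] /= h1 h2; congr (_ +i* _)%C.
  by transitivity (p * p' + q * q'); [ring|rewrite h1; ring].
by transitivity (q * p' - p * q'); [ring|rewrite h2; ring].
Qed.

Let S := @euclid_sphere R (n + n) r.

Let SE w : S w <-> sphere_of r (of_real w).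
Proof. by rewrite /S -{1}(of_realK w); split=> /sphere_ofE. Qed.

Let SU w : S w -> U (of_real w).
Proof.
move=> /SE Sw; have [_ BU _ _] := adm; apply: BU.
exact: sphere_sub_ball (ltW rpos) rr0 _ Sw.
Qed.

Lemma real_milnor_flow : exists Phi : R -> 'rV[R]_(n + n) -> 'rV[R]_(n + n),
  [/\ forall x, Phi 0 x = x,
      forall t x, S x -> S (Phi t x),
      forall s t x, Phi (s + t) x = Phi s (Phi t x),
      forall t x (e : R), 0 < e -> exists2 d : R, 0 < d &
        forall s y, `|s - t| < d -> `|y - x| < d -> `|Phi s y - Phi t x| < e &
      forall t x, S x -> exists2 rho : R, 0 < rho &
        mixed f g (of_real (Phi t x)) = rho%:C%C * (cos t +i* sin t)%C * mixed f g (of_real x)].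
Proof.
have cS : compact S by exact: euclid_sphere_compact.
have [l1 l2] := lipb_holomorphic hf cS SU; have [l3 l4] := lipb_holomorphic hg cS SU.
have lre F (j : 'I_(n + n)) : holomorphic_on U F ->
   lipb S (fun w => grad_re F (of_real w) 0 j) /\ lipb S (fun w => grad_im F (of_real w) 0 j).
  move=> hF; case: (split_ordP j) => k ->.
    have [h1 h2] := lipb_holomorphic (holomorphic_partial k hF) cS SU; split.
      by apply: lipb_eq h1 => w _; rewrite row_mxEl mxE.
    by apply: lipb_eq h2 => w _; rewrite row_mxEl mxE.
  have [h1 h2] := lipb_holomorphic (holomorphic_partial k hF) cS SU; split.
    by apply: lipb_eq (lipbN h2) => w _; rewrite row_mxEr mxE.
  by apply: lipb_eq h1 => w _; rewrite row_mxEr mxE.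
have hG F : holomorphic_on U F ->
   gradient_on_sphere r (fun w => complex.Re (F (of_real w))) (fun w => grad_re F (of_real w)) /\
   gradient_on_sphere r (fun w => complex.Im (F (of_real w))) (fun w => grad_im F (of_real w)).
  by move=> hF; split=> u du t /SU Su hu; have [h1 h2] := is_diff_grad hF Su;
    [exact: is_diff_curve h1 hu|exact: is_diff_curve h2 hu].
have ind w : S w -> forall c0 c1 c2 c3 c4 c5 : R,
  (forall i, c0 * w 0 i + c1 * grad_re f (of_real w) 0 i + c2 * grad_im f (of_real w) 0 i
    + c3 * grad_re g (of_real w) 0 i + c4 * grad_im g (of_real w) 0 i = 0) ->
  c1 * complex.Re (f (of_real w)) + c2 * complex.Im (f (of_real w)) = 0 ->
  c1 * complex.Im (f (of_real w)) - c2 * complex.Re (f (of_real w)) + c5 = 0 ->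
  c3 * complex.Re (g (of_real w)) + c4 * complex.Im (g (of_real w)) = 0 ->
  c3 * complex.Im (g (of_real w)) - c4 * complex.Re (g (of_real w)) - c5 = 0 ->
  [/\ c0 = 0, c1 = 0, c2 = 0, c3 = 0 & c4 = 0 /\ c5 = 0].
  move=> Sw c0 c1 c2 c3 c4 c5 hsum e1 e2 e3 e4; pose z := of_real w.
  have /SE Sz := Sw; have z0 := sphere_of_neq0 rpos Sz.
  have zz := dot_to_real_neq0 z0.
  have [_ _ sing transv] := adm.
  have zB : closed_ball_of r0 z by exact: sphere_sub_ball (ltW rpos) rr0 _ Sz.
  have [sf sg sfg] := sing z zB (elimN eqP z0).
  have [tf tg tfg] := transv r z (introT andP (conj rpos rr0)) Sz.
  have lc (x a b c d e : R) : c0 * a + c1 * b + c2 * c + c3 * d + c4 * e = 0 ->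
      c0 * (a * x) + c1 * (b * x) + c2 * (c * x) + c3 * (d * x) + c4 * (e * x) = 0.
    by move=> h; rewrite -[RHS](mul0r x) -h; ring.
  (* The real multipliers are paired into the complex coefficients [c1 - i c2] of df and [c3 - i c4]
     of dg. *)
  have hv v : c0 * dot (to_real z) (to_real v) +
      complex.Re ((c1 -i* c2)%C * 'd f z v + (c3 -i* c4)%C * 'd g z v) = 0.
    apply: (Re_form (dot_grad_re f z v) (dot_grad_im f z v) (dot_grad_re g z v) (dot_grad_im g z v)).
    rewrite /z of_realK /dot !mulr_sumr -!big_split big1 //= => i _.
    exact: lc (hsum i).
  have hfz : (c1 -i* c2)%C * f z = - ('i%C * c5%:C%C).
    by move: e1 e2; rewrite /z; case: (f _) => a b /= h1 h2; congr (_ +i* _)%C; lra.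
  have hgz : (c3 -i* c4)%C * g z = 'i%C * c5%:C%C.
    by move: e3 e4; rewrite /z; case: (g _) => a b /= h1 h2; congr (_ +i* _)%C; lra.
  have [-> -> [-> c20] [-> c40]] := functionals_independent (dZ f z) (dZ g z) zz sf sg sfg
    tf tg tfg (noncritical Sz) hv hfz hgz.
  by split => //; [|split => //]; apply/eqP; rewrite -oppr_eq0; apply/eqP.
have [Phi [P0 PS Padd Pc Prho]] := @rotating_flow R (n + n) r rpos
  (fun w => complex.Re (f (of_real w))) (fun w => complex.Im (f (of_real w)))
  (fun w => complex.Re (g (of_real w))) (fun w => complex.Im (g (of_real w)))
  (fun w => grad_re f (of_real w)) (fun w => grad_im f (of_real w))
  (fun w => grad_re g (of_real w)) (fun w => grad_im g (of_real w)) l1 l2 l3 l4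
  (fun j => (lre f j hf).1) (fun j => (lre f j hf).2)
  (fun j => (lre g j hg).1) (fun j => (lre g j hg).2)
  (hG f hf).1 (hG f hf).2 (hG g hg).1 (hG g hg).2 ind.
exists Phi; split => // t x Sx; have [rho rho0 [h1 h2]] := Prho t x Sx.
by exists rho => //; exact: rotated_product h1 h2.
Qed.

End MilnorFlow.

(** * Points of the sphere off the zero set of [H] *)

Section NonemptyDomain.
Variables (R : realType) (n : nat).
Local Notation C := (complexField R).
Variables (U : set 'rV[C]_n) (f g : 'rV[C]_n -> C) (r0 r : R).
Hypotheses (hf : holomorphic_on U f) (hg : holomorphic_on U g).
Hypotheses (adm : admissible_radius U f g r0) (rpos : 0 < r) (rr0 : r <= r0).
Implicit Types (z v u : 'rV[C]_n).

Lemma nonzero_near (h : R -> R) (d : R) : is_derive (0 : R) (1 : R) h d -> h 0 != 0 \/ d != 0 ->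
  \forall t \near 0^', h t != 0.
Proof.
move=> hd; have [h0|h0 _] := eqVneq (h 0) 0; last first.
  have ch := is_derive_continuous hd.
  apply: cvg_within; move: ch => /cvgrPdist_lt/(_ `|h 0|); rewrite normr_gt0 => /(_ h0).
  apply: filterS => t ht; apply/negP => /eqP ht0.
  by move: ht; rewrite ht0 subr0 ltxx.
case=> [/negP //|d0].
have [dh dE] := hd.
have : (fun t : R => t^-1 *: (h (t *: 1 + 0) - h 0)) @ 0^' --> d.
  by rewrite -dE; exact: dh.
move=> /cvgrPdist_lt/(_ `|d|); rewrite normr_gt0 => /(_ d0).
apply: filterS => t; rewrite h0 subr0 addr0 /GRing.scale /= mulr1 => ht.
by apply/negP => /eqP ht0; move: ht; rewrite ht0 mulr0 subr0 ltxx.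
Qed.

(** A complex linear form that vanishes on the tangent space vanishes at i z, which is tangent,
    hence at [z], hence everywhere. *)
Let form_tangent z (l : 'rV[C]_n -> C) : z != 0 -> (forall c v, l (c *: v) = c * l v) ->
  (forall u v, l (u + v) = l u + l v) -> ~ (forall v, l v = 0) ->
  exists2 v, tangent_sphere z v & l v != 0.
Proof.
move=> z0 lZ lD ln; apply: contrapT => hno; apply: ln.
have l0 v : tangent_sphere z v -> l v = 0.
  by move=> tv; apply/eqP/negPn/negP => lv; apply: hno; exists v.
have w0 := dot_to_real_neq0 z0.
have i0 := imaginary_unit_neq0 R.
have lz : l z = 0.
  have : l ('i%C *: z) = 0.
    apply/l0/tangent_sphereE; rewrite dot_to_real big1 // => j _; rewrite mxE.
    by case: (z 0 j) => a b /=; ring.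
  by rewrite lZ => /eqP; rewrite mulf_eq0 (negbTE i0) => /eqP.
move=> v; pose t := dot (to_real z) (to_real v) / dot (to_real z) (to_real z).
have := l0 (v + (- t)%:C%C *: z); rewrite lD lZ lz mulr0 addr0; apply.
apply/tangent_sphereE; rewrite to_realD to_realZ dotDr.
rewrite -[X in dot X (_ *: _)]scale1r dotZ mul1r mulNr /t divfK //.
by rewrite subrr.
Qed.

(** If each of two directions works for one form only, their sum works for both. *)
Let common_direction z (df dg : 'rV[C]_n -> C) (A B : Prop) :
  (forall u v, df (u + v) = df u + df v) -> (forall u v, dg (u + v) = dg u + dg v) ->
  A \/ B ->
  (A -> exists2 v, tangent_sphere z v & df v != 0) ->
  (B -> exists2 v, tangent_sphere z v & dg v != 0) ->
  exists2 v, tangent_sphere z v & (A -> df v != 0) /\ (B -> dg v != 0).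
Proof.
move=> dfD dgD AB hA hB.
have [a|na] := pselect A; last first.
  by have [|v tv lv] := hB; [case: AB|exists v].
have [v1 t1 l1] := hA a.
have [b|nb] := pselect B; last by exists v1.
have [v2 t2 l2] := hB b.
have [e1|e1] := eqVneq (dg v1) 0; last by exists v1.
have [e2|e2] := eqVneq (df v2) 0; last by exists v2.
exists (v1 + v2); last by rewrite dfD dgD e1 e2 addr0 add0r.
move: t1 t2 => /tangent_sphereE t1 /tangent_sphereE t2; apply/tangent_sphereE.
by rewrite to_realD dotDr t1 t2 addr0.
Qed.

Let dD (F : 'rV[C]_n -> C) z u v : 'd F z (u + v) = 'd F z u + 'd F z v.
Proof. by rewrite linearD. Qed.

Let dZ (F : 'rV[C]_n -> C) z c v : 'd F z (c *: v) = c * 'd F z v.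
Proof. by rewrite linearZ. Qed.

Let nonzero_on_curve (F : 'rV[C]_n -> C) (u : R -> 'rV[R]_(n + n)) v :
  holomorphic_on U F -> U (of_real (u 0)) ->
  (forall j, is_derive (0 : R) (1 : R) (fun t => u t 0 j) (to_real v 0 j)) ->
  (F (of_real (u 0)) = 0 -> 'd F (of_real (u 0)) v != 0) ->
  \forall t \near 0^', F (of_real (u t)) != 0.
Proof.
move=> hF Uu hu hv; have [h1 h2] := is_diff_grad hF Uu.
have d1 := is_diff_curve h1 hu; have d2 := is_diff_curve h2 hu.
rewrite dot_grad_re in d1; rewrite dot_grad_im in d2.
have nz (x : C) : x != 0 -> complex.Re x != 0 \/ complex.Im x != 0.
  case: x => a b ab; have [a0|a0] := eqVneq a 0; last by left.
  by right; apply: contra ab => /eqP /= ->; rewrite a0.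
have : (complex.Re (F (of_real (u 0))) != 0 \/ complex.Re ('d F (of_real (u 0)) v) != 0) \/
   (complex.Im (F (of_real (u 0))) != 0 \/ complex.Im ('d F (of_real (u 0)) v) != 0).
  have [F0|/nz[]] := eqVneq (F (of_real (u 0))) 0; [|by auto|by auto].
  by case: (nz _ (hv F0)); auto.
case=> [/(nonzero_near d1)|/(nonzero_near d2)]; apply: filterS => t.
  by apply: contra => /eqP ->.
by apply: contra => /eqP ->.
Qed.

(** Surjectivity onto the circle requires a point with [H] nonzero. If [f] or [g] vanishes at a
    chosen point, a great circle leaves it in a direction along which the vanishing functions have
    nonzero derivative. *)
Lemma milnor_domain_nonempty : (0 < n)%N -> exists z, milnor_domain f g r z.
Proof.
move=> n0; pose z : 'rV[C]_n := r%:C%C *: delta_mx 0 (Ordinal n0).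
have Sz : sphere_of r z.
  apply/sphere_ofE; rewrite /euclid_sphere /= dot_to_real (bigD1 (Ordinal n0)) //=.
  rewrite big1 ?addr0 => [|j jn]; first by rewrite !mxE !eqxx mulr1 /= mulr0 addr0 expr2.
  by rewrite !mxE (negbTE jn) andbF mulr0 /= mulr0 addr0.
have z0 := sphere_of_neq0 rpos Sz.
have dom y : sphere_of r y -> f y != 0 -> g y != 0 -> milnor_domain f g r y.
  move=> Sy fy gy; split => // -[_ /= H0].
  by have := mixed_eq0 f g y; rewrite H0 eqxx (negbTE fy) (negbTE gy).
have : (f z = 0 \/ g z = 0) \/ f z != 0 /\ g z != 0.
  by have [|] := eqVneq (f z) 0; have [|] := eqVneq (g z) 0; auto.
case=> [h|[fz gz]]; last by exists z; exact: dom.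
have [_ BU sing _] := adm.
have zB : closed_ball_of r0 z by exact: sphere_sub_ball (ltW rpos) rr0 _ Sz.
have [sf sg _] := sing z zB (elimN eqP z0).
have [v tv [hfv hgv]] := common_direction (dD f z) (dD g z) h
  (fun e => form_tangent z0 (dZ f z) (dD f z) (sf e))
  (fun e => form_tangent z0 (dZ g z) (dD g z) (sg e)).
have v0 : v != 0.
  apply/negP => /eqP v0; rewrite v0 in hfv hgv.
  have d0 F : 'd F z 0 = 0 by rewrite linear0.
  by case: h => [/hfv|/hgv]; rewrite d0 eqxx.
pose N := Num.sqrt (dot (to_real v) (to_real v)).
have N0 : 0 < N.
  rewrite sqrtr_gt0; apply: lt_le_trans (rnorm_le_dot v).
  by rewrite exprn_gt0 // rnorm_gt0.
pose x := (r / N)%:C%C *: v.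
have rN0 : (r / N)%:C%C != 0 :> C.
  by rewrite -rnorm_eq0 rnorm_real normr_eq0 gt_eqF // divr_gt0.
(* The great circle through [z] with initial velocity [x], which is [v] rescaled to length [r]. *)
pose u (t : R) := cos t *: to_real z + sin t *: to_real x.
have u0 : u 0 = to_real z by rewrite /u cos0 sin0 scale1r scale0r addr0.
have hu j : is_derive (0 : R) (1 : R) (fun t => u t 0 j) (to_real x 0 j).
  have -> : (fun t => u t 0 j) = (fun t => cos t * to_real z 0 j + sin t * to_real x 0 j).
    have coordE (a b : R) (y y' : 'rV[R]_(n + n)) : (a *: y + b *: y') 0 j = a * y 0 j + b * y' 0 j.
      by rewrite !mxE.
    by apply/funext => t; exact: coordE.
  have h1 := is_derive_mul (is_derive_cos (0 : R)) (is_derive_cst (to_real z 0 j) (0 : R) (1 : R)).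
  have h2 := is_derive_mul (is_derive_sin (0 : R)) (is_derive_cst (to_real x 0 j) (0 : R) (1 : R)).
  apply: (@is_derive_eq _ _ _ _ _ _ _ _ (is_deriveD h1 h2)).
  by rewrite cos0 sin0 oppr0 !mulr0 !mul0r mul1r !addr0 add0r.
have Su t : sphere_of r (of_real (u t)).
  apply/sphere_ofE; rewrite of_realK /euclid_sphere /= /u dotDr.
  rewrite (dotC (_ + _)) dotDr (dotC (_ + _)) dotDr !dotZ.
  have zz : dot (to_real z) (to_real z) = r ^+ 2 by move/sphere_ofE: Sz.
  have zx : dot (to_real z) (to_real x) = 0.
    rewrite /x to_realZ -[to_real z]scale1r dotZ.
    by move/tangent_sphereE: tv => ->; rewrite mulr0.
  have xx : dot (to_real x) (to_real x) = r ^+ 2.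
    rewrite /x to_realZ dotZ -[dot _ _]sqr_sqrtr ?dot_ge0 // -/N.
    by field; rewrite gt_eqF.
  rewrite (dotC (to_real x)) zz zx xx !mulr0 addr0 add0r -mulrDl -!expr2.
  by rewrite cos2Dsin2 mul1r.
have Uz : U (of_real (u 0)) by rewrite u0 to_realK; exact: BU.
have nf := nonzero_on_curve hf Uz hu.
have ng := nonzero_on_curve hg Uz hu.
have {}nf : \forall t \near 0^', f (of_real (u t)) != 0.
  apply: nf; rewrite u0 to_realK => /hfv h1.
  have e : 'd f z x = (r / N)%:C%C * 'd f z v := dZ f z _ v.
  by rewrite e mulf_neq0.
have {}ng : \forall t \near 0^', g (of_real (u t)) != 0.
  apply: ng; rewrite u0 to_realK => /hgv h1.
  have e : 'd g z x = (r / N)%:C%C * 'd g z v := dZ g z _ v.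
  by rewrite e mulf_neq0.
case: (@filter_ex _ _ (Proper_dnbhs_numFieldType (0 : R)) _ (filterI nf ng)) => t [ft gt].
by exists (of_real (u t)); exact: dom.
Qed.

End NonemptyDomain.

(** * Angles on the unit circle *)

Section Circle.
Variable R : realType.
Local Notation C := (complexField R).

Definition cis (t : R) : C := (cos t +i* sin t)%C.

Lemma cisD s t : cis (s + t) = cis s * cis t.
Proof. by rewrite /cis cosD sinD; congr (_ +i* _)%C; ring. Qed.

Lemma cis0 : cis 0 = 1.
Proof. by rewrite /cis cos0 sin0. Qed.

Lemma cisNM t : cis (- t) * cis t = 1.
Proof. by rewrite -cisD addNr cis0. Qed.

Lemma rnorm_cis t : rnorm (cis t) = 1.
Proof. by rewrite rnormE /= cos2Dsin2 sqrtr1. Qed.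

Lemma cis_surj (c : C) : rnorm c = 1 -> exists t, cis t = c.
Proof.
move=> c1; have := rnorm_sqr c; rewrite c1 expr1n; case: c {c1} => p q /= pq.
have pB : -1 <= p <= 1 by rewrite -ler_norml -(@ler_pXn2r _ 2) ?nnegrE // expr1n real_normK ?num_real // pq lerDl sqr_ge0.
have [cp sp] : cos (acos p) = p /\ sin (acos p) = `|q|.
  split; first by rewrite acosK // in_itv.
  by rewrite sin_acos // pq addrC addKr sqrtr_sqr.
have [q0|q0] := leP 0 q.
  by exists (acos p); rewrite /cis cp sp ger0_norm.
by exists (- acos p); rewrite /cis cosN sinN cp sp ltr0_norm // opprK.
Qed.

Lemma cis_atan (x : C) : rnorm x = 1 -> 0 < complex.Re x ->
  cis (atan (complex.Im x / complex.Re x)) = x.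
Proof.
move=> x1; have := rnorm_sqr x; rewrite x1 expr1n; case: x {x1} => p q /= pq p0.
have cE : cos (atan (q / p)) = p.
  rewrite cos_atan (_ : 1 + (q / p) ^+ 2 = p^-1 ^+ 2).
    by rewrite sqrtr_sqr ger0_norm ?invrK // invr_ge0 ltW.
  by rewrite exprMn -[X in X + _](divff (expf_neq0 2 (lt0r_neq0 p0))) exprVn -mulrDl -pq mul1r.
have := atanK (q / p); rewrite /tan cE => /(congr1 (fun x => x * p)).
rewrite !divfK ?gt_eqF // => sE.
by rewrite /cis cE sE.
Qed.

(** The branch of the argument of [y / c] that is continuous on the open half circle centred at
    [c]. *)
Definition arg_near (c : C) (y : C) : R :=
  atan (complex.Im (y * conjc c) / complex.Re (y * conjc c)).

Lemma mul_conjc_unit (c : C) : rnorm c = 1 -> c * conjc c = 1.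
Proof.
move=> c1; have := rnorm_sqr c; rewrite c1 expr1n; case: c {c1} => p q /= h.
by congr (_ +i* _)%C; [rewrite h; ring|ring].
Qed.

Lemma cis_arg_near (c y : C) : rnorm c = 1 -> rnorm y = 1 -> 0 < complex.Re (y * conjc c) ->
  c * cis (arg_near c y) = y.
Proof.
move=> c1 y1 h; rewrite cis_atan //; last by rewrite rnormM rnorm_conjc y1 c1 mul1r.
by rewrite mulrCA mul_conjc_unit // mulr1.
Qed.

Section Limits.
Variables (T : Type) (F : set_system T) (FF : Filter F) (u : T -> C) (c y : C).
Hypotheses (c1 : rnorm c = 1) (uy : u @ F --> y).

Lemma Re_Im_mul_cvg : (fun t => complex.Re (u t * conjc c)) @ F --> complex.Re (y * conjc c) /\
  (fun t => complex.Im (u t * conjc c)) @ F --> complex.Im (y * conjc c).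
Proof.
have h (e : R) : 0 < e -> \forall t \near F, rnorm (y * conjc c - u t * conjc c) < e.
  move=> e0; apply: filterS (@cvg_rnorm _ _ F FF _ u y uy e e0) => t.
  by rewrite -mulrBl rnormM rnorm_conjc c1 mulr1 rnormB.
split; apply/cvgrPdist_lt => e /h; apply: filterS => x; apply: le_lt_trans.
  by rewrite -raddfB; exact: Re_le_rnorm.
by rewrite -raddfB; exact: Im_le_rnorm.
Qed.

Hypothesis yc : 0 < complex.Re (y * conjc c).

Lemma arg_near_cvg : (fun t => arg_near c (u t)) @ F --> arg_near c y.
Proof.
have [h1 h2] := Re_Im_mul_cvg.
have h3 : (fun t => complex.Im (u t * conjc c) / complex.Re (u t * conjc c)) @ F -->
    complex.Im (y * conjc c) / complex.Re (y * conjc c).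
  by apply: (cvgM h2); apply: cvgV => //; rewrite gt_eqF.
by apply: continuous_cvg h3; exact: continuous_atan.
Qed.

Lemma near_half_plane : \forall t \near F, 0 < complex.Re (u t * conjc c).
Proof. by have [h1 _] := Re_Im_mul_cvg; exact: cvgr_gt h1 _ yc. Qed.

End Limits.

End Circle.

(** * Local triviality from a rotating flow *)

Section FlowFibration.
Variables (R : realType) (n : nat).
Local Notation C := (complexField R).
Variables (E : set 'rV[C]_n) (phi : 'rV[C]_n -> C) (Psi : R -> 'rV[C]_n -> 'rV[C]_n).
Implicit Types (z x : 'rV[C]_n).
Hypotheses (phic : {within E, continuous phi}) (phi1 : forall z, E z -> rnorm (phi z) = 1).
Hypotheses (E0 : exists z, E z) (PsiE : forall t z, E z -> E (Psi t z)).
Hypotheses (Psi0 : forall z, Psi 0 z = z) (PsiD : forall s t z, Psi (s + t) z = Psi s (Psi t z)).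
Hypothesis phi_Psi : forall t z, E z -> phi (Psi t z) = cis t * phi z.
Hypothesis Psic : forall t z (e : R), 0 < e -> exists2 d : R, 0 < d &
  forall s y, `|s - t| < d -> rnorm (y - z) < d -> rnorm (Psi s y - Psi t z) < e.

Let fibre : set 'rV[C]_n := [set z | E z /\ phi z = 1].
Let F := initial_topology (val : {z | z \in fibre} -> 'rV[C]_n).

Let cvg_fibre (T : Type) (G : set_system T) {FG : Filter G} (h : T -> F) (s : F) :
  (fun t => val (h t)) @ G --> val s -> h @ G --> s.
Proof.
move=> hG A [B [[V Vop <-] Vs BA]].
apply: (filterS (fun t (Vt : V (val (h t))) => BA (h t) Vt)).
by apply: (hG V); exact: open_nbhs_nbhs.
Qed.

Let flow_cvg (T : Type) (G : set_system T) {FG : Filter G} (a : T -> R) (u : T -> 'rV[C]_n)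
    (t : R) z : a @ G --> t -> u @ G --> z -> (fun i1 => Psi (a i1) (u i1)) @ G --> Psi t z.
Proof.
move=> at_ uz; apply: rnorm_cvg => e e0; have [d d0 hd] := Psic t z e0.
have h1 := @cvg_rnorm R T G FG _ u z uz d d0.
have /cvgrPdist_lt/(_ d d0) h2 := at_.
by apply: filterS2 h1 h2 => x h3 h4; apply: hd => //; rewrite distrC.
Qed.

(** The typical fibre is the one over 1, with the subspace topology. Over the half circle centred at
    [c], flowing for minus the argument carries each fibre onto it, and flowing back is the
    inverse. *)
Lemma flow_fibration : locally_trivial_fibration E (@unit_circle R) phi.
Proof.
have unitE (c : C) : unit_circle c <-> rnorm c = 1.
  by rewrite /unit_circle /= normE; split=> [/complexI|->].
have [z0 Ez0] := E0; have [a0 ha0] := cis_surj (phi1 Ez0).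
have on_fibre t z : E z -> cis t = phi z -> Psi (- t) z \in fibre.
  move=> Ez tz; apply/mem_set; split; first exact: PsiE.
  by rewrite phi_Psi // -tz cisNM.
pose t0 : {z | z \in fibre} :=
  exist (fun z => z \in fibre) _ (on_fibre _ _ Ez0 ha0).
split=> //; split.
  apply/seteqP; split=> [_ [z Ez <-]|c /unitE c1]; first exact/unitE/phi1.
  have [b hb] := cis_surj c1; exists (Psi (b - a0) z0); first exact: PsiE.
  by rewrite phi_Psi // -ha0 -cisD subrK.
exists F => c /unitE c1; have [a ha] := cis_surj c1.
pose W : set C := [set y | 0 < complex.Re (y * conjc c)].
pose theta y : R := a + arg_near c y.
have thetaE y : rnorm y = 1 -> W y -> cis (theta y) = y.
  by move=> y1 Wy; rewrite /theta cisD ha cis_arg_near.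
have theta_cvg (T : Type) (G : set_system T) (FG : Filter G) (u : T -> C) y : W y -> u @ G --> y ->
    (fun t => theta (u t)) @ G --> theta y.
  move=> Wy uy; apply: cvgD; first exact: cvg_cst.
  exact: arg_near_cvg.
exists W; split.
- by rewrite openE => y Wy; apply: (near_half_plane (nbhs_filter y) c1 _ Wy).
- by rewrite /W /= mul_conjc_unit.
(* [insubd] makes the first map total: it returns the point [t0] where the flow does not end on the
   fibre, which does not happen for points of [E] over [W]. *)
exists (fun x => insubd t0 (Psi (- theta (phi x)) x)), (fun yt => Psi (theta yt.1) (val yt.2)).
have valh x : E x -> W (phi x) ->
    val (insubd t0 (Psi (- theta (phi x)) x)) = Psi (- theta (phi x)) x.
  by move=> Ex Wx; rewrite insubdK // on_fibre // thetaE // phi1.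
split.
- apply/subspace_continuousP => x [Ex Wx]; apply: cvg_fibre; rewrite valh //.
  have cphi : phi @ within (E `&` phi @^-1` W) (nbhs x) --> phi x.
    have /subspace_continuousP/(_ x Ex) := phic.
    by apply: cvg_trans; apply: cvg_app; apply: within_subset => y [].
  have h1 : (fun y => - theta (phi y)) @ within (E `&` phi @^-1` W) (nbhs x) --> - theta (phi x).
    by apply: cvgN; exact: theta_cvg.
  have h2 : id @ within (E `&` phi @^-1` W) (nbhs x) --> x by apply: cvg_within.
  apply: cvg_trans (flow_cvg h1 h2); apply: near_eq_cvg.
  by apply: filterS (withinT (E `&` phi @^-1` W) (nbhs_filter x)) => y [Ey Wy]; rewrite valh.
- apply/subspace_continuousP => -[y s] [[/= _ Wy] _].
  apply: flow_cvg.
    apply: theta_cvg => //.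
    by apply: cvg_trans (cvg_fst (F := nbhs y) (G := nbhs s)); apply: cvg_app; exact: cvg_within.
  move=> A As; have vA : nbhs (s : F) (fun s' => A (val s')).
    exact: (@initial_continuous _ _ val (s : F) A As).
  have hA : nbhs ((y, s) : C * F) (fun yt => A (val yt.2)).
    exact: (@cvg_snd _ _ (nbhs y) (nbhs (s : F)) _ _ vA).
  by apply: filterS hA => yt Ayt _.
- by move=> x Ex Wx; rewrite /= valh // -PsiD addrN Psi0.
move=> y s /unitE y1 Wy /=.
have [Es s1] : fibre (val s) by apply: set_mem; exact: (valP s).
have Ek := PsiE (theta y) Es.
have pk : phi (Psi (theta y) (val s)) = y by rewrite phi_Psi // s1 mulr1 thetaE.
split => //; apply: val_inj; rewrite [LHS]valh ?pk // -PsiD addNr; exact: Psi0.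
Qed.

End FlowFibration.

Fact cancel_scale (K : fieldType) (a e x b : K) : a != 0 -> a * e * x / (a * b) = e * (x / b).
Proof.
by move=> a0; rewrite invfM -[RHS]mul1r -(divff a0); ring.
Qed.

(** * The fibration of the sphere *)

Section MilnorFibration.
Variables (R : realType) (n : nat).
Local Notation C := (complexField R).
Variables (U : set 'rV[C]_n) (f g : 'rV[C]_n -> C) (r0 r : R).
Hypotheses (hf : holomorphic_on U f) (hg : holomorphic_on U g).
Hypotheses (adm : admissible_radius U f g r0) (rpos : 0 < r) (rr0 : r <= r0).
Hypothesis noncritical : forall z, sphere_of r z -> f z != 0 -> g z != 0 ->
  exists2 v, tangent_sphere z v & log_arg_diff f g z v != 0.

Lemma milnor_domainE z : milnor_domain f g r z <-> sphere_of r z /\ mixed f g z != 0.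
Proof.
split=> [[Sz H]|[Sz /eqP H]]; split=> //; last by case.
by apply/negP => /eqP H0; apply: H.
Qed.

Lemma milnor_map_cvg z : U z -> mixed f g z != 0 -> milnor_map f g @ z --> milnor_map f g z.
Proof.
move=> Uz H0.
have cF F : holomorphic_on U F -> F @ z --> F z.
  move=> hF; have [s [K [_ _ dF _ _]]] := holomorphic_taylor hF Uz.
  exact: differentiable_continuous dF.
have cconj (u : 'rV[C]_n -> C) (l : C) : u @ z --> l -> (fun x => conjc (u x) : C) @ z --> (conjc l : C).
  move=> ul; apply: (@rnorm_cvg _ _ (nbhs z) (nbhs_filter z)) => e e0.
  apply: filterS (@cvg_rnorm _ _ (nbhs z) (nbhs_filter z) _ u l ul e e0) => x.
  by rewrite -rmorphB rnorm_conjc.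
have cnorm (u : 'rV[C]_n -> C) (l : C) : u @ z --> l -> (fun x => `|u x| : C) @ z --> (`|l| : C).
  move=> ul; apply: (@rnorm_cvg _ _ (nbhs z) (nbhs_filter z)) => e e0.
  apply: filterS (@cvg_rnorm _ _ (nbhs z) (nbhs_filter z) _ u l ul e e0) => x.
  apply: le_lt_trans; have := ler_dist_dist (u x) l.
  by rewrite [X in X <= _]normE [X in _ <= X]normE lecR.
have cm : mixed f g @ z --> mixed f g z.
  exact: (@ccvgM _ _ (nbhs z) (nbhs_filter z) _ _ _ _ (cF f hf) (cconj _ _ (cF g hg))).
apply: (@ccvgM _ _ (nbhs z) (nbhs_filter z) _ _ _ _ cm).
apply: (@ccvgV _ _ (nbhs z) (nbhs_filter z)); last exact: cnorm.
by rewrite normr_eq0.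
Qed.

Let scale_quot (rho : R) (e x : C) : 0 < rho -> rnorm e = 1 ->
  rho%:C%C * e * x / `|rho%:C%C * e * x| = e * (x / `|x|).
Proof.
move=> rho0 e1; have ne : `|e| = 1 by rewrite normE e1.
have nr : `|rho%:C%C : C| = rho%:C%C by rewrite normE rnorm_real gtr0_norm.
rewrite !normrM ne nr mulr1.
have rn : (rho%:C%C : C) != 0 by rewrite -rnorm_eq0 rnorm_real normr_eq0 gt_eqF.
exact: cancel_scale rn.
Qed.

(** Along the flow [H] is multiplied by a positive real and a rotation: the former keeps it nonzero
    and cancels in H / |H|, so the phase turns exactly by the elapsed time. *)
Lemma milnor_fibration : (0 < n)%N ->
  locally_trivial_fibration (milnor_domain f g r) (@unit_circle R) (milnor_map f g).
Proof.
move=> n0.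
have [Phi [P0 PS Padd Pc Prho]] := real_milnor_flow hf hg adm rpos rr0 noncritical.
pose Psi t z := of_real (Phi t (to_real z)).
have SU z : sphere_of r z -> U z.
  by have [_ BU _ _] := adm => Sz; apply: BU; exact: sphere_sub_ball (ltW rpos) rr0 _ Sz.
have PsiS t z : sphere_of r z -> sphere_of r (Psi t z).
  by move=> /sphere_ofE Sz; apply/sphere_ofE; rewrite of_realK; exact: PS.
have Psi_mixed t z : sphere_of r z -> exists2 rho : R, 0 < rho &
    mixed f g (Psi t z) = rho%:C%C * cis t * mixed f g z.
  move=> /sphere_ofE Sz; have [rho rho0 h] := Prho t _ Sz.
  by exists rho => //; rewrite to_realK in h.
apply: (@flow_fibration R n _ _ Psi).
- apply/subspace_continuousP => z /milnor_domainE[Sz H0].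
  by apply: cvg_within_filter; exact: milnor_map_cvg (SU _ Sz) H0.
- by move=> z /milnor_domainE[_ H0]; exact: rnorm_milnor.
- exact: milnor_domain_nonempty hf hg adm rpos rr0 n0.
- move=> t z /milnor_domainE[Sz H0]; apply/milnor_domainE; split; first exact: PsiS.
  have [rho rho0 ->] := Psi_mixed t z Sz.
  rewrite -rnorm_eq0 rnormM rnormM rnorm_real rnorm_cis mulr1 (gtr0_norm rho0); apply: mulf_neq0.
    by rewrite gt_eqF.
  by rewrite rnorm_eq0.
- by move=> z; rewrite /Psi P0 to_realK.
- by move=> s t z; rewrite /Psi Padd of_realK.
- move=> t z /milnor_domainE[Sz H0]; have [rho rho0 e] := Psi_mixed t z Sz.
  by rewrite /milnor_map e; apply: scale_quot => //; exact: rnorm_cis.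
move=> t z e e0; have e2 : 0 < e / 2 by rewrite divr_gt0.
have [d d0 hd] := Pc t (to_real z) _ e2; exists d => // s y st yz.
rewrite /Psi -of_realB; apply: le_lt_trans (rnorm_of_real _) _.
have h : `|to_real y - to_real z| <= rnorm (y - z).
  rewrite -[X in `|X|]of_realK of_realB !to_realK.
  apply: row_norm_le => [|j]; first exact: rnorm_ge0.
  case: (split_ordP j) => k ->.
    rewrite row_mxEl mxE; apply: le_trans (Re_le_rnorm _) _; exact: rnorm_coord.
  rewrite row_mxEr mxE; apply: le_trans (Im_le_rnorm _) _; exact: rnorm_coord.
by have := hd s (to_real y) st (le_lt_trans h yz); lra.
Qed.

End MilnorFibration.

Theorem corollary12 (R : realType) (n : nat) (hn : (2 <= n)%N)
    (U : set 'rV[complexField R]_n) (openU : open U) (U0 : U 0)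
    (f g : 'rV[complexField R]_n -> complexField R)
    (hol_f : holomorphic_on U f) (hol_g : holomorphic_on U g)
    (f0 : f 0 = 0) (g0 : g 0 = 0)
    (a b : multi_index n -> complexField R)
    (taylor_f : has_power_series f 0 a) (taylor_g : has_power_series g 0 b)
    (convenient_f : convenient a) (convenient_g : convenient b)
    (non_degenerate_f : non_degenerate a) (non_degenerate_g : non_degenerate b)
    (complete_intersection : non_degenerate_complete_intersection a b)
    (multiplicity : newton_multiplicity_condition a b)
    (r0 : R) (hr0 : admissible_radius U f g r0) :
  (exists r3 r2 : R,
     [/\ 0 < r3, 0 < r2,
         no_critical_points_upto U f g r3 &
         below_regular_radius f g r0 r2]) /\
  (forall r3 r2 : R, 0 < r3 -> 0 < r2 ->
     no_critical_points_upto U f g r3 ->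
     below_regular_radius f g r0 r2 ->
     forall r : R, 0 < r -> r <= Num.min r3 r2 ->
       locally_trivial_fibration
         (milnor_domain f g r) (@unit_circle R) (milnor_map f g)).
Proof.
split.
  have [r00 BU _ _] := hr0.
  have [r [rpos rr0 nc zc]] := regular_radii hol_f hol_g f0 g0 taylor_f taylor_g convenient_f
    convenient_g non_degenerate_f non_degenerate_g complete_intersection multiplicity r00 BU U0.
  (* The same radius is taken as [r3], as [r2] and as the witness [r1]. *)
  by exists r, r; split => //; exists r; split.
(* For arbitrary radii, [r <= r2 <= r1 <= r0] supplies the transversality of the sphere, and
   [r <= r3] the absence of critical points. *)
move=> r3 r2 _ _ [BU nc] [r1 [_ r10 _ r21]] r rpos; rewrite le_min => /andP[r_r3 r_r2].
have rr0 : r <= r0 by exact: le_trans (le_trans r_r2 r21) r10.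
apply: (milnor_fibration hol_f hol_g hr0 rpos rr0); last exact: ltnW.
move=> z Sz fz gz; have [_ BU0 _ _] := hr0.
have Uz : U z by apply: BU0; exact: sphere_sub_ball (ltW rpos) rr0 _ Sz.
apply: (noncritical_milnor hol_f hol_g Uz fz gz).1.
apply: (nc r); first by rewrite rpos.
by apply/milnor_domainE; rewrite mixed_eq0 negb_or fz.
Qed.
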